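(* In the setting described in the context, assume that $\mathcal{A}$ is strongly monotone, i.e. there exists $\alpha>0$ such that $$(\mathcal{A}(w_1)-\mathcal{A}(w_2),w_1-w_2)_H\geq \alpha\|w_1-w_2\|_H^2\quad\text{for all } w_1,w_2\in\mathcal{D}(\mathcal{A}),$$ and that $\mathcal{M}\in\mathcal{C}^1(H,Z)$ satisfies $\mathcal{M}(0)=0$ and $\mathrm{d}\mathcal{M}(w)\mathcal{A}(w)+Cw=0$ for all $w\in\mathcal{D}(\mathcal{A})$. Assume moreover that $\mathrm{d}\mathcal{M}:H\to\mathcal{L}(H,Z)$ is locally Lipschitz continuous. For $[d,y_{\mathrm{ref}}]\in H\times Z$ consider the closed-loop system $$\frac{\mathrm{d}w}{\mathrm{d}t}+\mathcal{A}(w)=BB^*\mathrm{d}\mathcal{M}(w)^*[z-\mathcal{M}(w)]+d,\qquad \frac{\mathrm{d}z}{\mathrm{d}t}=Cw-y_{\mathrm{ref}}. \qquad (\ast)$$ Then: (i) For all $[d,y_{\mathrm{ref}}]\in H\times Z$ and all $[w_0,z_0]\in H\times Z$, the system $(\ast)$ admits a unique maximal weak solution $[w,z]$ satisfying the initial condition $[w(0),z(0)]=[w_0,z_0]$ and defined on $[0,T_{\max})$ for some $T_{\max}\in(0,+\infty]$. (ii) Moreover, if $w_0\in\mathcal{D}(\mathcal{A})$, then $[w,z]$ is a strong solution of $(\ast)$. (iii) Furthermore, if $d=0$ or $\mathrm{d}\mathcal{M}$ is globally Lipschitz continuous, then $(\ast)$ is forward complete, i.e. $T_{\max}=+\infty$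 for all $[w_0,z_0]\in H\times Z$.
   Context: $H$, $Z$, $U$ are real Hilbert spaces. $\mathcal{A}:\mathcal{D}(\mathcal{A})\to H$ is a single-valued (possibly nonlinear) maximal monotone operator defined on a dense subset $\mathcal{D}(\mathcal{A})\subset H$, with $\mathcal{A}(0)=0$. $B:U\to H$ is a bounded linear map, and $C:\mathcal{D}(C)\to Z$ is a (possibly unbounded) linear map defined on a dense subspace $\mathcal{D}(C)\supset\mathcal{D}(\mathcal{A})$ of $H$. $\mathcal{C}^1(H,Z)$ is the space of continuously Fréchet differentiable maps from $H$ to $Z$; $\mathcal{L}(H,Z)$ is the space of bounded linear operators with the operator norm; adjoints are denoted by $^*$. A map is called locally Lipschitz continuous if it is Lipschitz continuous on every bounded set. Strong solution on $[0,T]$: an absolutely continuous function $[w,z]:[0,T]\to H\times Z$ with values in $\mathcal{D}(\mathcal{A})\times Z$ that solves the equations almost everywhere on $(0,T)$. Weak solution on $[0,T]$: a limit in $\mathcal{C}([0,T],H\times Z)$ of strong solutions. A function on $[0,T_{\max})$ is a strong (resp. weak) solution if it is one on $[0,T]$ for every $T<T_{\max}$; it is maximal if it cannot be extended as a weak solution to a larger interval. *)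

(* Defs.v *)
From HB Require Import structures.
From mathcomp Require Import all_boot all_order all_algebra.
From mathcomp Require Import all_classical all_reals all_analysis.

Set Implicit Arguments.
Unset Strict Implicit.
Unset Printing Implicit Defensive.

Import Order.TTheory GRing.Theory Num.Theory.
Import numFieldNormedType.Exports.

Local Open Scope classical_set_scope.
Local Open Scope ring_scope.

(* Real Hilbert spaces: complete normed spaces whose norm is induced by a
   symmetric positive definite bilinear form ([{dot _ for idfun}]). *)
HB.mixin Record CompleteNormedModule_isHilbert (R : realType) H
    of CompleteNormedModule R H := {
  inner : {dot H for (@idfun R)} ;
  inner_normE : forall x : H, inner x x = `|x| ^+ 2
}.

#[short(type="hilbertType")]
HB.structure Definition Hilbert (R : realType) :=
  {H of CompleteNormedModule_isHilbert R H & CompleteNormedModule R H}.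

Section operators.
Context {R : realType}.

(* [adjoint L y] is the vector x with <x, v> = <y, L v> for all v. It exists
   and is unique when L is bounded linear (Riesz); otherwise the default 0 may
   be returned. *)
Definition adjoint (X Y : hilbertType R) (L : X -> Y) (y : Y) : X :=
  xget 0 [set x | forall v : X, inner x v = inner y (L v)].

Definition bounded_linear (X Y : normedModType R) (L : {linear X -> Y}) :=
  exists k : R, forall x, `|L x| <= k * `|x|.

(* Meaningful for bounded linear maps (the supremum of an unbounded set is 0
   by convention). *)
Definition opnorm (X Y : normedModType R) (L : X -> Y) : R :=
  sup [set `|L x| | x in [set x : X | `|x| <= 1]].

Definition continuously_differentiable (X Y : normedModType R) (M : X -> Y) :=
  (forall w, differentiable M w) /\
  (forall w, opnorm ('d M v \- 'd M w) @[v --> w] --> (0 : R)).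

Definition diff_lipschitz_on (X Y : normedModType R) (M : X -> Y)
    (S : set X) :=
  exists k : R, forall w1 w2, S w1 -> S w2 ->
    opnorm ('d M w1 \- 'd M w2) <= k * `|w1 - w2|.

Definition diff_locally_lipschitz (X Y : normedModType R) (M : X -> Y) :=
  forall S : set X, bounded_set S -> diff_lipschitz_on M S.

Definition diff_globally_lipschitz (X Y : normedModType R) (M : X -> Y) :=
  diff_lipschitz_on M setT.

(* A linear map with domain D is a function on the whole space of which only
   the values on the linear subspace D matter. *)
Definition linear_subspace (X : lmodType R) (D : set X) :=
  D 0 /\ forall (a : R) x y, D x -> D y -> D (a *: x + y).

Definition linear_on (X Y : lmodType R) (D : set X) (L : X -> Y) :=
  forall (a : R) x y, D x -> D y -> L (a *: x + y) = a *: L x + L y.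

Definition op_graph (X Y : Type) (D : set X) (f : X -> Y) : set (X * Y) :=
  [set (x, f x) | x in D].

Definition monotone_graph (H : hilbertType R) (G : set (H * H)) :=
  forall p q, G p -> G q -> 0 <= inner (p.2 - q.2) (p.1 - q.1).

Definition maximal_monotone (H : hilbertType R) (G : set (H * H)) :=
  monotone_graph G /\ forall G', monotone_graph G' -> G `<=` G' -> G' = G.

Definition strongly_monotone (H : hilbertType R) (D : set H) (A : H -> H) :=
  exists2 alpha : R, 0 < alpha &
    forall w1 w2, D w1 -> D w2 ->
      alpha * `|w1 - w2| ^+ 2 <= inner (A w1 - A w2) (w1 - w2).

Definition absolutely_continuous (V : normedModType R) (a b : R)
    (f : R -> V) :=
  forall eps : R, 0 < eps -> exists2 delta : R, 0 < delta &
    forall (n : nat) (s t : 'I_n -> R),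
      (forall i, a <= s i /\ s i <= t i /\ t i <= b) ->
      trivIset [set: 'I_n] (fun i => `]s i, t i[%classic) ->
      \sum_(i < n) (t i - s i) < delta ->
      \sum_(i < n) `|f (t i) - f (s i)| < eps.

End operators.

Section closed_loop.
Context {R : realType} {H Z U : hilbertType R}.
Variables (DA : set H) (A : H -> H) (B : {linear U -> H}) (C : H -> Z).
Variables (M : H -> Z) (d : H) (yref : Z).

Definition closed_loop_at (w : R -> H) (z : R -> Z) (t : R) :=
  [/\ derivable w t 1, derivable z t 1,
      derive1 w t + A (w t) =
        B (adjoint B (adjoint ('d M (w t)) (z t - M (w t)))) + d &
      derive1 z t = C (w t) - yref].

(* Trajectories are functions on R of which only the values on the relevant
   interval of nonnegative times matter. *)
Definition strong_solution (T : R) (w : R -> H) (z : R -> Z) :=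
  [/\ absolutely_continuous 0 T (fun t : R => (w t, z t)),
      (forall t : R, t \in `[0, T] -> DA (w t)) &
      {ae (@lebesgue_measure R), forall t : R, t \in `]0, T[ ->
        closed_loop_at w z t}].

Definition weak_solution (T : R) (w : R -> H) (z : R -> Z) :=
  {within `[0, T]%classic, continuous (fun t : R => (w t, z t))} /\
  exists (w_ : nat -> R -> H) (z_ : nat -> R -> Z),
    (forall n, strong_solution T (w_ n) (z_ n)) /\
    {uniform `[0, T]%classic,
      (fun n (t : R) => (w_ n t, z_ n t)) @ \oo --> (fun t : R => (w t, z t))}.

Definition strong_solution_upto (Tmax : \bar R) (w : R -> H) (z : R -> Z) :=
  forall T : R, 0 < T -> (T%:E < Tmax)%E -> strong_solution T w z.

Definition weak_solution_upto (Tmax : \bar R) (w : R -> H) (z : R -> Z) :=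
  forall T : R, 0 < T -> (T%:E < Tmax)%E -> weak_solution T w z.

Definition agree_upto (Tmax : \bar R) (w w' : R -> H) (z z' : R -> Z) :=
  forall t : R, 0 <= t -> (t%:E < Tmax)%E -> w' t = w t /\ z' t = z t.

(* Every interval strictly larger than [0, Tmax[ contains [0, T] for some
   real T >= Tmax, so non-extendability is tested on the latter. *)
Definition maximal_weak_solution (Tmax : \bar R) (w : R -> H) (z : R -> Z) :=
  [/\ (0 < Tmax)%E, weak_solution_upto Tmax w z &
      ~ exists (T : R) (w' : R -> H) (z' : R -> Z),
          [/\ (Tmax <= T%:E)%E, weak_solution T w' z' &
              agree_upto Tmax w w' z z']].

Definition forward_complete :=
  forall (w0 : H) (z0 : Z) (Tmax : \bar R) (w : R -> H) (z : R -> Z),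
    maximal_weak_solution Tmax w z -> w 0 = w0 -> z 0 = z0 -> Tmax = +oo%E.

End closed_loop.

(* Main.v *)
Require Import Defs.
From HB Require Import structures.
From mathcomp Require Import all_boot all_order all_algebra.
From mathcomp Require Import ring lra.
From mathcomp Require Import all_classical all_reals all_analysis.
From mathcomp Require Import measurable_realfun.

Set Implicit Arguments.
Unset Strict Implicit.
Unset Printing Implicit Defensive.

Import Order.TTheory GRing.Theory Num.Theory.
Import numFieldNormedType.Exports.

Local Open Scope classical_set_scope.
Local Open Scope ring_scope.

(** Write [eta = z - M w]. Along a solution
    [eta' = C w - yref - dM(w) w'], and the hypothesis [dM(w) (A w) + C w = 0]
    makes the unbounded terms cancel, so that
<<
      w'   = - A w + F1(w, eta),    F1(w, eta) = B B^* dM(w)^* eta + d,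
      eta' =         F2(w, eta),    F2(w, eta) = - dM(w) F1(w, eta) - yref.
>>
    In the Hilbert sum of [H] and [Z] this is [u' + A' u = F u], where
    [A' (w, eta) = (A w, 0)] is maximal monotone and [F] is Lipschitz on balls
    because [dM] is. The two systems are exchanged by
    [strong_solution_trajectory] and [trajectory_strong_solution].

    Suppose first that [F] is globally Lipschitz. Minty's theorem gives the
    resolvents of [A'], hence a scheme that is implicit in [A'] and explicit
    in [F]. Halving its step changes the discrete solution by the order of
    the square root of the step ([halving_error]), so the scheme converges along
    dyadic steps ([cvg_flow]). For an initial datum in the domain the limit [u]
    stays in the domain, the speed [|A' u - F u|] grows at most exponentially,
    and a discrete energy inequality survives in the limit
    ([flow_evolution]). The damped speed is monotone, so it is continuous off a
    countable set, and wherever the speed is upper semicontinuous the energy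
    inequality, tested with resolvents of [A'], forces the difference quotients
    to converge strongly to [F u - A' u] ([evolution_is_derive]). Any two
    strong solutions satisfy a Gronwall estimate, by monotonicity and the fact
    that an absolutely continuous function with nonpositive derivative almost
    everywhere is nonincreasing. The estimate gives uniqueness, passes to
    uniform limits, and yields weak solutions for every initial datum because
    the domain is dense ([trajectory_exists]).

    For the actual [F], compose it with the radial projection on a ball of
    radius [r]. Weak solutions whose transform stays in a smaller ball are the same
    thing as uniform limits of trajectories of the truncated system that stay
    there. So local
    existence, uniqueness, continuation of bounded solutions, and strong
    regularity for [w 0] in the domain are all read off the truncated system;
    gluing gives the unique maximal solution. Finally, if [d = 0] or [dM] is
    globally Lipschitz then [|dM(w) d|] grows at most linearly in [|w|], and
    [|w|^2 + |eta|^2] obeys a linear differential inequality: the control term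
    in the first equation is absorbed by the dissipation
    [- |B^* dM(w)^* eta|^2] of the second ([energy_growth]). Bounded solutions
    continue, whence forward completeness. *)

(** * Inner products and Hilbert sums *)

Section inner_theory.
Context {R : realType} {X : hilbertType R}.
Implicit Types (x y z : X) (a : R).

Lemma innerC x y : inner x y = inner y x.
Proof. by rewrite (@hermitian_subproof _ _ _ _ inner x y) expr0 mul1r. Qed.
Lemma innerDr x y z : inner x (y + z) = inner x y + inner x z.
Proof. by rewrite linearDr. Qed.
Lemma innerBr x y z : inner x (y - z) = inner x y - inner x z.
Proof. by rewrite linearBr. Qed.
Lemma innerZr a x y : inner x (a *: y) = a * inner x y.
Proof. by rewrite linearZr_LR. Qed.
Lemma innerNr x y : inner x (- y) = - inner x y.
Proof. by rewrite linearNr. Qed.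
Lemma inner0r x : inner x 0 = 0.
Proof. by rewrite linear0r. Qed.
Lemma innerDl x y z : inner (x + y) z = inner x z + inner y z.
Proof. by rewrite linearDl. Qed.
Lemma innerBl x y z : inner (x - y) z = inner x z - inner y z.
Proof. by rewrite linearBl. Qed.
Lemma innerZl a x y : inner (a *: x) y = a * inner x y.
Proof. by rewrite linearZl_LR. Qed.
Lemma innerNl x y : inner (- x) y = - inner x y.
Proof. by rewrite linearNl. Qed.
Lemma inner0l x : inner 0 x = 0.
Proof. by rewrite linear0l. Qed.

Definition innerE := (innerDl, innerDr, innerBl, innerBr, innerNl, innerNr,
  innerZl, innerZr, inner0l, inner0r).

Lemma normsqD x y : `|x + y| ^+ 2 = `|x| ^+ 2 + 2 * inner x y + `|y| ^+ 2.
Proof. rewrite -!inner_normE !innerE (innerC y x); ring. Qed.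

Lemma normsqB x y : `|x - y| ^+ 2 = `|x| ^+ 2 - 2 * inner x y + `|y| ^+ 2.
Proof. rewrite -!inner_normE !innerE (innerC y x); ring. Qed.

Lemma inner_le x y : inner x y <= `|x| * `|y|.
Proof.
have [->|x0] := eqVneq x 0; first by rewrite inner0l normr0 mul0r.
have [->|y0] := eqVneq y 0; first by rewrite inner0r normr0 mulr0.
have xp : 0 < `|x| by rewrite normr_gt0.
have yp : 0 < `|y| by rewrite normr_gt0.
have : 0 <= `| `|y| *: x - `|x| *: y| ^+ 2 by exact: sqr_ge0.
rewrite normsqB !innerE !normrZ !normr_id => h.
have : 0 <= 2 * (`|x| * `|y|) * (`|x| * `|y| - inner x y) by lra.
by rewrite pmulr_rge0 ?subr_ge0// !mulr_gt0.
Qed.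

Lemma normr_inner_le x y : `|inner x y| <= `|x| * `|y|.
Proof.
rewrite ler_norml inner_le andbT lerNl -innerNl.
by rewrite (le_trans (inner_le _ _))// normrN.
Qed.

(** Also the way to check identities between vectors below: expand the inner
    products with an arbitrary vector and compare scalars. *)
Lemma inner_inj x y : (forall v, inner x v = inner y v) -> x = y.
Proof.
move=> e; apply/eqP; rewrite -subr_eq0 -normr_eq0 -sqrf_eq0 -inner_normE.
by rewrite innerBl e subrr.
Qed.

Lemma cvg_inner (T : Type) (F : set_system T) {FF : Filter F} (f g : T -> X) x y :
  f @ F --> x -> g @ F --> y -> (fun t => inner (f t) (g t)) @ F --> inner x y.
Proof.
move=> fx gy.
pose h t := inner (f t - x) (g t - y) + inner (f t - x) y + inner x (g t - y)
  + inner x y.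
have e t : inner (f t) (g t) = h t.
  by rewrite /h !innerE; ring.
rewrite (_ : (fun t => _) = h); last by apply/funext.
rewrite -[in X in _ --> X](add0r (inner x y)).
have fx0 : `|f t - x| @[t --> F] --> (0 : R).
  by rewrite -(@normr0 _ X); apply: cvg_norm; rewrite -(subrr x); apply: cvgB => //; exact: cvg_cst.
have gy0 : `|g t - y| @[t --> F] --> (0 : R).
  by rewrite -(@normr0 _ X); apply: cvg_norm; rewrite -(subrr y); apply: cvgB => //; exact: cvg_cst.
apply: cvgD; last exact: cvg_cst.
rewrite -[X in _ --> X](addr0 (0 : R)); apply: cvgD; last first.
  apply: norm_cvg0; apply: (@squeeze_cvgr _ _ _ _ (fun=> 0) (fun t => `|x| * `|g t - y|)).
  - by apply: nearW => t; rewrite normr_ge0 normr_inner_le.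
  - exact: cvg_cst.
  - by rewrite -(mulr0 `|x|); apply: cvgM => //; exact: cvg_cst.
rewrite -[X in _ --> X](addr0 (0 : R)); apply: cvgD; last first.
  apply: norm_cvg0; apply: (@squeeze_cvgr _ _ _ _ (fun=> 0) (fun t => `|f t - x| * `|y|)).
  - by apply: nearW => t; rewrite normr_ge0 normr_inner_le.
  - exact: cvg_cst.
  - by rewrite -(mul0r `|y|); apply: cvgM => //; exact: cvg_cst.
apply: norm_cvg0; apply: (@squeeze_cvgr _ _ _ _ (fun=> 0) (fun t => `|f t - x| * `|g t - y|)).
- by apply: nearW => t; rewrite normr_ge0 normr_inner_le.
- exact: cvg_cst.
- by rewrite -(mul0r (0 : R)); apply: cvgM.
Qed.

End inner_theory.

(** The canonical norm of a product is the maximum of the norms, so the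
    Euclidean norm lives on an alias. *)
Definition hprod (R : realType) (H Z : hilbertType R) : Type := (H * Z)%type.

Section hprod_norm.
Context {R : realType} {H Z : hilbertType R}.

HB.instance Definition _ := GRing.Lmodule.copy (hprod H Z) (H * Z)%type.

Implicit Types u v : hprod H Z.
Definition hprod_inner u v : R := inner u.1 v.1 + inner u.2 v.2.
Definition hprod_norm u : R := Num.sqrt (hprod_inner u u).

Lemma hprod_norm_ge0 u : 0 <= hprod_norm u.
Proof. exact: sqrtr_ge0. Qed.

Lemma hprod_innerC u v : hprod_inner u v = hprod_inner v u.
Proof. by rewrite /hprod_inner innerC (innerC u.2). Qed.

Lemma hprod_normE u : hprod_norm u ^+ 2 = hprod_inner u u.
Proof. by rewrite sqr_sqrtr// /hprod_inner !inner_normE addr_ge0// sqr_ge0. Qed.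

Lemma hprod_innerEE u : hprod_inner u u = `|u.1| ^+ 2 + `|u.2| ^+ 2.
Proof. by rewrite /hprod_inner !inner_normE. Qed.

Lemma hprod_inner_le u v : hprod_inner u v <= hprod_norm u * hprod_norm v.
Proof.
apply: le_trans (_ : `|u.1| * `|v.1| + `|u.2| * `|v.2| <= _).
  by apply: lerD; exact: inner_le.
rewrite -(@ler_pXn2r _ 2)// ?nnegrE ?addr_ge0// ?mulr_ge0 ?hprod_norm_ge0//.
rewrite [in leRHS]exprMn !hprod_normE !hprod_innerEE.
have := sqr_ge0 (`|u.1| * `|v.2| - `|u.2| * `|v.1|).
nra.
Qed.

Lemma hprod_ler_normD u v : hprod_norm (u + v) <= hprod_norm u + hprod_norm v.
Proof.
rewrite -(@ler_pXn2r _ 2)// ?nnegrE ?addr_ge0 ?hprod_norm_ge0// sqrrD !hprod_normE.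
have := hprod_inner_le u v.
have -> : hprod_inner (u + v) (u + v) = hprod_inner u u + 2 * hprod_inner u v + hprod_inner v v.
  rewrite [hprod_inner (u + v) _]/hprod_inner /= !innerE (innerC v.1) (innerC v.2).
  by rewrite /hprod_inner; ring.
lra.
Qed.

Lemma hprod_normrZ (l : R) u : hprod_norm (l *: u) = `|l| * hprod_norm u.
Proof.
rewrite /hprod_norm; have -> : hprod_inner (l *: u) (l *: u) = l ^+ 2 * hprod_inner u u.
  by rewrite /hprod_inner /= !innerE; ring.
by rewrite sqrtrM ?sqr_ge0// sqrtr_sqr.
Qed.

Lemma hprod_norm_eq0 u : hprod_norm u = 0 -> u = 0.
Proof.
move=> /(congr1 (fun r => r ^+ 2)); rewrite hprod_normE expr0n hprod_innerEE => /eqP.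
rewrite paddr_eq0 ?sqr_ge0// !sqrf_eq0 !normr_eq0; case: u => a b /= /andP[/eqP -> /eqP ->].
by [].
Qed.

HB.instance Definition _ := @Lmodule_isNormed.Build R (hprod H Z)
  hprod_norm hprod_ler_normD hprod_normrZ hprod_norm_eq0.

Lemma hprod_norm1 u : `|u.1| <= `|u|.
Proof.
rewrite -(@ler_pXn2r _ 2)// ?nnegrE// [X in _ <= X](hprod_normE u) hprod_innerEE.
by rewrite lerDl sqr_ge0.
Qed.

Lemma hprod_norm2 u : `|u.2| <= `|u|.
Proof.
rewrite -(@ler_pXn2r _ 2)// ?nnegrE// [X in _ <= X](hprod_normE u) hprod_innerEE.
by rewrite lerDr sqr_ge0.
Qed.

Lemma hprod_norm_sq u : `|u| ^+ 2 = `|u.1| ^+ 2 + `|u.2| ^+ 2.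
Proof. by rewrite [LHS](hprod_normE u) hprod_innerEE. Qed.

Lemma hprod_norm_le u : `|u| <= `|u.1| + `|u.2|.
Proof.
rewrite -(@ler_pXn2r _ 2)// ?nnegrE ?addr_ge0// hprod_norm_sq sqrrD.
by rewrite addrAC lerDl mulrn_wge0// mulr_ge0.
Qed.

Lemma cvg_hprod (T : Type) (F : set_system T) {FF : Filter F}
    (f : T -> hprod H Z) (u : hprod H Z) :
  (f t).1 @[t --> F] --> u.1 -> (f t).2 @[t --> F] --> u.2 -> f @ F --> u.
Proof.
move=> f1 f2; apply/cvgrPdist_lt => e e0.
near=> t; apply: le_lt_trans (hprod_norm_le _) _ => /=.
rewrite (splitr e) ltrD//; near: t.
  by move/cvgrPdist_lt: f1; apply; rewrite divr_gt0.
by move/cvgrPdist_lt: f2; apply; rewrite divr_gt0.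
Unshelve. all: by end_near. Qed.

Lemma cvg_hprod1 (T : Type) (F : set_system T) {FF : Filter F}
    (f : T -> hprod H Z) (u : hprod H Z) :
  f @ F --> u -> (f t).1 @[t --> F] --> u.1.
Proof.
move=> fu; apply/cvgrPdist_lt => e e0.
move/cvgrPdist_lt : fu => /(_ _ e0); apply: filterS => t.
exact/le_lt_trans/(hprod_norm1 (u - f t)).
Qed.

Lemma cvg_hprod2 (T : Type) (F : set_system T) {FF : Filter F}
    (f : T -> hprod H Z) (u : hprod H Z) :
  f @ F --> u -> (f t).2 @[t --> F] --> u.2.
Proof.
move=> fu; apply/cvgrPdist_lt => e e0.
move/cvgrPdist_lt : fu => /(_ _ e0); apply: filterS => t.
exact/le_lt_trans/(hprod_norm2 (u - f t)).
Qed.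

Lemma hprod_complete (F : set_system (hprod H Z)) :
  ProperFilter F -> cauchy F -> cvg F.
Proof.
move=> FF /cauchyP Fc.
have F1 : cvg ((fun u : hprod H Z => u.1) @ F).
  apply: cauchy_cvg; apply/cauchyP => e e0.
  have [x Fx] := Fc e e0; exists x.1.
  rewrite /fmap /=; apply: filterS Fx => u; rewrite -!ball_normE /ball_ /= => xu.
  exact: le_lt_trans (hprod_norm1 (x - u)) xu.
have F2 : cvg ((fun u : hprod H Z => u.2) @ F).
  apply: cauchy_cvg; apply/cauchyP => e e0.
  have [x Fx] := Fc e e0; exists x.2.
  rewrite /fmap /=; apply: filterS Fx => u; rewrite -!ball_normE /ball_ /= => xu.
  exact: le_lt_trans (hprod_norm2 (x - u)) xu.
apply/cvg_ex; exists ((lim ((fun u : hprod H Z => u.1) @ F),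
                       lim ((fun u : hprod H Z => u.2) @ F)) : hprod H Z).
exact: (@cvg_hprod _ F _ id).
Qed.

HB.instance Definition _ := Uniform_isComplete.Build (hprod H Z) hprod_complete.

Let inner_is_bilinear : bilinear_for
    (GRing.Scale.Law.clone _ _ *%R _) (GRing.Scale.Law.clone _ _ *%R _)
    hprod_inner.
Proof.
by split=> [u|u] a x y; rewrite /hprod_inner /= !innerE; ring.
Qed.

HB.instance Definition _ := bilinear_isBilinear.Build R (hprod H Z) (hprod H Z)
  R _ _ hprod_inner inner_is_bilinear.

Let inner_hermitian u v :
  hprod_inner u v = (-1) ^+ false * @idfun R (hprod_inner v u).
Proof. by rewrite expr0 mul1r hprod_innerC. Qed.

HB.instance Definition _ := isHermitianSesquilinear.Build R (hprod H Z)
  false idfun hprod_inner inner_hermitian.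

Let inner_gt0 u : u != 0 -> 0 < hprod_inner u u.
Proof. by move=> u0; rewrite -hprod_normE exprn_gt0// [ltRHS](_ : _ = `|u|)// normr_gt0. Qed.

HB.instance Definition _ := isDotProduct.Build R (hprod H Z) hprod_inner inner_gt0.

Let inner_norm u : hprod_inner u u = `|u| ^+ 2.
Proof. by rewrite -hprod_normE. Qed.

HB.instance Definition _ := CompleteNormedModule_isHilbert.Build R (hprod H Z)
  inner_norm.

Lemma inner_hprodE u v : inner u v = inner u.1 v.1 + inner u.2 v.2.
Proof. by []. Qed.

End hprod_norm.

(** * Convex minimization, Riesz and Minty *)

Lemma cauchy_seq_cvg (R : realType) (X : completeNormedModType R)
    (u : nat -> X) (e : nat -> R) :
  e @ \oo --> 0 -> (forall n m, (n <= m)%N -> `|u n - u m| <= e n) -> cvgn u.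
Proof.
move=> e0 ue; apply/cauchy_cvgP/cauchyP => eps eps0.
have /cvgrPdist_lt /(_ _ eps0) [N _ hN] := e0.
exists (u N); exists N => // n /= Nn.
rewrite -ball_normE /ball_ /=; apply: le_lt_trans (ue _ _ Nn) _.
by have := hN N (leqnn N); rewrite /= sub0r normrN; apply: le_lt_trans (ler_norm _).
Qed.

Section variational.
Context {R : realType} {X : hilbertType R}.

(** [E] plays the role of the epigraph of a lower semicontinuous convex function
    [f], so that functions with infinite values need not be handled. Minimizing
    sequences of [r + |x|^2 / 2] are Cauchy by the parallelogram identity; at the
    minimizer [x], comparison with the segment to any other point says that [- x]
    is a subgradient of [f]. *)
Lemma epigraph_variational_inequality (E : set (X * R)) (m : R) :
  E !=set0 ->
  (forall x r y s t, E (x, r) -> E (y, s) -> 0 <= t -> t <= 1 ->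
     E (x + t *: (y - x), r + t * (s - r))) ->
  (forall (x : nat -> X) (r : nat -> R) a b, (forall n, E (x n, r n)) ->
     x @ \oo --> a -> r @ \oo --> b -> E (a, b)) ->
  (forall x r, E (x, r) -> m <= r + `|x| ^+ 2 / 2) ->
  exists x r, E (x, r) /\ forall y s, E (y, s) -> r <= s + inner x (y - x).
Proof.
move=> [[x0 r0] E0] Econv Ecl Ebd.
pose J (p : X * R) := p.2 + `|p.1| ^+ 2 / 2.
have infJ : has_inf (J @` E).
  split; first by exists (J (x0, r0)), (x0, r0).
  by exists m => _ [[x r] Ep <-]; exact: Ebd.
pose I := inf (J @` E).
have IJ p : E p -> I <= J p.
  by move=> Ep; apply: ge_inf; [exact: infJ.2|exists p].
have n0 n : 0 < n.+1%:R^-1 :> R by rewrite invr_gt0.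
have /choice [p pP] : forall n : nat, exists p, E p /\ J p < I + n.+1%:R^-1.
  move=> n; have [_ [p Ep <-] Ip] := @inf_adherent _ _ _ (n0 n) infJ.
  by exists p.
pose x n := (p n).1; pose r n := (p n).2.
have pE n : p n = (x n, r n) by rewrite /x /r; case: (p n).
have xE n : E (x n, r n) by rewrite -pE; exact: (pP n).1.
have xC n k : (n <= k)%N -> `|x n - x k| <= Num.sqrt (8 * n.+1%:R^-1).
  move=> nk; rewrite -(@ler_pXn2r _ 2)// ?nnegrE ?sqrtr_ge0//.
  rewrite sqr_sqrtr ?mulr_ge0 ?invr_ge0//.
  have h0 : (0:R) <= 2^-1 by lra.
  have h1 : (2^-1:R) <= 1 by lra.
  have := IJ _ (Econv _ _ _ _ _ (xE n) (xE k) h0 h1); rewrite /J /=.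
  have := (pP n).2; have := (pP k).2; rewrite !pE /J /=.
  have : k.+1%:R^-1 <= n.+1%:R^-1 :> R by rewrite lef_pV2 ?posrE// ler_nat.
  rewrite normsqD normrZ exprMn ger0_norm ?invr_ge0// innerZr innerBr inner_normE.
  rewrite [X in _ -> _ -> _ -> _ -> X <= _]normsqB (normsqB (x k)) (innerC (x k)).
  set a := `|x n| ^+ 2; set b := `|x k| ^+ 2; set c := inner _ _.
  set u := n.+1%:R^-1; set v := k.+1%:R^-1.
  by lra.
have sq0 : (fun n => Num.sqrt (8 * n.+1%:R^-1)) @ \oo --> (0 : R).
  rewrite -[X in _ --> X]sqrtr0; apply: continuous_cvg; first exact: sqrt_continuous.
  by rewrite -[X in _ --> X](mulr0 (8:R)); apply: cvgM; [exact: cvg_cst|exact: cvg_harmonic].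
have /cvg_ex[a xa] : cvgn x by apply: cauchy_seq_cvg sq0 _.
have JI : (fun n => J (p n)) @ \oo --> I.
  apply: (@squeeze_cvgr _ _ _ _ (fun=> I) (fun n => I + n.+1%:R^-1)).
  - by apply: nearW => n; rewrite IJ ?ltW ?(pP n).2//; exact: (pP n).1.
  - exact: cvg_cst.
  - by rewrite -[X in _ --> X](addr0 I); apply: cvgD; [exact: cvg_cst|exact: cvg_harmonic].
have rb : r @ \oo --> I - `|a| ^+ 2 / 2.
  rewrite (_ : r = (fun n => J (p n) - `|x n| ^+ 2 / 2)); last first.
    by apply/funext => n; rewrite /J pE /= addrK.
  apply: cvgB => //; apply: cvgM; last exact: cvg_cst.
  under eq_fun do rewrite expr2; rewrite expr2.
  by apply: cvgM; exact: cvg_norm.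
have Eab := Ecl _ _ _ _ xE xa rb.
exists a, (I - `|a| ^+ 2 / 2); split => // y s Ey.
apply/ler_addgt0Pr => eps eps0.
pose q := `|y - a| ^+ 2 / 2.
have q0 : 0 <= q by rewrite divr_ge0// sqr_ge0.
(* moving by [t] along the segment costs only [t * (t * q)], at most [t * eps] *)
pose t := Num.min 1 (eps / (q + 1)).
have t0 : 0 < t by rewrite lt_min ltr01/= divr_gt0// ltr_wpDl.
have t1 : t <= 1 by rewrite ge_min lexx.
have tq : t * q <= eps.
  rewrite (@le_trans _ _ (eps / (q + 1) * q))// ?ler_wpM2r ?ge_min ?lexx ?orbT//.
  by rewrite mulrAC ler_pdivrMr ?ltr_wpDl// ler_pM2l// lerDl.
have := IJ _ (Econv _ _ _ _ _ Eab Ey (ltW t0) t1); rewrite /J /=.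
rewrite normsqD normrZ exprMn (ger0_norm (ltW t0)) innerZr.
set c := inner _ _.
rewrite (_ : `|y - a| ^+ 2 = 2 * q); last by rewrite /q mulrC divfK.
set A := `|a| ^+ 2 / 2 => h.
have : 0 <= t * (s - (I - A) + c + t * q).
  have : I <= I - A + t * (s - (I - A)) + (`|a| ^+ 2 + 2 * (t * c) + t ^+ 2 * (2 * q)) / 2 by [].
  rewrite (_ : (_ + _ + _) / 2 = A + t * c + t * (t * q)); last by rewrite /A; field.
  lra.
rewrite pmulr_rge0//; lra.
Qed.

(** The representing vector minimizes [|v|^2 / 2 - f v]. *)
Lemma riesz_representation (f : {linear X -> R}) (k : R) :
  (forall v, `|f v| <= k * `|v|) -> exists x : X, forall v, inner x v = f v.
Proof.
move=> fk.
have fc : continuous f.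
  apply/linear_bounded_continuous; apply/linear_boundedP.
  by near=> M => v; rewrite (le_trans (fk v))// ler_wpM2r// ltW.
have [||||x [r [/= xr xP]]] := @epigraph_variational_inequality
    [set p : X * R | - f p.1 <= p.2] (- (k ^+ 2 / 2)).
- by exists (0, 0) => /=; rewrite linear0 oppr0.
- move=> a r b s t /= ar bs t0 t1; rewrite linearD linearZ linearB /=.
  have : 0 <= (1 - t) * (r + f a) by rewrite mulr_ge0//; lra.
  have : 0 <= t * (s + f b) by rewrite mulr_ge0//; lra.
  rewrite /GRing.scale /=; nra.
- move=> a r x b /= ar ax rb.
  apply: (@ler_cvg_to _ \oo _ _ (fun n => - f (a n)) r) => //;
    last by apply: nearW => n; exact: ar.
  by apply: cvgN; apply: continuous_cvg => //; exact: fc.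
- move=> a r /= ar; have := fk a; rewrite ler_norml => /andP[_ h].
  have := sqr_ge0 (k - `|a|); nra.
exists x.
have le y : f y <= inner x y.
  have := xP (x + y) (- f (x + y)) (lexx _); rewrite linearD /= [x + y]addrC addrK.
  lra.
move=> v; apply/le_anti; rewrite le andbT.
by have := le (- v); rewrite innerNr linearN lerN2.
Unshelve. all: by end_near. Qed.

End variational.

Section minty.
Context {R : realType} {X : hilbertType R}.

(** Otherwise [z] could be added to [G]. *)
Lemma maximal_monotone_mem (G : set (X * X)) z : maximal_monotone G ->
  (forall g, G g -> 0 <= inner (z.2 - g.2) (z.1 - g.1)) -> G z.
Proof.
move=> [Gm GM] zG.
have <- : G `|` [set z] = G; last by right.
apply: GM; last by move=> g; left.
move=> p q [Gp|->] [Gq|->]; [exact: Gm| |exact: zG|by rewrite !subrr inner0l].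
by rewrite -(opprB z.2) -(opprB z.1) innerNl innerNr opprK; exact: zG.
Qed.

(** [E] is the epigraph of the Fitzpatrick function of [G], which dominates the
    duality product everywhere and coincides with it on [G]. If [z] is the point
    where its sum with half the squared norm is minimal, the variational
    inequality shows that [(- z.2, - z.1)] is monotonically related to [G], hence
    in [G], and testing with this very point gives [z.1 + z.2 = 0]. *)
Lemma minty (G : set (X * X)) : monotone_graph G ->
  (forall z, (forall g, G g -> 0 <= inner (z.2 - g.2) (z.1 - g.1)) -> G z) ->
  exists2 g, G g & g.1 + g.2 = 0.
Proof.
move=> Gm GM.
pose phi (z : hprod X X) (g : X * X) := inner z.1 g.2 + inner g.1 z.2 - inner g.1 g.2.
pose E := [set p : hprod X X * R | forall g, G g -> phi p.1 g <= p.2].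
have phiE z g : inner (z.2 - g.2) (z.1 - g.1) = inner z.1 z.2 - phi z g.
  by rewrite /phi !innerE (innerC z.2) (innerC z.2) (innerC g.2) (innerC g.2); ring.
have Gphi g : G g -> E (g : hprod X X, inner g.1 g.2).
  by move=> Gg g' Gg' /=; have := Gm _ _ Gg Gg'; rewrite phiE subr_ge0.
have Ege z r : E (z, r) -> inner z.1 z.2 <= r.
  move=> Ez; case: (leP (inner z.1 z.2) r) => // zr.
  have Gz : G z by apply: GM => g Gg; rewrite phiE subr_ge0 (le_trans (Ez g Gg))// ltW.
  have /= := Ez _ Gz; rewrite /phi.
  have -> : inner z.1 z.2 + inner z.1 z.2 - inner z.1 z.2 = inner z.1 z.2 by ring.
  by rewrite leNgt zr.
have [||||z [r [Ez zP]]] := @epigraph_variational_inequality R (hprod X X) E 0.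
- have [[g Gg]|nG] := pselect (exists g, G g); first by exists (g, inner g.1 g.2); exact: Gphi.
  by case: (nG); exists (0, 0); apply: GM => g Gg; case: nG; exists g.
- move=> x r y s t Ex Ey t0 t1 g Gg /=.
  have := Ex g Gg; have := Ey g Gg => /= Ey' Ex'.
  have -> : phi (x + t *: (y - x)) g = (1 - t) * phi x g + t * phi y g.
    by rewrite /phi /= !innerE; ring.
  have : 0 <= (1 - t) * (r - phi x g) by rewrite mulr_ge0//; lra.
  have : 0 <= t * (s - phi y g) by rewrite mulr_ge0//; lra.
  lra.
- move=> x r a b Ex xa rb g Gg /=.
  have xa1 : (x n).1 @[n --> \oo] --> a.1 by exact: cvg_hprod1 xa.
  have xa2 : (x n).2 @[n --> \oo] --> a.2 by exact: cvg_hprod2 xa.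
  apply: (@ler_cvg_to _ \oo _ _ (fun n => phi (x n) g) r) => //;
    last by apply: nearW => n; exact: Ex.
  apply: cvgB; last exact: cvg_cst.
  apply: cvgD.
    exact: cvg_inner xa1 (@cvg_cst _ g.2 _ _ _).
  exact: cvg_inner (@cvg_cst _ g.1 _ _ _) xa2.
- move=> x r /Ege h.
  have := sqr_ge0 (`|x.1 + x.2|); rewrite normsqD hprod_norm_sq; lra.
have zr := Ege _ _ Ez.
have key g : G g -> `|z.1 + z.2| ^+ 2 <= inner (g.1 + z.2) (g.2 + z.1).
  move=> Gg; have := zP _ _ (Gphi _ Gg).
  rewrite innerBr inner_normE hprod_norm_sq inner_hprodE normsqD !innerE.
  by rewrite (innerC g.1 z.1) (innerC z.2 z.1); lra.
have Gw : G (- z.2, - z.1).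
  apply: GM => g Gg /=; rewrite -!opprD innerNl innerNr opprK innerC (addrC z.2) (addrC z.1).
  exact: le_trans (sqr_ge0 _) (key g Gg).
exists (- z.2, - z.1) => //=.
have := key _ Gw; rewrite /= !addNr inner0l => h.
have : `|z.1 + z.2| ^+ 2 == 0 by rewrite eq_le h sqr_ge0.
by rewrite sqrf_eq0 normr_eq0 => /eqP e; rewrite -opprD addrC e oppr0.
Qed.

(** Minty's theorem for the graph of [l *: A - y]. *)
Lemma maximal_monotone_range (D : set X) (A : X -> X) (l : R) (y : X) :
  maximal_monotone (op_graph D A) -> 0 < l ->
  exists2 x, D x & x + l *: A x = y.
Proof.
move=> GM l0; have Gm := GM.1.
pose G := [set p : X * X | D p.1 /\ p.2 = l *: A p.1 - y].
have [||g [Dg ->] gE] := @minty G.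
- move=> p q [Dp ->] [Dq ->].
  rewrite opprB addrA addrNK -scalerBr innerZl mulr_ge0 ?(ltW l0)//.
  by apply: (Gm (p.1, A p.1) (q.1, A q.1)); [exists p.1|exists q.1].
- move=> z zG; suff : op_graph D A (z.1, l^-1 *: (z.2 + y)).
    move=> [x Dx [xz1 xz]]; split; rewrite /= -xz1 //.
    by rewrite xz scalerA divff ?gt_eqF// scale1r addrK.
  apply: maximal_monotone_mem => // _ [x Dx <-] /=.
  have := zG (x, l *: A x - y) (conj Dx erefl).
  rewrite /= opprB addrA => h.
  have -> : l^-1 *: (z.2 + y) - A x = l^-1 *: (z.2 + y - l *: A x).
    by rewrite scalerBr scalerA mulVf ?gt_eqF// scale1r.
  by rewrite innerZl mulr_ge0 ?invr_ge0 ?(ltW l0).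
exists g.1 => //; apply/eqP; rewrite -subr_eq0 -addrA; exact/eqP.
Qed.

End minty.

(** * Resolvents and Yosida approximations *)

(** The form of maximal monotonicity used below: by Minty's theorem it is what
    maximality amounts to, and it passes to Hilbert sums componentwise. *)
Definition m_monotone (R : realType) (X : hilbertType R) (D : set X)
    (A : X -> X) :=
  (forall x y, D x -> D y -> 0 <= inner (A x - A y) (x - y)) /\
  (forall l y, 0 < l -> exists2 x, D x & x + l *: A x = y).

Definition resolvent (R : realType) (X : hilbertType R) (D : set X)
    (A : X -> X) (l : R) (y : X) : X := xget 0 [set x | D x /\ x + l *: A x = y].

Definition yosida (R : realType) (X : hilbertType R) (D : set X)
    (A : X -> X) (l : R) (y : X) : X := l^-1 *: (y - resolvent D A l y).

Lemma maximal_m_monotone (R : realType) (X : hilbertType R) (D : set X)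
  (A : X -> X) : maximal_monotone (op_graph D A) -> m_monotone D A.
Proof.
move=> Amax; split=> [x y Dx Dy|l y l0]; last exact: maximal_monotone_range.
by apply: (Amax.1 (x, A x) (y, A y)); [exists x|exists y].
Qed.

(** Used with [f] a value of the perturbation, so that results on [A] become
    results on the speed [|A x - f|]. *)
Lemma m_monotone_shift (R : realType) (X : hilbertType R) (D : set X)
  (A : X -> X) (f : X) : m_monotone D A -> m_monotone D (fun x => A x - f).
Proof.
move=> [Am Ar]; split=> [x y Dx Dy|l y l0].
  by rewrite opprB addrA addrNK; exact: Am.
have [x Dx xy] := Ar l (y + l *: f) l0; exists x => //.
by rewrite scalerBr addrA xy addrK.
Qed.

Section resolvent_theory.
Context {R : realType} {X : hilbertType R} (D : set X) (A : X -> X).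
Hypothesis Am : m_monotone D A.
Local Notation J := (resolvent D A).
Local Notation Y := (yosida D A).
Implicit Types (l m : R) (x y z : X).

Lemma resolventP l y : 0 < l -> D (J l y) /\ J l y + l *: A (J l y) = y.
Proof.
move=> l0; have [x Dx xy] := Am.2 l y l0.
exact: (@xgetPex _ 0 [set x | D x /\ x + l *: A x = y] (ex_intro _ x (conj Dx xy))).
Qed.

Lemma yosidaE l y : 0 < l -> A (J l y) = Y l y.
Proof.
move=> l0; have [_ e] := resolventP y l0.
by rewrite /yosida -[X in X - _]e addrC addKr scalerA mulVf ?gt_eqF// scale1r.
Qed.

Lemma resolvent_yosida l y : 0 < l -> y - J l y = l *: Y l y.
Proof. by move=> l0; rewrite /yosida scalerA divff ?gt_eqF// scale1r. Qed.

Lemma monotone_expand l x y : 0 <= l -> D x -> D y ->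
  `|x - y| <= `|(x + l *: A x) - (y + l *: A y)|.
Proof.
move=> l0 Dx Dy; rewrite -(@ler_pXn2r _ 2)// ?nnegrE//.
have -> : x + l *: A x - (y + l *: A y) = (x - y) + l *: (A x - A y).
  by rewrite scalerBr opprD addrACA.
rewrite [leRHS]normsqD innerZr innerC -addrA lerDl addr_ge0// ?sqr_ge0//.
by rewrite !mulr_ge0// Am.1.
Qed.

Lemma resolvent_dist l y z : 0 < l -> `|J l y - J l z| <= `|y - z|.
Proof.
move=> l0; have [Dy ey] := resolventP y l0; have [Dz ez] := resolventP z l0.
by apply: le_trans (monotone_expand (ltW l0) Dy Dz) _; rewrite ey ez.
Qed.

Lemma resolvent_id l x : 0 < l -> D x -> J l (x + l *: A x) = x.
Proof.
move=> l0 Dx; have [Dy ey] := resolventP (x + l *: A x) l0.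
apply/eqP; rewrite -subr_eq0 -normr_le0.
by apply: le_trans (monotone_expand (ltW l0) Dy Dx) _; rewrite ey subrr normr0.
Qed.

Lemma cvg_resolvent l (x : nat -> X) y : 0 < l -> x @ \oo --> y ->
  J l (x n) @[n --> \oo] --> J l y.
Proof.
move=> l0 xy; apply/cvgrPdist_lt => e e0.
move/cvgrPdist_lt : xy => /(_ _ e0); apply: filterS => n.
by apply: le_lt_trans; exact: resolvent_dist.
Qed.

(** [x n] is the image of [x n + A (x n)] by the resolvent, which is continuous. *)
Lemma m_monotone_closed (x : nat -> X) y z : (forall n, D (x n)) ->
  x @ \oo --> y -> A (x n) @[n --> \oo] --> z -> D y /\ A y = z.
Proof.
move=> Dx xy xz.
have s : x n + 1 *: A (x n) @[n --> \oo] --> y + 1 *: z.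
  by apply: cvgD => //; apply: cvgZr.
have /= := cvg_resolvent ltr01 s.
under eq_fun do rewrite resolvent_id//.
move=> xJ; have e : y = J 1 (y + 1 *: z) by exact: cvg_unique xy xJ.
have [] := resolventP (y + 1 *: z) ltr01; rewrite -e => Dy.
by rewrite !scale1r => /addrI.
Qed.

Lemma yosida_le l x : 0 < l -> D x -> `|Y l x| <= `|A x|.
Proof.
move=> l0 Dx; rewrite /yosida normrZ gtr0_norm ?invr_gt0// mulrC ler_pdivrMr//.
rewrite -[X in `|X - _|](resolvent_id l0 Dx).
rewrite (le_trans (resolvent_dist _ _ l0))// addrC addKr normrZ gtr0_norm//.
by rewrite mulrC.
Qed.

Lemma yosida_dist l x y : 0 < l -> `|Y l x - Y l y| <= 2 / l * `|x - y|.
Proof.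
move=> l0; rewrite /yosida -scalerBr normrZ gtr0_norm ?invr_gt0//.
rewrite [leRHS]mulrAC mulrC ler_wpM2r ?invr_ge0 ?(ltW l0)//.
have -> : x - J l x - (y - J l y) = (x - y) - (J l x - J l y).
  by rewrite !opprB [_ - y]addrC addrACA [- J l x + _]addrC.
rewrite mulr_natl mulr2n (le_trans (ler_normB _ _))// lerD//.
exact: resolvent_dist.
Qed.

(** Monotonicity between the resolvents of step [l] and [m] gives
    [(l + m) <a, b> >= l |a|^2 + m |b|^2] for the Yosida values [a], [b]. The
    conclusion makes bounded Yosida values converge strongly as [l] tends to
    [0]. *)
Lemma yosida_sub l m x : 0 < l -> l <= m ->
  `|Y l x - Y m x| ^+ 2 <= `|Y l x| ^+ 2 - `|Y m x| ^+ 2.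
Proof.
move=> l0; rewrite le_eqVlt => /predU1P[->|lm].
  by rewrite !subrr normr0 expr0n.
have m0 := lt_trans l0 lm.
have [Dp _] := resolventP x l0; have [Dq _] := resolventP x m0.
have := Am.1 _ _ Dp Dq; rewrite !yosidaE//.
have -> : J l x - J m x = m *: Y m x - l *: Y l x.
  by rewrite -!resolvent_yosida// opprB [RHS]addrC addrA subrK.
move: (Y l x) (Y m x) => u v.
rewrite normsqB !innerE !inner_normE (innerC v).
set a := `|u| ^+ 2; set b := `|v| ^+ 2; set c := inner _ _ => h.
have h2 : 0 <= a - 2 * c + b by rewrite -normsqB sqr_ge0.
have : 0 <= (l + m) * (2 * c - 2 * b).
  have -> : (l + m) * (2 * c - 2 * b) =
    2 * (m * c - l * a - (m * b - l * c)) + 2 * l * (a - b) by ring.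
  have : 0 <= (m - l) * (a - b) by nra.
  rewrite pmulr_rge0 ?subr_gt0// => ab.
  by rewrite addr_ge0 ?mulr_ge0 ?(ltW l0)//; lra.
by rewrite pmulr_rge0 ?addr_gt0//; lra.
Qed.

(** The squared norms of the Yosida values increase as the step decreases, so
    when bounded they converge, and [yosida_sub] turns this into a Cauchy
    property of the values themselves; the limit is [A x] as the graph is
    closed. *)
Lemma bounded_yosida x K : (forall l, 0 < l -> `|Y l x| <= K) ->
  [/\ D x, `|A x| <= K &
    forall e, 0 < e -> exists2 l, 0 < l & `|A x - Y l x| < e].
Proof.
move=> YK.
pose l n : R := n.+1%:R^-1.
have l0 n : 0 < l n by rewrite invr_gt0.
have lle n k : (n <= k)%N -> l k <= l n by move=> nk; rewrite lef_pV2 ?posrE// ler_nat.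
pose g n := `|Y (l n) x| ^+ 2.
have g_nd n k : (n <= k)%N -> g n <= g k.
  by move=> nk; rewrite -subr_ge0; apply: le_trans (sqr_ge0 _) (yosida_sub x (l0 k) (lle _ _ nk)).
have gK n : g n <= K ^+ 2.
  by rewrite ler_pXn2r ?nnegrE ?YK// (le_trans _ (YK 1 ltr01)).
have ndg : nondecreasing_seq g by move=> n k; exact: g_nd.
have /cvg_ex[G gG] : cvgn g by apply: nondecreasing_is_cvgn => //; exists (K ^+ 2) => _ [n _ <-].
have gG' n : g n <= G.
  by rewrite -(cvg_lim _ gG)//; apply: nondecreasing_cvgn_le => //; apply/cvg_ex; exists G.
have /cvg_ex[z Yz] : cvgn (fun n => Y (l n) x).
  apply: (@cauchy_seq_cvg _ _ _ (fun n => Num.sqrt (G - g n))).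
    rewrite -[X in _ --> X]sqrtr0; apply: continuous_cvg; first exact: sqrt_continuous.
    by rewrite -(subrr G); apply: cvgB => //; exact: cvg_cst.
  move=> n k nk; rewrite -(@ler_pXn2r _ 2)// ?nnegrE ?sqrtr_ge0// sqr_sqrtr ?subr_ge0//.
  rewrite -normrN opprB (le_trans (yosida_sub x (l0 k) (lle _ _ nk)))//.
  by rewrite lerB // gG'.
have Jx : J (l n) x @[n --> \oo] --> x.
  rewrite (_ : (fun n => _) = (fun n => x - l n *: Y (l n) x)); last first.
    by apply/funext => n; rewrite -resolvent_yosida// opprB addrC subrK.
  rewrite -[X in _ --> X](subr0 x); apply: cvgB; first exact: cvg_cst.
  by rewrite -(scale0r z); apply: cvgZ => //; exact: cvg_harmonic.
have [Dx Ax] : D x /\ A x = z.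
  apply: (m_monotone_closed _ Jx) => [n|]; first by have [] := resolventP x (l0 n).
  by under eq_fun do rewrite yosidaE//.
split=> //.
  rewrite Ax; apply: (@ler_cvg_to _ \oo _ _ (fun n => `|Y (l n) x|) (fun=> K)).
  - exact: cvg_norm.
  - exact: cvg_cst.
  - by apply: nearW => n; exact: YK.
move=> e e0; rewrite Ax.
by move/cvgrPdist_lt : Yz => /(_ _ e0)[N _ /(_ N (leqnn N))] h; exists (l N).
Qed.

End resolvent_theory.

(** Demiclosedness: a bound on [A - f] survives strong limits of its argument,
    because the Yosida approximations are continuous. *)
Lemma m_monotone_demiclosed (R : realType) (X : hilbertType R) (D : set X)
    (A : X -> X) (f : X) (x : nat -> X) (k : nat -> R) y K : m_monotone D A ->
  (forall n, D (x n)) -> (forall n, `|A (x n) - f| <= k n) ->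
  x @ \oo --> y -> k @ \oo --> K ->
  D y /\ `|A y - f| <= K.
Proof.
move=> Am Dx xk xy kK; have Am' := m_monotone_shift f Am.
have [|//] := @bounded_yosida _ _ _ _ Am' y K.
move=> l l0.
apply: (@ler_cvg_to _ \oo _ _ (fun=> `|yosida D (fun x => A x - f) l y|)
    (fun n => k n + 2 / l * `|y - x n|)).
- exact: cvg_cst.
- rewrite -[X in _ --> X]addr0; apply: cvgD => //.
  rewrite -(mulr0 (2 / l)); apply: cvgM; first exact: cvg_cst.
  by rewrite -(@normr0 _ X) -(subrr y); apply: cvg_norm; apply: cvgB => //; exact: cvg_cst.
- apply: nearW => n; rewrite -lerBlDl.
  apply: le_trans (yosida_dist Am' _ _ l0).
  apply: le_trans (lerB_dist _ _); rewrite lerD2l lerN2 (le_trans _ (xk n))//.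
  exact: (yosida_le Am' l0 (Dx n)).
Qed.

(** * The semi-implicit Euler scheme *)

Lemma geometric_cauchy_cvg (R : realType) (X : completeNormedModType R)
    (u : nat -> X) (c q : R) (N : nat) : 0 <= c -> 0 <= q -> q < 1 ->
  (forall n, (N <= n)%N -> `|u n.+1 - u n| <= c * q ^+ n) -> cvgn u.
Proof.
move=> c0 q0 q1 uq.
suff /cvg_ex[l ul] : cvgn (fun n => u (n + N)%N).
  by apply/cvg_ex; exists l; rewrite -(cvg_shiftn N).
apply: (@cauchy_seq_cvg _ _ _ (fun n => c / (1 - q) * q ^+ (n + N))).
  rewrite -(mulr0 (c / (1 - q))); apply: cvgM; first exact: cvg_cst.
  have := @cvg_expr R q; rewrite ger0_norm// => /(_ q1).
  by rewrite -(@cvg_shiftn N).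
have q1' : 0 < 1 - q by rewrite subr_gt0.
move=> n m nm; apply: (@le_trans _ _ (c / (1 - q) * (q ^+ (n + N) - q ^+ (m + N)))).
  elim: m nm => [|m IH]; first by rewrite leqn0 => /eqP ->; rewrite !subrr normr0 mulr0.
  rewrite leq_eqVlt => /predU1P[->|]; first by rewrite !subrr normr0 mulr0.
  rewrite ltnS => /IH {}IH.
  rewrite -(subrKA (u (m + N)%N)) (le_trans (ler_normD _ _))//.
  apply: (le_trans (lerD IH _)); first by rewrite distrC; apply: uq; rewrite leq_addl.
  rewrite addSn exprS.
  have -> : c * q ^+ (m + N) = c / (1 - q) * (q ^+ (m + N) - q * q ^+ (m + N)).
    by field; rewrite gt_eqF.
  by rewrite -mulrDr subrKA.
by rewrite ler_wpM2l ?gerBl ?exprn_ge0// divr_ge0// ltW.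
Qed.

Section scheme.
Context {R : realType} {X : hilbertType R} (D : set X) (A F : X -> X) (L : R).
Hypotheses (Am : m_monotone D A) (L0 : 0 <= L).
Hypothesis FL : forall x y, `|F x - F y| <= L * `|x - y|.
Implicit Types (l h t : R) (x y z p : X).

Definition euler_step l x := resolvent D A l (x + l *: F x).
Local Notation S := euler_step.

Lemma euler_step_in l x : 0 < l -> D (S l x).
Proof. by move=> l0; have [] := resolventP Am (x + l *: F x) l0. Qed.

Lemma euler_stepE l x : 0 < l -> l *: A (S l x) = (x - S l x) + l *: F x.
Proof.
move=> l0; have [_ e] := resolventP Am (x + l *: F x) l0.
rewrite -/(S l x) in e.
by rewrite addrAC -e [S l x + _]addrC addrK.
Qed.

Lemma euler_step_A l x : 0 < l -> A (S l x) = l^-1 *: (x - S l x) + F x.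
Proof.
move=> l0; apply: (@scalerI _ _ l); first by rewrite gt_eqF.
by rewrite euler_stepE// scalerDr scalerA divff ?gt_eqF// scale1r.
Qed.

Lemma euler_step_dist l x y : 0 < l ->
  `|S l x - S l y| <= (1 + l * L) * `|x - y|.
Proof.
move=> l0; apply: le_trans (resolvent_dist Am _ _ l0) _.
rewrite opprD addrACA -scalerBr (le_trans (ler_normD _ _))// mulrDl mul1r lerD2l.
by rewrite normrZ gtr0_norm// -mulrA ler_pM2l.
Qed.

Lemma iter_step_dist l x y k : 0 < l ->
  `|iter k (S l) x - iter k (S l) y| <= (1 + l * L) ^+ k * `|x - y|.
Proof.
move=> l0; elim: k => [|k IH]; first by rewrite mul1r.
rewrite !iterS exprS -mulrA (le_trans (euler_step_dist _ _ l0))//.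
by rewrite ler_wpM2l// addr_ge0// mulr_ge0// ltW.
Qed.

Lemma pow_le_expR l k t : 0 <= l -> l * k%:R <= t ->
  (1 + l * L) ^+ k <= expR (L * t).
Proof.
move=> l0 lk; apply: (@le_trans _ _ (expR (l * L) ^+ k)).
  by rewrite lerXn2r ?nnegrE ?expR_ge0 ?expR_ge1Dx// addr_ge0// mulr_ge0.
rewrite -expRM_natr ler_expR.
have -> : l * L * k%:R = L * (l * k%:R) by ring.
by rewrite ler_wpM2l.
Qed.

(** [x] is the resolvent of [x + l *: A x], and resolvents are nonexpansive. *)
Lemma euler_step_move l x : 0 < l -> D x ->
  `|S l x - x| <= l * `|A x - F x|.
Proof.
move=> l0 Dx; rewrite -[X in `|_ - X|](resolvent_id Am l0 Dx).
apply: le_trans (resolvent_dist Am _ _ l0) _.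
by rewrite opprD addrACA subrr add0r -scalerBr normrZ gtr0_norm// distrC.
Qed.

Lemma iter_step_speed l x k t : 0 < l -> D x -> l * k%:R <= t ->
  `|iter k.+1 (S l) x - iter k (S l) x| <= l * (expR (L * t) * `|A x - F x|).
Proof.
move=> l0 Dx kt; rewrite iterSr (le_trans (iter_step_dist _ _ _ l0))//.
rewrite mulrCA ler_pM ?exprn_ge0 ?addr_ge0 ?mulr_ge0 ?(ltW l0)//.
  exact: pow_le_expR (ltW l0) kt.
exact: euler_step_move.
Qed.

Lemma iter_step_move l x k t : 0 < l -> D x -> l * k%:R <= t ->
  `|iter k (S l) x - x| <= l * k%:R * (expR (L * t) * `|A x - F x|).
Proof.
move=> l0 Dx; elim: k => [|k IH] kt; first by rewrite subrr normr0 mulr0 mul0r.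
have kt' : l * k%:R <= t by apply: le_trans kt; rewrite ler_pM2l// ler_nat.
rewrite -(subrKA (iter k (S l) x)) (le_trans (ler_normD _ _))//.
rewrite -addn1 natrD mulrDr mulr1 mulrDl addrC lerD ?IH//.
by rewrite addn1; exact: iter_step_speed.
Qed.

(** Comparing a step of length [2 h] with two steps of length [h]: expand
    [|x1 - y2|^2] and use that [A] is monotone between [x1] and each of [y1],
    [y2]; what remains is a relative error of order [h] and an absolute one of
    order [h ^+ 2]. *)
Lemma step_halving h V x0 y0 : 0 < h -> h * L <= 1 ->
  let x1 := S (2 * h) x0 in let y1 := S h y0 in let y2 := S h y1 in
  `|x1 - x0| <= 2 * h * V -> `|y1 - y0| <= h * V -> `|y2 - y1| <= h * V ->
  `|x1 - y2| ^+ 2 <= (1 + 14 * h * L) * `|x0 - y0| ^+ 2 + 22 * (h * V) ^+ 2.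
Proof.
move=> h0 hL x1 y1 y2 dx dy1 dy2.
have h20 : 0 < 2 * h by rewrite mulr_gt0.
have Dx1 : D x1 by exact: euler_step_in.
have Dy1 : D y1 by exact: euler_step_in.
have Dy2 : D y2 by exact: euler_step_in.
have ex := euler_stepE x0 h20; have ey1 := euler_stepE y0 h0.
have ey2 := euler_stepE y1 h0.
have Ax := euler_step_A x0 h20; have Ay1 := euler_step_A y0 h0.
rewrite -/x1 in ex Ax; rewrite -/y1 in ey1 Ay1; rewrite -/y1 -/y2 in ey2.
set e0 := x0 - y0; set e1 := x1 - y2.
have hV : 0 <= h * V by apply: le_trans dy1.
have V0 : 0 <= V by rewrite -(pmulr_rge0 _ h0).
pose a := `|e0|.
have a0 : 0 <= a by exact: normr_ge0.
have eE : e1 - e0 = h *: (A y2 - A x1) + h *: (A y1 - A x1)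
                    + h *: (F x0 - F y1) + h *: (F x0 - F y0).
  apply: inner_inj => v; move/(congr1 (inner^~ v)) : ex.
  move/(congr1 (inner^~ v)) : ey1; move/(congr1 (inner^~ v)) : ey2.
  by rewrite /e1 /e0 !innerE; lra.
have e1a : `|e1| <= a + 4 * (h * V).
  have -> : e1 = e0 + (x1 - x0) - (y1 - y0) - (y2 - y1).
    by apply: inner_inj => v; rewrite /e1 /e0 !innerE; ring.
  apply: le_trans (ler_normB _ _) _; apply: le_trans (lerD (ler_normB _ _) dy2) _.
  apply: le_trans (lerD (lerD (ler_normD _ _) dy1) (lexx _)) _.
  rewrite -/a; lra.
have e01 : `|e1| ^+ 2 - a ^+ 2 <= 2 * inner (e1 - e0) e1.
  have := sqr_ge0 `|e1 - e0|; rewrite normsqB innerBl inner_normE (innerC e0).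
  by rewrite -/a; lra.
have i1 : inner (A y2 - A x1) e1 <= 0.
  have := Am.1 _ _ Dy2 Dx1; rewrite -(opprB x1) innerNr oppr_ge0. by [].
have bA : `|A y1 - A x1| <= 2 * V + L * a.
  rewrite Ax Ay1 opprD addrACA (le_trans (ler_normD _ _))// lerD//; last first.
    by rewrite distrC FL.
  have -> : 2 * V = V + V by ring.
  rewrite (le_trans (ler_normB _ _))// !normrZ distrC (distrC x0).
  by rewrite !gtr0_norm ?invr_gt0// lerD// mulrC ler_pdivrMr// mulrC.
have i2 : inner (A y1 - A x1) e1 <= (2 * V + L * a) * (h * V).
  have -> : e1 = (x1 - y1) + (y1 - y2) by rewrite addrA subrK.
   rewrite innerDr -[leRHS]add0r lerD//.
    have := Am.1 _ _ Dy1 Dx1; rewrite -(opprB x1) innerNr oppr_ge0. by [].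
  apply: le_trans (inner_le _ _) _; rewrite ler_pM//.
  by rewrite distrC.
have i3 : inner (F x0 - F y1) e1 <= L * (a + h * V) * (a + 4 * (h * V)).
  apply: le_trans (inner_le _ _) _; rewrite ler_pM//.
  rewrite (le_trans (FL _ _))// ler_wpM2l//.
  rewrite -(subrKA y0) (le_trans (ler_normD _ _))// lerD//.
  by rewrite distrC.
have i4 : inner (F x0 - F y0) e1 <= L * a * (a + 4 * (h * V)).
  by apply: le_trans (inner_le _ _) _; rewrite ler_pM.
have : inner (e1 - e0) e1 <= h * ((2 * V + L * a) * (h * V) +
    L * (a + h * V) * (a + 4 * (h * V)) + L * a * (a + 4 * (h * V))).
  rewrite eE !innerDl !innerZl -!mulrDr ler_pM2l//.
  by rewrite -[leRHS]add0r -!addrA !lerD//; rewrite !addrA.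
rewrite -/a; set w := h * V => bnd.
have w0 : 0 <= w by [].
have hLa : 0 <= h * L by rewrite mulr_ge0// ltW.
have hE : h * ((2 * V + L * a) * w + L * (a + w) * (a + 4 * w) + L * a * (a + 4 * w)) =
  2 * w ^+ 2 + 10 * (h * L) * (w * a) + 2 * (h * L) * a ^+ 2 + 4 * (h * L) * w ^+ 2.
  by rewrite /w; ring.
have wa : 0 <= (h * L) * (w ^+ 2 + a ^+ 2 - 2 * (w * a)).
  by rewrite mulr_ge0//; have := sqr_ge0 (w - a); rewrite sqrrB; lra.
have hw : (h * L) * w ^+ 2 <= w ^+ 2 by rewrite -[leRHS]mul1r ler_wpM2r// sqr_ge0.
have -> : 1 + 14 * h * L = 1 + 14 * (h * L) by ring.
move: bnd e01 wa hw; rewrite hE; lra.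
Qed.

End scheme.

(** * Convergence along dyadic steps *)

Section flow.
Context {R : realType} {X : hilbertType R} (D : set X) (A F : X -> X) (L : R).
Hypotheses (Am : m_monotone D A) (L0 : 0 <= L).
Hypothesis FL : forall x y, `|F x - F y| <= L * `|x - y|.
Implicit Types (l h t : R) (x y z p : X).
Local Notation S := (euler_step D A F).

Lemma halving_error h t x k (V := expR (L * t) * `|A x - F x|) :
  0 < h -> h * L <= 1 -> D x -> 2 * h * k%:R <= t ->
  `|iter k (S (2 * h)) x - iter k.*2 (S h) x| ^+ 2
    <= (1 + 14 * h * L) ^+ k * (k%:R * (22 * (h * V) ^+ 2)).
Proof.
move=> h0 hL Dx; elim: k => [|k IH] kt.
  by rewrite subrr normr0 expr0n/= mul0r mulr0.
have kt' : 2 * h * k%:R <= t by apply: le_trans kt; rewrite ler_pM2l ?mulr_gt0// ler_nat.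
have h20 : 0 < 2 * h by rewrite mulr_gt0.
have s2 : h * (k.*2).+1%:R <= t.
  apply: le_trans kt; rewrite [2 * h]mulrC -mulrA ler_pM2l// -natrM ler_nat mul2n doubleS.
  exact: leqnSn.
have s1 : h * (k.*2)%:R <= t by apply: le_trans s2; rewrite ler_pM2l// ler_nat.
have c0 : 0 <= 14 * h * L by rewrite !mulr_ge0// ltW.
have P1 : 1 <= (1 + 14 * h * L) ^+ k by rewrite exprn_ege1// lerDl.
set P := _ ^+ k in P1 IH; set w2 := (h * V) ^+ 2 in IH *.
have w20 : 0 <= w2 by exact: sqr_ge0.
apply: le_trans (step_halving Am L0 FL (V := V) h0 hL _ _ _) _.
- exact: (iter_step_speed Am L0 FL h20 Dx kt').
- exact: (iter_step_speed Am L0 FL h0 Dx s1).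
- exact: (iter_step_speed Am L0 FL h0 Dx s2).
rewrite [_ ^+ k.+1]exprS -/P -[k.+1%:R]natr1 -/w2.
have : (1 + 14 * h * L) * `|iter k (S (2 * h)) x - iter k.*2 (S h) x| ^+ 2 <=
    (1 + 14 * h * L) * (P * (k%:R * (22 * w2))).
  by rewrite ler_wpM2l ?IH// addr_ge0.
have : 22 * w2 <= (1 + 14 * h * L) * P * (22 * w2).
  apply: ler_peMl; first by rewrite mulr_ge0.
  apply: le_trans P1 _; apply: ler_peMl; last by rewrite lerDl.
  by rewrite exprn_ge0// addr_ge0.
move=> a b; apply: le_trans (lerD b a) _.
by rewrite le_eqVlt; apply/orP; left; apply/eqP; ring.
Qed.

Definition dyadic_step (n : nat) : R := 2^-1 ^+ n.
Definition dyadic_index (n : nat) t : nat := Num.trunc (t * 2 ^+ n).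

Lemma dyadic_step_gt0 n : 0 < dyadic_step n.
Proof. by rewrite exprn_gt0. Qed.

Lemma dyadic_stepS n : 2 * dyadic_step n.+1 = dyadic_step n.
Proof. by rewrite /dyadic_step exprS mulrA divff ?mul1r. Qed.

Lemma dyadic_step2 n : dyadic_step n * 2 ^+ n = 1.
Proof. by rewrite /dyadic_step exprVn mulVf// expf_neq0. Qed.

Lemma dyadic_stepK n t : dyadic_step n * (t * 2 ^+ n) = t.
Proof. by rewrite mulrCA dyadic_step2 mulr1. Qed.

Lemma cvg_dyadic_step : dyadic_step @ \oo --> (0 : R).
Proof. by apply: cvg_expr; rewrite ger0_norm; lra. Qed.

Lemma dyadic_index_le n t : 0 <= t -> dyadic_step n * (dyadic_index n t)%:R <= t.
Proof.
move=> t0; rewrite -[leRHS](dyadic_stepK n) ler_pM2l ?dyadic_step_gt0//.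
by rewrite /dyadic_index truncn_le mulr_ge0// exprn_ge0.
Qed.

Lemma dyadic_index_gt n t : 0 <= t -> t < dyadic_step n * (dyadic_index n t).+1%:R.
Proof.
move=> t0; rewrite -[ltLHS](dyadic_stepK n) ltr_pM2l ?dyadic_step_gt0//.
by rewrite -truncn_lt_nat ?mulr_ge0 ?exprn_ge0.
Qed.

Lemma dyadic_indexS n t : 0 <= t ->
  dyadic_index n.+1 t = (dyadic_index n t).*2 \/
  dyadic_index n.+1 t = (dyadic_index n t).*2.+1.
Proof.
move=> t0; have t0' k : 0 <= t * 2 ^+ k by rewrite mulr_ge0// exprn_ge0.
have a : ((dyadic_index n t).*2 <= dyadic_index n.+1 t)%N.
  rewrite truncn_ge_nat// -mul2n natrM exprS mulrCA ler_pM2l//.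
  by rewrite /dyadic_index truncn_le.
have b : (dyadic_index n.+1 t < (dyadic_index n t).+1.*2)%N.
  rewrite truncn_lt_nat// -mul2n natrM exprS mulrCA ltr_pM2l//.
  by rewrite -truncn_lt_nat.
move: b; rewrite doubleS ltnS leq_eqVlt ltnS => /predU1P[->|b]; first by right.
by left; apply/eqP; rewrite eqn_leq a b.
Qed.

Lemma dyadic_index_mono n s t : s <= t -> (dyadic_index n s <= dyadic_index n t)%N.
Proof. by move=> st; apply: le_truncn; rewrite ler_wpM2r// exprn_ge0. Qed.

Lemma cvg_dyadic_index t : 0 <= t ->
  dyadic_step n * (dyadic_index n t)%:R @[n --> \oo] --> t.
Proof.
move=> t0; apply: (@squeeze_cvgr _ _ _ _ (fun n => t - dyadic_step n) (fun=> t)).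
- apply: nearW => n; rewrite dyadic_index_le// andbT lerBlDr ltW//.
  by have := dyadic_index_gt n t0; rewrite -natr1 mulrDr mulr1.
- rewrite -[X in _ --> X](subr0 t); apply: cvgB; [exact: cvg_cst|exact: cvg_dyadic_step].
- exact: cvg_cst.
Qed.

Definition flow x t : X :=
  lim (iter (dyadic_index n t) (S (dyadic_step n)) x @[n --> \oo]).

(** By [halving_error] consecutive approximations differ by a multiple of the
    square root of the step, a geometric sequence of ratio [q]. *)
Lemma cvg_flow x t : D x -> 0 <= t ->
  iter (dyadic_index n t) (S (dyadic_step n)) x @[n --> \oo] --> flow x t.
Proof.
move=> Dx t0; pose V := expR (L * t) * `|A x - F x|.
have V0 : 0 <= V by rewrite mulr_ge0// expR_ge0.
pose c := 11 * t * expR (L * (7 * t)).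
have c0 : 0 <= c by rewrite !mulr_ge0// expR_ge0.
pose q : R := Num.sqrt 2^-1.
have qq : q * q = 2^-1 by rewrite -expr2 sqr_sqrtr.
have q0 : 0 <= q by rewrite sqrtr_ge0.
have q1 : q < 1 by rewrite -(@ltr_pXn2r _ 2)// ?nnegrE// expr2 qq expr1n; lra.
have dq n : dyadic_step n = q ^+ n * q ^+ n by rewrite -exprMn qq.
have [N _ NL] : \forall n \near \oo, dyadic_step n * L <= 1.
  have : dyadic_step n * L @[n --> \oo] --> (0 : R).
    by rewrite -(mul0r L); apply: cvgM; [exact: cvg_dyadic_step|exact: cvg_cst].
  move=> /cvgr_le; exact.
apply: (@geometric_cauchy_cvg _ _ _ (Num.sqrt c * V + V) q N) => //.
  by rewrite addr_ge0// mulr_ge0// sqrtr_ge0.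
move=> n Nn; have h0 := dyadic_step_gt0 n.+1; set h := dyadic_step n.+1 in h0 *.
have hL : h * L <= 1 by apply: NL; rewrite /= (leq_trans Nn).
set k := dyadic_index n t.
have kt : 2 * h * k%:R <= t by rewrite dyadic_stepS dyadic_index_le.
have kt' : h * (k.*2)%:R <= t by rewrite -mul2n natrM mulrA [h * 2]mulrC.
have e1 : `|iter k.*2 (S h) x - iter k (S (2 * h)) x| <= Num.sqrt c * V * q ^+ n.+1.
  rewrite distrC -(@ler_pXn2r _ 2)// ?nnegrE ?mulr_ge0 ?sqrtr_ge0 ?exprn_ge0//.
  apply: le_trans (halving_error h0 hL Dx kt) _.
  have -> : (Num.sqrt c * V * q ^+ n.+1) ^+ 2 = c * V ^+ 2 * h.
    by rewrite 2!exprMn sqr_sqrtr// [q ^+ _ ^+ 2]expr2 -dq.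
  rewrite -/V /c.
  apply: (@le_trans _ _ (expR (L * (7 * t)) * (11 * t * h * V ^+ 2))); last first.
    by rewrite le_eqVlt; apply/orP; left; apply/eqP; ring.
  apply: ler_pM.
  - by rewrite exprn_ge0// addr_ge0// !mulr_ge0// ltW.
  - by rewrite mulr_ge0// mulr_ge0// sqr_ge0.
  - apply: pow_le_expR => //; first by rewrite mulr_ge0// ltW.
    by move: kt; lra.
  - have -> : k%:R * (22 * (h * V) ^+ 2) = 11 * (2 * h * k%:R) * h * V ^+ 2 by ring.
    by rewrite ler_wpM2r ?sqr_ge0// ler_wpM2r ?(ltW h0)// ler_wpM2l.
have qn1 : q ^+ n.+1 <= 1 by rewrite exprn_ile1// ltW.
have hV : h * V <= V * q ^+ n.+1.
  rewrite mulrC ler_wpM2l// /h dq -[leRHS]mulr1 ler_wpM2l// exprn_ge0//.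
apply: (@le_trans _ _ ((Num.sqrt c * V + V) * q ^+ n.+1)); last first.
  rewrite ler_wpM2l ?addr_ge0 ?mulr_ge0 ?sqrtr_ge0//.
  by rewrite exprS ler_piMl ?exprn_ge0// ltW.
rewrite mulrDl -(subrKA (iter k.*2 (S h) x)) (le_trans (ler_normD _ _))// addrC.
rewrite lerD//; first by rewrite -dyadic_stepS.
apply: le_trans hV.
have [->|->] := dyadic_indexS n t0; first by rewrite subrr normr0 mulr_ge0// ltW.
exact: iter_step_speed.
Qed.

(** Sum over the steps of [|x' - p|^2 - |x - p|^2 <= 2 <x' - x, x' - p>], where
    [A x'] is replaced by [A p] by monotonicity and, all iterates being within
    [r] of [y], the other terms by their values at [y]. *)
Lemma iter_step_energy l t y p k (r := t * (expR (L * t) * `|A y - F y|)) :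
  0 < l -> D y -> D p -> l * k%:R <= t ->
  `|iter k (S l) y - p| ^+ 2 - `|y - p| ^+ 2 <=
  2 * (l * k%:R) * (inner (F y - A p) (y - p) + L * r * (r + `|y - p|) +
                `|F y - A p| * r).
Proof.
move=> l0 Dy Dp; elim: k => [|k IH] kt; first by rewrite subrr mulr0 mulr0 mul0r.
have kt' : l * k%:R <= t by apply: le_trans kt; rewrite ler_pM2l// ler_nat.
set x := iter k (S l) y in IH *; set x' := iter k.+1 (S l) y.
have V0 : 0 <= expR (L * t) * `|A y - F y| by rewrite mulr_ge0// expR_ge0.
have xr : `|x - y| <= r.
  by apply: le_trans (iter_step_move Am L0 FL l0 Dy kt') _; rewrite ler_wpM2r.
have xr' : `|x' - y| <= r.
  by apply: le_trans (iter_step_move Am L0 FL l0 Dy kt) _; rewrite ler_wpM2r.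
have r0 : 0 <= r by apply: le_trans xr.
have e : l *: A x' = x - x' + l *: F x by exact: (euler_stepE F Am).
have Dx' : D x' by exact: (euler_step_in F Am).
set B := (_ + _ + _ : R) in IH *.
have hB : inner (F x - A p) (x' - p) <= B.
  have -> : inner (F x - A p) (x' - p) = inner (F y - A p) (y - p)
      + inner (F x - F y) (x' - p) + inner (F y - A p) (x' - y).
    by rewrite !innerE; ring.
  rewrite lerD//; last first.
    by rewrite (le_trans (inner_le _ _))// ler_wpM2l.
  rewrite lerD// (le_trans (inner_le _ _))// ler_pM//.
    by rewrite (le_trans (FL _ _))// ler_wpM2l.
  by rewrite -(subrKA y) (le_trans (ler_normD _ _))// lerD2r.
have mon : 0 <= inner (A x' - A p) (x' - p) by exact: Am.1.
have : `|x' - p| ^+ 2 - `|x - p| ^+ 2 <= 2 * l * B.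
  have -> : x - p = (x' - p) - (x' - x) by rewrite opprB [RHS]addrC subrKA.
  rewrite (normsqB (x' - p)) innerC.
  have -> : inner (x' - x) (x' - p) =
      l * (inner (F x - A p) (x' - p) - inner (A x' - A p) (x' - p)).
    move/(congr1 (inner^~ (x' - p))) : e; rewrite !innerDl !innerZl !innerNl.
    lra.
  have := sqr_ge0 `|x' - x|.
  have : l * (inner (F x - A p) (x' - p) - inner (A x' - A p) (x' - p)) <= l * B.
    by rewrite ler_pM2l//; lra.
  lra.
move: IH => /(_ kt'); rewrite -[k.+1%:R]natr1; lra.
Qed.

(** The step counts [j n] are arbitrary, subject to [l n * j n] tending to [t],
    so that the lemma also applies to the scheme restarted at an intermediate
    time. *)
Lemma iter_step_limit (y z : X) (l : nat -> R) (j : nat -> nat) t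
    (V := expR (L * t) * `|A y - F y|) (r := t * V) : D y ->
  (forall n, 0 < l n) -> l @ \oo --> (0 : R) ->
  l n * (j n)%:R @[n --> \oo] --> t ->
  iter (j n) (S (l n)) y @[n --> \oo] --> z ->
  [/\ D z, `|A z - F z| <= V, `|z - y| <= r &
    forall p, D p -> `|z - p| ^+ 2 - `|y - p| ^+ 2 <=
      2 * t * (inner (F y - A p) (y - p) + L * r * (r + `|y - p|) +
                `|F y - A p| * r)].
Proof.
move=> Dy l0 lc jt yz.
pose tn n := l n * (j n)%:R.
pose Vn n := expR (L * tn n) * `|A y - F y|.
pose rn n := tn n * Vn n.
have Vc : Vn @ \oo --> V.
  apply: cvgM; last exact: cvg_cst.
  apply: continuous_cvg; first exact: continuous_expR.
  by apply: cvgM => //; exact: cvg_cst.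
have rc : rn @ \oo --> r by exact: cvgM.
(* one step more, since [j n] may be [0] and [A] is controlled after a step *)
have yz' : iter (j n).+1 (S (l n)) y @[n --> \oo] --> z.
  rewrite (_ : (fun n => _) = (fun n => iter (j n) (S (l n)) y +
    (iter (j n).+1 (S (l n)) y - iter (j n) (S (l n)) y))); last first.
    by apply/funext => n; rewrite addrC subrK.
  rewrite -[X in _ --> X]addr0; apply: cvgD => //.
  apply: norm_cvg0; apply: (@squeeze_cvgr _ _ _ _ (fun=> 0) (fun n => l n * Vn n)).
  - by apply: nearW => n; rewrite normr_ge0 (iter_step_speed Am L0 FL (l0 n) Dy).
  - exact: cvg_cst.
  - by rewrite -(mul0r V); apply: cvgM.
have [Dz zV] : D z /\ `|A z - F z| <= V.
  apply: (@m_monotone_demiclosed _ _ _ _ (F z) (fun n => iter (j n).+1 (S (l n)) y)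
    (fun n => Vn n + L * `|iter (j n) (S (l n)) y - z|) _ _ Am) => //.
  - by move=> n; rewrite iterS; exact: (euler_step_in _ Am).
  - move=> n; rewrite iterS (euler_step_A F Am)// -addrA (le_trans (ler_normD _ _))//.
    rewrite lerD// normrZ gtr0_norm ?invr_gt0// mulrC ler_pdivrMr// distrC mulrC.
    exact: iter_step_speed.
  - rewrite -[X in _ --> X]addr0; apply: cvgD => //.
    rewrite -(mulr0 L); apply: cvgM; first exact: cvg_cst.
    rewrite -(@normr0 _ X) -(subrr z); apply: cvg_norm; apply: cvgB => //; exact: cvg_cst.
have cn (a : X) : `|iter (j n) (S (l n)) y - a| @[n --> \oo] --> `|z - a|.
  by apply: cvg_norm; apply: cvgB => //; exact: cvg_cst.
split=> // [|p Dp].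
  apply: (@ler_cvg_to _ \oo _ _ (fun n => `|iter (j n) (S (l n)) y - y|) rn) => //.
  by apply: nearW => n; exact: (iter_step_move Am L0 FL (l0 n) Dy).
pose B r := inner (F y - A p) (y - p) + L * r * (r + `|y - p|) + `|F y - A p| * r.
apply: (@ler_cvg_to _ \oo _ _
  (fun n => `|iter (j n) (S (l n)) y - p| ^+ 2 - `|y - p| ^+ 2)
  (fun n => 2 * tn n * B (rn n))).
- apply: cvgB; last exact: cvg_cst.
  by under eq_fun do rewrite expr2; rewrite expr2; apply: cvgM.
- apply: cvgM; first by apply: cvgM => //; exact: cvg_cst.
  apply: cvgD; last by apply: cvgM => //; exact: cvg_cst.
  apply: cvgD; first exact: cvg_cst.
  apply: cvgM; first by apply: cvgM => //; exact: cvg_cst.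
  by apply: cvgD => //; exact: cvg_cst.
- by apply: nearW => n; exact: (iter_step_energy (l0 n) Dy Dp).
Qed.

End flow.

(** * Differentiability of the limit *)

Section evolution.
Context {R : realType} {X : hilbertType R} (D : set X) (A F : X -> X) (L : R).
Hypotheses (Am : m_monotone D A) (L0 : 0 <= L).
Hypothesis FL : forall x y, `|F x - F y| <= L * `|x - y|.
Implicit Types (l h s t : R) (x y z p : X) (u : R -> X).
Local Notation S := (euler_step D A F).
Local Notation speed u t := (`|A (u t) - F (u t)|).

(** What the limit of the scheme retains, and all that is needed to
    differentiate it: the last clause is a form of the integral inequality
    characterizing solutions, with explicit error terms of second order in
    [t - s]. *)
Definition evolution u := forall s t, 0 <= s -> s <= t ->
  let r := (t - s) * (expR (L * (t - s)) * speed u s) in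
  [/\ D (u t), speed u t <= expR (L * (t - s)) * speed u s,
      `|u t - u s| <= r &
      forall p, D p -> `|u t - p| ^+ 2 - `|u s - p| ^+ 2 <=
        2 * (t - s) * (inner (F (u s) - A p) (u s - p) +
           L * r * (r + `|u s - p|) + `|F (u s) - A p| * r)].

Lemma flow0 x : flow D A F x 0 = x.
Proof.
apply/cvg_lim => //; apply: cvg_near_cst; apply: nearW => n.
by rewrite /dyadic_index mul0r truncn0.
Qed.

Lemma flow_in x t : D x -> 0 <= t -> D (flow D A F x t).
Proof.
move=> Dx t0.
by have [] := iter_step_limit Am L0 FL Dx dyadic_step_gt0 (@cvg_dyadic_step R)
  (cvg_dyadic_index t0) (cvg_flow Am L0 FL Dx t0).
Qed.

(** Restarting the scheme from the limit at time [s]: the steps are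
    Lipschitz, so the error committed at time [s] is only amplified boundedly. *)
Lemma flow_evolution x : D x -> evolution (flow D A F x).
Proof.
move=> Dx s t s0 st r; have t0 := le_trans s0 st.
set y := flow D A F x s.
have Dy : D y by exact: flow_in.
pose j n := (dyadic_index n t - dyadic_index n s)%N.
have jt : @dyadic_step R n * (j n)%:R @[n --> \oo] --> t - s.
  rewrite (_ : (fun n => _) = (fun n => @dyadic_step R n * (dyadic_index n t)%:R -
                                        @dyadic_step R n * (dyadic_index n s)%:R)); last first.
    by apply/funext => n; rewrite /j natrB ?dyadic_index_mono// mulrBr.
  by apply: cvgB; exact: cvg_dyadic_index.
apply: (iter_step_limit Am L0 FL Dy dyadic_step_gt0 (@cvg_dyadic_step R) jt).
have xt := cvg_flow Am L0 FL Dx t0; have xs := cvg_flow Am L0 FL Dx s0.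
rewrite (_ : (fun n => _) = (fun n =>
   iter (dyadic_index n t) (S (@dyadic_step R n)) x -
   (iter (j n) (S (@dyadic_step R n)) (iter (dyadic_index n s) (S (@dyadic_step R n)) x)
    - iter (j n) (S (@dyadic_step R n)) y))); last first.
  by apply/funext => n; rewrite -iterD /j subnK ?dyadic_index_mono// opprB addrC subrK.
rewrite -[X in _ --> X]subr0; apply: cvgB => //.
apply: norm_cvg0; apply: (@squeeze_cvgr _ _ _ _ (fun=> 0)
  (fun n => expR (L * t) * `|iter (dyadic_index n s) (S (@dyadic_step R n)) x - y|)).
- apply: nearW => n; rewrite normr_ge0 /=.
  apply: le_trans (iter_step_dist Am L0 FL _ _ _ (dyadic_step_gt0 n)) _.
  rewrite ler_wpM2r//; apply: pow_le_expR => //; first exact/ltW/dyadic_step_gt0.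
  apply: le_trans (dyadic_index_le n t0).
  by rewrite ler_pM2l ?dyadic_step_gt0// ler_nat leq_subr.
- exact: cvg_cst.
- rewrite -(mulr0 (expR (L * t))); apply: cvgM; first exact: cvg_cst.
  rewrite -(@normr0 _ X) -(subrr y); apply: cvg_norm; apply: cvgB => //; exact: cvg_cst.
Qed.

(** Apply the energy inequality with [p] the resolvent of step [m] of
    [A - F (u t0)] at [u t0], so that [u t0 - p = m *: w]: dividing by
    [m * (s2 - s1)] bounds [<(u s2 - u s1) / (s2 - s1), w>] by [- |w|^2] up to a
    term proportional to [s2 - s1], while the quotient has norm at most [G]. *)
Lemma difference_quotient_bound u s1 s2 t0 m G
    (w := yosida D (fun x => A x - F (u t0)) m (u t0))
    (C := L * G * (G + m * `|w|) + `|w| * G + L * G * (2 * G + m * `|w|)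
          + (L * G + `|w|) * G + G ^+ 2) :
  evolution u -> 0 <= s1 -> s1 < s2 -> s2 - s1 <= 1 -> t0 = s1 \/ t0 = s2 ->
  expR (L * (s2 - s1)) * speed u s1 <= G -> 0 < m ->
  `|(s2 - s1)^-1 *: (u s2 - u s1) + w| ^+ 2
     <= G ^+ 2 - `|w| ^+ 2 + 2 * (s2 - s1) * C / m.
Proof.
move=> uE s10 s12 s1s2 t0s uG m0.
have [_ _ + /(_ (resolvent D (fun x => A x - F (u t0)) m (u t0)))] := uE s1 s2 s10 (ltW s12).
set p := resolvent _ _ _ _; set V := expR _ * _ in uG *; set y := u s1; set x := u t0.
set T := s2 - s1 in uG s1s2 *; set Dt := u s2 - y.
have T0 : 0 < T by rewrite subr_gt0.
have V0 : 0 <= V by rewrite mulr_ge0// expR_ge0.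
have G0 := le_trans V0 uG.
move=> hD; have Am' := m_monotone_shift (F x) Am.
have [Dp _] := resolventP Am' x m0; move=> /(_ Dp).
have xp : x - p = m *: w by exact: resolvent_yosida.
have Ap : A p = F x + w by rewrite -[w](yosidaE Am' _ m0) addrC subrK.
have rG : T * V <= T * G by rewrite ler_pM2l.
have r0 : 0 <= T * V by rewrite mulr_ge0// ltW.
have DtG : `|Dt| <= T * G by exact: le_trans rG.
have yx : `|y - x| <= T * G.
  case: t0s => e; rewrite /x /y e; first by rewrite subrr normr0 mulr_ge0// ltW.
  by rewrite distrC.
have yp : y - p = (y - x) + m *: w by rewrite -xp subrKA.
have TG : T * G <= G by rewrite ler_piMl.
have TG0 : 0 <= T * G by rewrite mulr_ge0// ltW.
have ypn : `|y - p| <= G + m * `|w|.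
  rewrite yp (le_trans (ler_normD _ _))// normrZ gtr0_norm// lerD2r.
  exact: le_trans yx TG.
have Fyx : `|F y - F x| <= L * (T * G) by rewrite (le_trans (FL _ _))// ler_wpM2l.
have FyAp : F y - A p = (F y - F x) - w by rewrite Ap opprD addrA.
have FyApn : `|F y - A p| <= L * G + `|w|.
  rewrite FyAp (le_trans (ler_normB _ _))// lerD2r (le_trans Fyx)// ler_wpM2l//.
have i1 : inner (F y - A p) (y - p) <= T * (L * G * (G + m * `|w|) + `|w| * G) - m * `|w| ^+ 2.
  have -> : inner (F y - A p) (y - p) = inner (F y - F x) (y - p) - inner w (y - x) - m * `|w| ^+ 2.
    have -> : inner (F y - A p) (y - p) = inner (F y - F x) (y - p) - inner w (y - p).
      by rewrite FyAp innerBl.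
    have -> : inner w (y - p) = inner w (y - x) + m * `|w| ^+ 2.
      by rewrite yp innerDr innerZr inner_normE.
    by rewrite opprD addrA.
  rewrite lerD2r.
  have := normr_inner_le w (y - x); rewrite ler_norml => /andP[b _].
  have b1 := le_trans (inner_le (F y - F x) (y - p)) (ler_pM (normr_ge0 _) (normr_ge0 _) Fyx ypn).
  have b2 : `|w| * `|y - x| <= `|w| * (T * G) by rewrite ler_wpM2l.
  lra.
have i2 : L * (T * V) * (T * V + `|y - p|) <= T * (L * G * (2 * G + m * `|w|)).
  have -> : T * (L * G * (2 * G + m * `|w|)) = L * (T * G) * (G + (G + m * `|w|)) by ring.
  apply: ler_pM; [by rewrite mulr_ge0|by rewrite addr_ge0|by rewrite ler_wpM2l|].
  by rewrite lerD// (le_trans rG).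
have i3 : `|F y - A p| * (T * V) <= T * ((L * G + `|w|) * G).
  have -> : T * ((L * G + `|w|) * G) = (L * G + `|w|) * (T * G) by ring.
  by rewrite ler_pM.
have i4 : inner Dt (y - x) >= - (T * (T * G ^+ 2)).
  have := normr_inner_le Dt (y - x); rewrite ler_norml => /andP[b _].
  have b1 := ler_pM (normr_ge0 _) (normr_ge0 _) DtG yx.
  apply: le_trans b; rewrite lerN2 (le_trans b1)// le_eqVlt; apply/orP; left.
  by apply/eqP; ring.
have -> : u s2 - p = Dt + (y - p) by rewrite /Dt subrKA.
rewrite normsqD [in inner Dt _]yp innerDr innerZr => en.
have hB : 2 * T * (inner (F y - A p) (y - p) + L * (T * V) * (T * V + `|y - p|) +
    `|F y - A p| * (T * V)) <= 2 * T * (T * (C - G ^+ 2) - m * `|w| ^+ 2).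
  rewrite ler_pM2l ?mulr_gt0//; apply: le_trans (lerD (lerD i1 i2) i3) _.
  by rewrite le_eqVlt; apply/orP; left; apply/eqP; rewrite /C; ring.
have en2 : m * inner Dt w <= m * (T * (T * C / m - `|w| ^+ 2)).
  have -> : m * (T * (T * C / m - `|w| ^+ 2)) = T * (T * C - m * `|w| ^+ 2).
    by field; rewrite gt_eqF.
  have := le_trans en hB; have := sqr_ge0 `|Dt|; move: i4; clear.
  by set a := inner _ _; set b := inner _ _; set c := `|Dt| ^+ 2; lra.
have en3 : T^-1 * inner Dt w <= T * C / m - `|w| ^+ 2.
  by rewrite mulrC ler_pdivrMr// mulrC -(ler_pM2l m0).
have en4 : `|T^-1 *: Dt| ^+ 2 <= G ^+ 2.
  rewrite ler_pXn2r ?nnegrE// normrZ gtr0_norm ?invr_gt0// mulrC ler_pdivrMr//.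
  by rewrite mulrC.
rewrite normsqD innerZl.
by move: en3 en4; set a := T^-1 * _; set b := `|_ *: _| ^+ 2; lra.
Qed.

(** At a time where the speed is upper semicontinuous the difference quotient
    has asymptotically norm at most that of [v = A x - F x], and its scalar
    product with the nearby Yosida values of [v] is asymptotically [- |v|^2];
    hence it converges to [- v]. *)
Lemma evolution_is_derive u t0 : evolution u -> 0 < t0 ->
  (forall e, 0 < e -> \forall s \near t0, speed u s <= speed u t0 + e) ->
  is_derive t0 1 u (F (u t0) - A (u t0)).
Proof.
move=> uE t00 usc.
set v := A (u t0) - F (u t0).
have Am' := m_monotone_shift (F (u t0)) Am.
have [Dx _ _ _] := uE t0 t0 (ltW t00) (lexx _).
suff lim : h^-1 *: (u (h *: 1 + t0) - u t0) @[h --> 0^'] --> F (u t0) - A (u t0).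
  by apply: DeriveDef; [apply/cvg_ex; exists (F (u t0) - A (u t0))|exact/cvg_lim].
apply/cvgrPdist_lt => e e0.
pose V := `|v|.
have V0 : 0 <= V by exact: normr_ge0.
have V1 : 0 < 8 * (4 * V + 1) by lra.
(* with [d] as error in both the speed and the Yosida value, the bound on
   [|Q + w|^2] is at most [d * (4 * V + 1)] plus the vanishing term *)
pose d := Num.min 1 (Num.min (e / 2) (e ^+ 2 / (8 * (4 * V + 1)))).
have d0 : 0 < d by rewrite !lt_min ltr01 !divr_gt0// exprn_gt0.
have d1 : d <= 1 by rewrite ge_min lexx.
have d2 : d <= e / 2 by rewrite !ge_min lexx orbT.
have d3 : d * (8 * (4 * V + 1)) <= e ^+ 2 by rewrite -ler_pdivlMr// !ge_min lexx !orbT.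
have [] := @bounded_yosida _ _ _ _ Am' (u t0) V.
  by move=> l l0; exact: (yosida_le Am').
move=> _ _ /(_ d d0)[m m0]; rewrite -/v; set w := yosida _ _ _ _ => vw.
have wV : `|w| <= V by exact: (yosida_le Am').
have wV2 : V - d <= `|w|.
  by rewrite lerBlDr -lerBlDl (le_trans (lerB_dist _ _))// ltW.
pose G := V + d.
pose C := L * G * (G + m * `|w|) + `|w| * G + L * G * (2 * G + m * `|w|)
          + (L * G + `|w|) * G + G ^+ 2.
have C0 : 0 <= C.
  have G0 : 0 <= G by rewrite addr_ge0// ltW.
  by rewrite /C !addr_ge0 ?sqr_ge0// !mulr_ge0// ?addr_ge0// ?mulr_ge0// ltW.
have nh : (fun h : R => `|h|) h @[h --> (0 : R)^'] --> (0 : R).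
  rewrite -[X in _ --> X](@normr0 _ R); apply: cvg_norm; exact: cvg_within.
have near1 : \forall h \near (0 : R)^', speed u (h + t0) <= V + d / 2.
  have : h + t0 @[h --> (0 : R)^'] --> t0.
    rewrite -[X in _ --> X](add0r t0); apply: cvgD; last exact: cvg_cst.
    exact: cvg_within.
  by move=> /(_ _ (usc (d / 2) _)); apply; rewrite divr_gt0.
have near2 : \forall h \near (0 : R)^', expR (L * `|h|) * (V + d / 2) <= V + d.
  suff : expR (L * `|h|) * (V + d / 2) @[h --> (0 : R)^'] --> V + d / 2.
    by move=> /cvgr_le; apply; lra.
  rewrite -[X in _ --> X]mul1r; apply: cvgM; last exact: cvg_cst.
  rewrite -[X in _ --> X](@expR0 R); apply: continuous_cvg; first exact: continuous_expR.
  rewrite -[X in _ --> X](mulr0 L); exact: (cvgM (@cvg_cst _ L _ _ _) nh).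
have near3 : \forall h \near (0 : R)^', 2 * `|h| * C / m <= e ^+ 2 / 8.
  suff : 2 * `|h| * C / m @[h --> (0 : R)^'] --> (0 : R).
    by move=> /cvgr_le; apply; rewrite divr_gt0// exprn_gt0.
  rewrite -[X in _ --> X](mul0r m^-1); apply: cvgM; last exact: cvg_cst.
  rewrite -[X in _ --> X](mul0r C); apply: cvgM; last exact: cvg_cst.
  by have := cvgM (@cvg_cst _ (2 : R) _ _ _) nh; rewrite mulr0; apply.
have near4 : \forall h \near (0 : R)^', `|h| <= 1.
  by move/cvgr_le : nh; exact.
have near5 : \forall h \near (0 : R)^', `|h| <= t0.
  by move/cvgr_le : nh; exact.
near=> h.
have h0 : h != 0 by near: h; exact: nbhs_dnbhs_neq.
have hs : speed u (h + t0) <= V + d / 2 by near: h.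
have hE : expR (L * `|h|) * (V + d / 2) <= V + d by near: h.
have hC : 2 * `|h| * C / m <= e ^+ 2 / 8 by near: h.
have h1 : `|h| <= 1 by near: h.
have ht : `|h| <= t0 by near: h.
rewrite [h *: 1]mulr1; set Q := h^-1 *: _.
have Qw : `|Q + w| ^+ 2 <= G ^+ 2 - `|w| ^+ 2 + 2 * `|h| * C / m.
  have [hn|hp] := ltP h 0.
    have hnE : t0 - (h + t0) = `|h| by rewrite ltr0_norm// opprD addrCA subrr addr0.
    have -> : Q = (t0 - (h + t0))^-1 *: (u t0 - u (h + t0)).
      by rewrite hnE ltr0_norm// invrN scaleNr -scalerN opprB.
    rewrite -hnE; apply: difference_quotient_bound => //.
    - by rewrite -[0](addNr t0) lerD2r lerNl -(ltr0_norm hn).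
    - by rewrite -subr_gt0 hnE normr_gt0.
    - by rewrite hnE.
    - by right.
    - by rewrite hnE; apply: le_trans hE; rewrite ler_wpM2l ?expR_ge0.
  have {}hp : 0 < h by rewrite lt_neqAle eq_sym h0.
  have hpE : (h + t0) - t0 = `|h| by rewrite gtr0_norm// addrK.
  have -> : Q = (h + t0 - t0)^-1 *: (u (h + t0) - u t0) by rewrite addrK.
  rewrite -hpE; apply: difference_quotient_bound => //.
  - exact: ltW.
  - by rewrite ltrDr.
  - by rewrite hpE.
  - by left.
  - rewrite hpE; apply: le_trans hE; by rewrite ler_wpM2l ?expR_ge0// lerDl divr_ge0// (ltW d0).
have Qe : `|Q + w| <= e / 2.
  rewrite -(@ler_pXn2r _ 2)// ?nnegrE ?divr_ge0// ?(ltW e0)//.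
  apply: le_trans Qw _; rewrite /G.
  have := normr_ge0 w; move: wV wV2; set a := `|w| => wV wV2 a0.
  have va : V ^+ 2 - a ^+ 2 <= d * (2 * V).
    by rewrite subr_sqr ler_pM ?subr_ge0 ?addr_ge0//; lra.
  have dd : d ^+ 2 <= d by rewrite expr2 ler_piMl// ltW.
  rewrite sqrrD; lra.
rewrite -[F (u t0) - _]opprB -/v -opprD normrN.
have -> : v + Q = (v - w) + (Q + w) by rewrite [RHS]addrACA addNr addr0.
rewrite (le_lt_trans (ler_normD _ _))// (splitr e) ltr_leD// (lt_le_trans vw)//.
Unshelve. all: by end_near. Qed.

End evolution.

(** * Absolutely continuous functions *)

Section almost_everywhere_real.
Context {R : realType}.
Implicit Types P Q S : R -> Prop.

Lemma ae_impl P Q : (forall t, P t -> Q t) ->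
  {ae (@lebesgue_measure R), forall t, P t} ->
  {ae (@lebesgue_measure R), forall t, Q t}.
Proof. by move=> PQ; apply: negligibleS => t nQ /PQ. Qed.

Lemma ae_impl2 P Q S : (forall t, P t -> Q t -> S t) ->
  {ae (@lebesgue_measure R), forall t, P t} ->
  {ae (@lebesgue_measure R), forall t, Q t} ->
  {ae (@lebesgue_measure R), forall t, S t}.
Proof.
move=> PQS aP aQ; have := negligibleU aP aQ; apply: negligibleS => t nS.
have [Pt|] := pselect (P t); last by left.
by right => Qt; exact: nS (PQS t Pt Qt).
Qed.

End almost_everywhere_real.

Section absolute_continuity.
Context {R : realType}.

(** The common reason why sums, products and Lipschitz images of absolutely
    continuous functions are absolutely continuous. *)
Lemma absolutely_continuous_dominated (V W W' : normedModType R) (a b c : R)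
    (f : R -> V) (g : R -> W) (h : R -> W') : 0 <= c ->
  absolutely_continuous a b f -> absolutely_continuous a b g ->
  (forall s t, a <= s -> s <= t -> t <= b ->
     `|h t - h s| <= c * (`|t - s| + `|f t - f s| + `|g t - g s|)) ->
  absolutely_continuous a b h.
Proof.
move=> c0 acf acg hfg e e0; pose e' := e / (3 * (c + 1)).
have c1 : 0 < c + 1 by rewrite ltr_wpDl.
have e'0 : 0 < e' by rewrite divr_gt0// mulr_gt0.
have [d1 d10 H1] := acf e' e'0; have [d2 d20 H2] := acg e' e'0.
exists (Num.min e' (Num.min d1 d2)); first by rewrite !lt_min e'0 d10.
move=> n s t st tr; rewrite !lt_min => /and3P[k0 k1 k2].
apply: (@le_lt_trans _ _ (c * (\sum_(i < n) (t i - s i) + \sum_(i < n) `|f (t i) - f (s i)|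
   + \sum_(i < n) `|g (t i) - g (s i)|))).
  rewrite -!big_split/= mulr_sumr; apply: ler_sum => i _.
  have [ai [si ti]] := st i.
  by rewrite -[X in X + _ + _]ger0_norm ?subr_ge0// hfg.
have := H1 _ _ _ st tr k1; have := H2 _ _ _ st tr k2; move: k0.
have -> : e = (c + 1) * (3 * e') by rewrite /e'; field; rewrite gt_eqF.
set x := \sum_(i < n) (t i - s i); set y := \sum_(i < n) _; set z := \sum_(i < n) _ => xe ye ze.
have x0 : 0 <= x by apply: sumr_ge0 => i _; rewrite subr_ge0; exact: (st i).2.1.
have y0 : 0 <= y by apply: sumr_ge0.
have z0 : 0 <= z by apply: sumr_ge0.
apply: (@le_lt_trans _ _ ((c + 1) * (x + z + y))); last by rewrite ltr_pM2l//; lra.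
by rewrite ler_wpM2r// ?addr_ge0// lerDl.
Qed.

Lemma absolutely_continuous_cst (V : normedModType R) (a b : R) (v : V) :
  absolutely_continuous a b (fun=> v).
Proof.
move=> e e0; exists 1 => // n s t _ _ _.
by rewrite big1// => i _; rewrite subrr normr0.
Qed.

Lemma absolutely_continuous_lipschitz (V : normedModType R) (a b c : R)
  (f : R -> V) : 0 <= c ->
  (forall s t, a <= s -> s <= t -> t <= b -> `|f t - f s| <= c * `|t - s|) ->
  absolutely_continuous a b f.
Proof.
move=> c0 fl; have ac0 := @absolutely_continuous_cst R a b 0.
apply: (absolutely_continuous_dominated c0 ac0 ac0) => s t sa st tb.
by rewrite subrr normr0 !addr0 fl.
Qed.

Lemma absolutely_continuous_within (V : normedModType R) (a b : R)
  (f : R -> V) : absolutely_continuous a b f ->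
  {within `[a, b], continuous f}.
Proof.
move=> acf; apply/subspace_continuousP => x /=; rewrite in_itv/= => /andP[ax xb].
apply/cvgrPdist_lt => e e0; have [d d0 fd] := acf e e0.
have key s t : a <= s -> s <= t -> t <= b -> t - s < d -> `|f t - f s| < e.
  move=> sa st tb sd; have := fd 1%N (fun=> s) (fun=> t) (fun=> conj sa (conj st tb)).
  rewrite !big_ord1; apply => //; by move=> i j _ _ _; rewrite (ord1 i) (ord1 j).
rewrite near_withinE; near=> y => /=; rewrite in_itv/= => /andP[ay yb].
have xy : `|x - y| < d by near: y; apply: nbhsx_ballx.
have [xley|ylex] := leP x y.
  by rewrite distrC key//; apply: le_lt_trans xy; rewrite distrC; exact: ler_norm.
by rewrite key//; [exact: ltW|apply: le_lt_trans xy; exact: ler_norm].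
Unshelve. all: by end_near. Qed.

Lemma within_continuous_bounded (V : normedModType R) (a b : R) (f : R -> V) :
  {within `[a, b], continuous f} ->
  exists2 c : R, 0 <= c & forall t, a <= t -> t <= b -> `|f t| <= c.
Proof.
move=> fc; have := continuous_compact fc (@segment_compact _ a b).
move=> /compact_bounded[c [_ hc]]; exists (`|c| + 1) => [|t at_ tb].
  by rewrite addr_ge0.
apply: hc; first by rewrite (le_lt_trans (ler_norm c))// ltrDl.
by exists t => //=; rewrite in_itv/= at_.
Qed.

(** Cover the exceptional null set and the endpoints by an open set of small
    measure.  Moving right from [a], either [f] grows at rate at most [e], or
    the move stays inside the cover; moves of the second kind contribute little
    in total, by absolute continuity. *)
Lemma absolutely_continuous_nonincreasing (a b : R) (f : R -> R) : a <= b ->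
  absolutely_continuous a b f ->
  {ae (@lebesgue_measure R), forall t : R, t \in `]a, b[ ->
     exists2 l, is_derive t 1 f l & l <= 0} ->
  f b <= f a.
Proof.
move=> ab acf [N [mN N0 fN]].
apply/ler_addgt0Pr => e' e'0; pose e := e' / (b - a + 1).
have ba1 : 0 < b - a + 1 by rewrite ltr_wpDl// subr_ge0.
have e0 : 0 < e by rewrite divr_gt0.
have [d d0 fd] := acf e e0.
pose D := N `|` [set a] `|` [set b].
have D0 : lebesgue_measure D = 0.
  apply: measure_negligible; first by apply: measurableU => //; exact: measurableU.
  apply: negligibleU; first apply: negligibleU.
  - exact/negligibleP.
  - by apply/negligibleP => //; exact: lebesgue_measure_set1.
  - by apply/negligibleP => //; exact: lebesgue_measure_set1.
have mD : measurable D by apply: measurableU => //; exact: measurableU.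
have Doo : (@lebesgue_measure R D < +oo)%E by rewrite D0.
have [U [oU DU Ud]] := lebesgue_regularity_outer mD Doo d0.
have mU : measurable U by exact: open_measurable.
have Ud' : (lebesgue_measure U < d%:E)%E.
  rewrite [X in (X < _)%E](measureDI (@lebesgue_measure R) mU mD) (setIidr DU).
  by rewrite [X in (_ + X)%E]D0 adde0.
(* [P x]: the second-kind moves needed to reach [x] form a finite disjoint
   family of intervals inside [U] *)
pose P x := exists (n : nat) (s t : 'I_n -> R), [/\
  forall i, [/\ a <= s i, s i <= t i & t i <= x],
  trivIset [set: 'I_n] (fun i => `]s i, t i[%classic),
  forall i, `]s i, t i[%classic `<=` U &
  f x - f a <= e * (x - a) + \sum_(i < n) `|f (t i) - f (s i)|].
have PE x : x <= b -> P x -> f x - f a <= e * (x - a) + e.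
  move=> xb [n [s [t [st tr sU fx]]]].
  apply: le_trans fx _; rewrite lerD2l ltW//; apply: fd => //.
    by move=> i; have [? ? tx] := st i; split => //; split => //; exact: le_trans xb.
  rewrite -lte_fin; apply: le_lt_trans Ud'; rewrite -sumEFin.
  have -> : (\sum_(i < n) (t i - s i)%:E =
      lebesgue_measure (\big[setU/set0]_(i < n) `]s i, t i[%classic))%E.
    rewrite measure_semi_additive_ord//; last by apply: bigsetU_measurable.
    apply: eq_bigr => i _; apply/esym.
    apply: (etrans (@lebesgue_measure_itv R `]s i, t i[)) => /=; rewrite lte_fin.
    have [_ + _] := st i; rewrite le_eqVlt => /predU1P[->|-> //].
    by rewrite subrr ltxx.
  apply: le_measure; rewrite ?inE//; first exact: bigsetU_measurable.
  apply: (big_ind (fun A : set R => A `<=` U)) => [//|A A' AU AU'|i _]; last exact: sU.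
  by move=> z [/AU|/AU'].
have Pa : P a.
  exists 0%N, (fun=> a), (fun=> a); split; [by case|by move=> [] | by case|].
  by rewrite big_ord0 !subrr mulr0 addr0.
have Pgood x y : x <= y -> f y - f x <= e * (y - x) -> P x -> P y.
  move=> xy fxy [n [s [t [st tr sU fx]]]]; exists n, s, t; split => //.
    by move=> i; have [? ? ?] := st i; split => //; exact: le_trans xy.
  lra.
have Pbad x y : a <= x -> x <= y -> `]x, y[%classic `<=` U -> P x -> P y.
  move=> ax xy xyU [n [s [t [st tr sU fx]]]].
  pose s' (i : 'I_n.+1) := if unlift ord_max i is Some j then s j else x.
  pose t' (i : 'I_n.+1) := if unlift ord_max i is Some j then t j else y.
  exists n.+1, s', t'; split.
  - move=> i; rewrite /s' /t'; case: unliftP => [j _|_] //.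
    by have [? ? ?] := st j; split => //; exact: le_trans xy.
  - move=> i j _ _; rewrite /s' /t'.
    case: unliftP => [i' ->|->]; case: unliftP => [j' ->|->] //.
    + by move=> ij; rewrite (tr i' j').
    + move=> [z []] /=; rewrite !in_itv/= => /andP[_ zt] /andP[xz _].
      by have [_ _ tx] := st i'; have := lt_trans xz (lt_le_trans zt tx); rewrite ltxx.
    + move=> [z []] /=; rewrite !in_itv/= => /andP[xz _] /andP[_ zt].
      by have [_ _ tx] := st j'; have := lt_trans xz (lt_le_trans zt tx); rewrite ltxx.
  - by move=> i; rewrite /s' /t'; case: unliftP.
  - rewrite big_ord_recr /=.
    rewrite (eq_bigr (fun i => `|f (t i) - f (s i)|)); last first.
      move=> i _; have -> : widen_ord (leqnSn n) i = lift ord_max i.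
        by apply: val_inj; rewrite /= /bump leqNgt ltn_ord.
      by rewrite /s' /t' liftK.
    rewrite /s' /t' unlift_none.
    have : f y - f x <= `|f y - f x| by exact: ler_norm.
    have : 0 <= e * (y - x) by rewrite mulr_ge0 ?subr_ge0// ltW.
    lra.
have step c : a <= c -> c <= b -> exists2 r, 0 < r & forall x y, a <= x -> y <= b ->
    c - r < x -> x <= c -> c <= y -> y < c + r -> P x -> P y.
  move=> ac cb; have [Dc|nDc] := pselect (D c).
    have /nbhs_ballP[r r0 rU] : nbhs c U by apply: open_nbhs_nbhs; split => //; exact: DU.
    exists r => // x y ax yb cx xc cy yc; apply: Pbad => //; first exact: le_trans cy.
    move=> z /=; rewrite in_itv/= => /andP[xz zy]; apply: rU.
    by rewrite -ball_normE /ball_ /= ltr_distlC; apply/andP; split; lra.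
  have cab : c \in `]a, b[.
    rewrite in_itv/= !lt_neqAle ac cb !andbT; apply/andP; split; apply/eqP => ca; apply: nDc.
      by left; right.
    by right.
  have [l [dfl <-] l0] : exists2 l, is_derive c 1 f l & l <= 0.
    apply: contrapT => nl; apply: nDc; left; left; apply: fN => /= H; exact/nl/H.
  have := dfl; rewrite /derivable => /cvg_ex[l' fl'].
  have l'E : 'D_1 f c = l' by exact/cvg_lim.
  rewrite l'E in l0.
  move/cvgrPdist_lt : fl' => /(_ e e0); rewrite near_withinE => /nbhs_ballP[r r0 rfl].
  have key h : h != 0 -> `|h| < r -> h^-1 * (f (h + c) - f c) < e.
    move=> h0 hr; have := rfl h; rewrite -ball_normE /ball_ /= sub0r normrN => /(_ hr h0).
    rewrite [h *: 1]mulr1 ltr_distlC => /andP[_]; rewrite /GRing.scale /=; lra.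
  exists r => // x y ax yb cx xc cy yc; apply: Pgood; first exact: le_trans cy.
  have e1 : f y - f c <= e * (y - c).
    move: cy; rewrite le_eqVlt => /predU1P[->|cy]; first by rewrite !subrr mulr0.
    have := key (y - c); rewrite subrK subr_eq0 gt_eqF// => /(_ isT).
    rewrite gtr0_norm ?subr_gt0// ltrBlDl => /(_ yc).
    by rewrite mulrC ltr_pdivrMr ?subr_gt0// => /ltW.
  have e2 : f c - f x <= e * (c - x).
    move: xc; rewrite le_eqVlt => /predU1P[->|xc]; first by rewrite !subrr mulr0.
    have := key (x - c); rewrite subrK subr_eq0 lt_eqF// => /(_ isT).
    rewrite ltr0_norm ?subr_lt0// opprB ltrBlDr -ltrBlDl => /(_ _).
    rewrite -mulrNN -invrN !opprB mulrC ltr_pdivrMr ?subr_gt0//.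
    by move=> H; apply/ltW/H; lra.
  lra.
pose S := [set x | a <= x /\ x <= b /\ P x].
have supS : has_sup S by split; [exists a|exists b => x [_ []]].
pose c := sup S.
have ac : a <= c by apply: sup_upper_bound.
have cb : c <= b by apply: sup_le_ub; [exists a|move=> x [_ []]].
have [r r0 rP] := step c ac cb.
have [x [ax [xb Px]] cx] := @sup_adherent _ _ _ r0 supS.
have xc : x <= c by apply: sup_upper_bound.
pose y := Num.min b (c + r / 2).
have cy : c <= y by rewrite le_min cb lerDl divr_ge0// ltW.
have yb : y <= b by rewrite ge_min lexx.
have yr : y < c + r by rewrite gt_min; apply/orP; right; rewrite ltrD2l; lra.
have Py : P y by exact: (rP x y).
have yc : y <= c by apply: sup_upper_bound => //; split; [exact: le_trans cy|].
have yE : y = b.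
  by move: yc; rewrite /y; case: (leP b (c + r / 2)) => // _; rewrite gerDl; lra.
have := PE _ (lexx b); rewrite -{1}yE => /(_ Py).
have -> : e * (b - a) + e = e'.
  by rewrite /e; field; rewrite gt_eqF.
lra.
Qed.

End absolute_continuity.

(** * Gronwall estimates and strong trajectories *)

Section gronwall.
Context {R : realType}.

Lemma expR_sub_le (x y m : R) : x <= m -> y <= m ->
  `|expR x - expR y| <= expR m * `|x - y|.
Proof.
move=> xm ym; wlog yx : x y xm ym / y <= x.
  move=> H; have [yx|/ltW xy] := leP y x; first exact: H.
  by rewrite distrC (distrC x); exact: H.
rewrite !ger0_norm ?subr_ge0 ?ler_expR//.
apply: (@le_trans _ _ (expR x * (x - y))); last first.
  by rewrite ler_wpM2r ?subr_ge0// ler_expR.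
have := expR_ge1Dx (y - x); rewrite expRD => h.
have := ler_wpM2l (expR_ge0 x) h; rewrite expRN mulrCA mulfV ?gt_eqF ?expR_gt0// mulr1.
lra.
Qed.

(** [expR (- K * t) * f t] is nonincreasing. *)
Lemma absolutely_continuous_gronwall (a b K : R) (f : R -> R) : a <= b ->
  absolutely_continuous a b f ->
  {ae (@lebesgue_measure R), forall t : R, t \in `]a, b[ ->
     exists2 l, is_derive t 1 f l & l <= K * f t} ->
  f b <= expR (K * (b - a)) * f a.
Proof.
move=> ab acf fK; pose E t := expR (- K * t).
have [c c0 fc] := within_continuous_bounded (absolutely_continuous_within acf).
pose m := `|K| * (`|a| + `|b|).
have Em t : a <= t -> t <= b -> - K * t <= m.
  move=> at_ tb; rewrite (le_trans (ler_norm _))// normrM normrN ler_wpM2l//.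
  have := ler_norm a; have := ler_norm b; have := ler_norm (- a); have := ler_norm (- b).
  have := normr_ge0 a; have := normr_ge0 b.
  by rewrite !normrN; case: (ger0P t); lra.
have acE : absolutely_continuous a b (fun t => E t * f t).
  apply: (@absolutely_continuous_dominated _ _ _ _ a b (expR m + c * (expR m * `|K|)) f f) => //.
    by rewrite addr_ge0 ?mulr_ge0 ?expR_ge0.
  move=> s t as_ st tb; have sb := le_trans st tb; have at_ := le_trans as_ st.
  have -> : E t * f t - E s * f s = E t * (f t - f s) + f s * (E t - E s) by ring.
  rewrite (le_trans (ler_normD _ _))// !normrM.
  have h1 : `|E t| * `|f t - f s| <= expR m * `|f t - f s|.
    by rewrite ler_wpM2r// ger0_norm ?expR_ge0// ler_expR Em.
  have h2 : `|f s| * `|E t - E s| <= c * (expR m * `|K| * `|t - s|).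
    rewrite ler_pM ?fc// (le_trans (expR_sub_le (Em t at_ tb) (Em s as_ sb)))//.
    by rewrite -mulrBr normrM normrN mulrA.
  have p1 := expR_ge0 m.
  have := mulr_ge0 p1 (normr_ge0 (t - s)); have := mulr_ge0 p1 (normr_ge0 (f t - f s)).
  have p2 : 0 <= c * (expR m * `|K|) by rewrite !mulr_ge0.
  have := mulr_ge0 p2 (normr_ge0 (f t - f s)).
  lra.
have : E b * f b <= E a * f a.
  apply: (absolutely_continuous_nonincreasing ab acE).
  apply: ae_impl fK => t ft tab; have [l fl lK] := ft tab.
  exists (E t * l + (- K * E t) * f t); last first.
    have := ler_wpM2l (expR_ge0 (- K * t)) lK; rewrite -/(E t); lra.
  have dE : is_derive t 1 E (- K * E t).
    have dl : is_derive t 1 (fun s : R => - K * s) (- K).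
      have := is_deriveZ (- K) (is_derive_id t (1 : R)).
      by rewrite [X in is_derive _ _ _ X](_ : _ = - K); [exact|exact: mulr1].
    rewrite mulrC; exact: (is_derive1_comp (is_derive_expR (- K * t)) dl).
  have := is_deriveM dE fl.
  rewrite [X in is_derive _ _ _ X](_ : _ = E t * l + - K * E t * f t); first exact.
  by rewrite /GRing.scale /=; ring.
rewrite /E => h; have := ler_wpM2l (expR_ge0 (K * b)) h.
rewrite !mulrA -!expRD mulNr addrN expR0 mul1r.
by rewrite (_ : K * b + - K * a = K * (b - a)) //; ring.
Qed.

Lemma is_derive_normsq (X : hilbertType R) (u : R -> X) (t : R) (du : X) :
  is_derive t 1 u du ->
  is_derive t 1 (fun s => `|u s| ^+ 2 : R) (2 * inner du (u t)).
Proof.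
move=> [ud <-].
have uc : {for t, continuous u} by apply/differentiable_continuous/derivable1_diffP.
suff lim : h^-1 *: (`|u (h *: 1 + t)| ^+ 2 - `|u t| ^+ 2) @[h --> 0^']
    --> (2 * inner ('D_1 u t) (u t) : R).
  by apply: DeriveDef; [apply/cvg_ex; exists (2 * inner ('D_1 u t) (u t))|exact/cvg_lim].
rewrite (_ : (fun h => _) = (fun h : R =>
  inner (h^-1 *: (u (h *: 1 + t) - u t)) (u (h *: 1 + t) + u t))); last first.
  apply/funext => h; rewrite innerZl innerBl !innerDr !inner_normE (innerC (u t)).
  by rewrite /GRing.scale /=; ring.
have -> : 2 * inner ('D_1 u t) (u t) = inner ('D_1 u t) (u t + u t) by rewrite innerDr; ring.
apply: cvg_inner; first by have := ud; rewrite /derivable.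
apply: cvgD; last exact: cvg_cst.
have ht : h *: (1 : R) + t @[h --> (0 : R)^'] --> t.
  rewrite -[X in _ --> X](add0r t); apply: cvgD; last exact: cvg_cst.
  under eq_fun do rewrite /GRing.scale /= mulr1.
  exact: cvg_within.
exact: (cvg_comp _ _ ht uc).
Qed.

End gronwall.

Section trajectories.
Context {R : realType} {X : hilbertType R} (D : set X) (A F : X -> X) (L : R).
Hypothesis Am : m_monotone D A.
Hypothesis FL : forall x y, `|F x - F y| <= L * `|x - y|.
Local Notation speed u t := (`|A (u t) - F (u t)|).

Definition strong_trajectory (T : R) (u : R -> X) :=
  [/\ absolutely_continuous 0 T u, (forall t, 0 <= t -> t <= T -> D (u t)) &
   {ae (@lebesgue_measure R), forall t : R, t \in `]0, T[ ->
      is_derive t 1 u (F (u t) - A (u t))}].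

Lemma absolutely_continuousW (V : normedModType R) (a b c : R) (f : R -> V) :
  c <= b -> absolutely_continuous a b f -> absolutely_continuous a c f.
Proof.
move=> cb acf e e0; have [d d0 fd] := acf e e0; exists d => // n s t st.
by apply: fd => i; have [? [? ?]] := st i; split => //; split => //; exact: le_trans cb.
Qed.

Lemma strong_trajectoryW S T u : S <= T -> strong_trajectory T u -> strong_trajectory S u.
Proof.
move=> ST [acu uD ue]; split; first exact: absolutely_continuousW acu.
  by move=> t t0 tS; apply: uD => //; exact: le_trans ST.
apply: ae_impl ue => t ut; rewrite in_itv/= => /andP[t0 tS]; apply: ut.
by rewrite in_itv/= t0 (lt_le_trans tS).
Qed.

Lemma strong_trajectory_stable T u1 u2 t : strong_trajectory T u1 ->
  strong_trajectory T u2 -> 0 <= t -> t <= T ->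
  `|u1 t - u2 t| <= expR (L * t) * `|u1 0 - u2 0|.
Proof.
move=> /strong_trajectoryW + /strong_trajectoryW + t0 tT.
move=> /(_ _ tT)[ac1 D1 e1] /(_ _ tT)[ac2 D2 e2].
pose f s := `|u1 s - u2 s| ^+ 2.
have [c c0 uc1] := within_continuous_bounded (absolutely_continuous_within ac1).
have [c' c'0 uc2] := within_continuous_bounded (absolutely_continuous_within ac2).
have acf : absolutely_continuous 0 t f.
  apply: (absolutely_continuous_dominated (c := 2 * (c + c')) _ ac1 ac2).
    by rewrite mulr_ge0// addr_ge0.
  move=> s r s0 sr rt; rewrite /f subr_sqr normrM mulrC.
  have r0 := le_trans s0 sr; have st := le_trans sr rt.
  apply: ler_pM => //.
    have n1 x : 0 <= x -> x <= t -> `|u1 x - u2 x| <= c + c'.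
      by move=> x0 xt; rewrite (le_trans (ler_normB _ _))// lerD// ?uc1 ?uc2.
    rewrite ger0_norm ?addr_ge0// (_ : 2 * (c + c') = (c + c') + (c + c')); last by ring.
    by rewrite lerD// n1.
  rewrite (le_trans (ler_dist_dist _ _))//.
  rewrite (_ : _ - _ - _ = (u1 r - u1 s) - (u2 r - u2 s)); last first.
    by rewrite !opprB addrACA [X in _ + X]addrC -addrACA.
  by rewrite (le_trans (ler_normB _ _))// -addrA lerDr.
have := absolutely_continuous_gronwall (K := 2 * L) t0 acf.
rewrite subr0 /f => H.
rewrite -(@ler_pXn2r _ 2)// ?nnegrE ?mulr_ge0 ?expR_ge0// exprMn -expRM_natr.
rewrite (_ : L * t * 2 = 2 * L * t); last by ring.
apply: H; apply: ae_impl2 e1 e2 => s e1 e2 st.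
have [ss0 sst] : 0 <= s /\ s <= t by move: st; rewrite in_itv/= => /andP[/ltW ? /ltW ?].
have := is_derive_normsq (is_deriveB (e1 st) (e2 st)).
set l := 2 * _ => dl; exists l => //.
rewrite /l -mulrA ler_pM2l//.
have m := Am.1 _ _ (D1 s ss0 sst) (D2 s ss0 sst).
have -> : inner (F (u1 s) - A (u1 s) - (F (u2 s) - A (u2 s))) ((u1 - u2) s)
   = inner (F (u1 s) - F (u2 s)) (u1 s - u2 s) - inner (A (u1 s) - A (u2 s)) (u1 s - u2 s).
  by rewrite -innerBl; congr (inner _ _); apply: inner_inj => v; rewrite !innerE; ring.
rewrite lerBlDr (le_trans (inner_le _ _))// expr2 mulrA.
by rewrite (@le_trans _ _ (L * `|u1 s - u2 s| * `|u1 s - u2 s|)) ?ler_wpM2r// lerDl.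
Qed.

End trajectories.

(** * Globally Lipschitz perturbations *)

Section global_existence.
Context {R : realType} {X : hilbertType R} (D : set X) (A F : X -> X) (L : R).
Hypotheses (Am : m_monotone D A) (L0 : 0 <= L).
Hypothesis FL : forall x y, `|F x - F y| <= L * `|x - y|.
Implicit Types (u v : R -> X) (x y : X).
Local Notation speed u t := (`|A (u t) - F (u t)|).

(** A rational number chosen in each jump numbers the jumps. *)
Lemma countable_jumps (g : R -> R) :
  (forall s t, 0 <= s -> s <= t -> g t <= g s) ->
  countable [set t | 0 < t /\ exists2 e, 0 < e &
                       forall s, 0 <= s -> s < t -> g t + e <= g s].
Proof.
move=> gni; set J := [set t | _].
have /choice[q qP] : forall t, exists q : rat, J t -> g t < ratr q /\
    forall s, 0 <= s -> s < t -> ratr q < g s.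
  move=> t; have [[t0 [e e0 gt]]|nJ] := pselect (J t); last by exists 0.
  have [q] := @rat_in_itvoo R (g t) (g t + e) ltac:(by rewrite ltrDl).
  rewrite in_itv/= => /andP[q1 q2]; exists q => _; split => // s s0 st.
  exact: lt_le_trans (gt s s0 st).
apply/countable_injP; exists (fun t => pickle (q t)).
have key s t : J s -> J t -> s < t -> q s <> q t.
  move=> Js Jt st qst; have [q1 _] := qP s Js; have [_ q2] := qP t Jt.
  by have := q2 s (ltW Js.1) st; rewrite -qst ltNge ltW.
move=> s t; rewrite !inE => Js Jt /(pcan_inj pickleK) qst.
by case: (ltgtP s t) => // st; [case: (key _ _ Js Jt st)|case: (key _ _ Jt Js st)].
Qed.

(** The damped speed [g] is nonincreasing, hence upper semicontinuous from the
    right, and from the left too except at its countably many jumps; elsewhere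
    [evolution_is_derive] applies. *)
Lemma evolution_strong_trajectory u T : evolution D A F L u ->
  strong_trajectory D A F T u.
Proof.
move=> uE.
have sp t : 0 <= t -> speed u t <= expR (L * t) * speed u 0.
  by move=> t0; have [_ + _ _] := uE 0 t (lexx _) t0; rewrite subr0.
have uD t : 0 <= t -> D (u t) by move=> t0; have [] := uE t t t0 (lexx _).
split => [|t t0 _|]; last 2 first.
- exact: uD.
- pose g t := expR (- L * t) * speed u t.
  have gni s t : 0 <= s -> s <= t -> g t <= g s.
    move=> s0 st; have [_ + _ _] := uE s t s0 st.
    move=> /(ler_wpM2l (expR_ge0 (- L * t))); rewrite mulrA -expRD.
    by rewrite (_ : - L * t + L * (t - s) = - L * s) //; ring.
  have gE t : speed u t = expR (L * t) * g t.
    by rewrite /g mulrA -expRD mulNr addrN expR0 mul1r.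
  have J0 := countable_lebesgue_measure0 (countable_jumps gni).
  set J := [set t | _] in J0.
  have mJ : measurable J by exact/countable_measurable/countable_jumps.
  exists J; split => // t /= nt; apply: contrapT => nJ; apply: nt.
  rewrite in_itv/= => /andP[t0 _]; apply: (evolution_is_derive Am L0 FL uE t0) => e e0.
  have e'0 : 0 < expR (- L * t) * (e / 2) by rewrite mulr_gt0 ?expR_gt0 ?divr_gt0.
  have [s0 [s00 s0t] gs0] : exists2 s0, 0 <= s0 /\ s0 < t & g s0 < g t + expR (- L * t) * (e / 2).
    apply: contrapT => nex; apply: nJ; split => //; exists (expR (- L * t) * (e / 2)) => // s s0 st.
    by rewrite leNgt; apply/negP => gs; apply: nex; exists s.
  have near1 : \forall s \near t, expR (L * s) * (g t + expR (- L * t) * (e / 2)) <= speed u t + e.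
    suff : expR (L * s) * (g t + expR (- L * t) * (e / 2)) @[s --> t] --> speed u t + e / 2.
      by move=> /cvgr_le; apply; lra.
    have -> : speed u t + e / 2 = expR (L * t) * (g t + expR (- L * t) * (e / 2)).
      by rewrite mulrDr -gE [in RHS]mulrA -expRD mulNr addrN expR0 mul1r.
    apply: cvgM; last exact: cvg_cst.
    apply: continuous_cvg; first exact: continuous_expR.
    by apply: cvgM; [exact: cvg_cst|exact: cvg_id].
  near=> s.
  apply: (@le_trans _ _ (expR (L * s) * (g t + expR (- L * t) * (e / 2)))); last by near: s.
  rewrite gE ler_wpM2l ?expR_ge0// (le_trans _ (ltW gs0))// gni//.
  by apply/ltW; near: s; exact: lt_nbhsr.
pose c := expR (L * T) * (expR (L * T) * speed u 0).
have c0 : 0 <= c by rewrite !mulr_ge0 ?expR_ge0.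
apply: (absolutely_continuous_lipschitz c0) => s t s0 st tT.
have [_ _ + _] := uE s t s0 st; move/le_trans; apply.
rewrite [`|t - s|]ger0_norm ?subr_ge0// mulrC ler_wpM2r ?subr_ge0//.
have e1 : expR (L * (t - s)) <= expR (L * T).
  by rewrite ler_expR ler_wpM2l//; lra.
apply: ler_pM; rewrite ?expR_ge0// (le_trans (sp s s0))// ler_wpM2r// ler_expR.
by rewrite ler_wpM2l// (le_trans st).
Unshelve. all: by end_near. Qed.

Definition limit_trajectory (T : R) u :=
  exists (u_ : nat -> R -> X) (e : nat -> R),
    [/\ forall n, strong_trajectory D A F T (u_ n), e @ \oo --> (0 : R) &
        forall n t, 0 <= t -> t <= T -> `|u t - u_ n t| <= e n].

Lemma strong_limit_trajectory T u :
  strong_trajectory D A F T u -> limit_trajectory T u.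
Proof.
move=> us; exists (fun=> u), (fun=> 0); split => // [|n t _ _].
  exact: cvg_cst.
by rewrite subrr normr0.
Qed.

Lemma limit_trajectoryI T u :
  (forall e, 0 < e -> exists2 v, strong_trajectory D A F T v &
     forall t, 0 <= t -> t <= T -> `|u t - v t| <= e) -> limit_trajectory T u.
Proof.
move=> H; have /choice[v vP] : forall n : nat, exists v,
    strong_trajectory D A F T v /\
    forall t, 0 <= t -> t <= T -> `|u t - v t| <= n.+1%:R^-1.
  move=> n; have n0 : 0 < n.+1%:R^-1 :> R by rewrite invr_gt0.
  by have [v] := H _ n0; exists v.
exists v, harmonic; split => [n||n]; first exact: (vP n).1.
  exact: cvg_harmonic.
exact: (vP n).2.
Qed.

Lemma limit_trajectory_stable T u v t : limit_trajectory T u ->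
  limit_trajectory T v -> 0 <= t -> t <= T ->
  `|u t - v t| <= expR (L * t) * `|u 0 - v 0|.
Proof.
move=> [u_ [e [us e0 ue]]] [v_ [e' [vs e'0 ve]]] t0 tT; have T0 := le_trans t0 tT.
have cv (a : R -> X) a_ (f : nat -> R) s : f @ \oo --> (0 : R) ->
    (forall n, `|a s - a_ n s| <= f n) -> a_ n s @[n --> \oo] --> a s.
  move=> f0 af; apply/cvgrPdist_lt => eps eps0.
  move/cvgrPdist_lt : f0 => /(_ _ eps0); apply: filterS => n.
  rewrite sub0r normrN; apply: le_lt_trans.
  by apply: le_trans (af n) _; exact: ler_norm.
apply: (@ler_cvg_to _ \oo _ _ (fun n => `|u_ n t - v_ n t|)
  (fun n => expR (L * t) * `|u_ n 0 - v_ n 0|)).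
- apply: cvg_norm; apply: cvgB.
    by apply: (cv _ _ _ _ e0) => n; exact: ue.
  by apply: (cv _ _ _ _ e'0) => n; exact: ve.
- apply: cvgM; first exact: cvg_cst.
  apply: cvg_norm; apply: cvgB.
    by apply: (cv _ _ _ _ e0) => n; exact: ue.
  by apply: (cv _ _ _ _ e'0) => n; exact: ve.
- by apply: nearW => n; exact: (strong_trajectory_stable Am FL (us n) (vs n)).
Qed.

Lemma limit_trajectory_continuous T u : limit_trajectory T u ->
  {within `[0, T], continuous u}.
Proof.
move=> [u_ [e [us e0 ue]]]; apply/subspace_continuousP => x xT.
apply/cvgrPdist_lt => eps eps0; have eps3 : 0 < eps / 3 by rewrite divr_gt0.
move/cvgrPdist_lt : e0 => /(_ _ eps3)[N _ /(_ N (leqnn N))].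
rewrite sub0r normrN => eN; have {}eN := le_lt_trans (ler_norm _) eN.
have [acN _ _] := us N.
have /subspace_continuousP /(_ x xT) /cvgrPdist_lt /(_ _ eps3) := absolutely_continuous_within acN.
rewrite !near_withinE; apply: filterS => y + yT => /(_ yT) xy.
move: xT yT; rewrite /= !in_itv/= => /andP[x0 xT] /andP[y0 yT].
have h1 := le_lt_trans (ue N x x0 xT) eN; have h2 := le_lt_trans (ue N y y0 yT) eN.
rewrite distrC in h2.
have -> : u x - u y = (u x - u_ N x) + (u_ N x - u_ N y) + (u_ N y - u y).
  by rewrite !subrKA.
rewrite (le_lt_trans (ler_normD _ _))// (le_lt_trans (lerD (ler_normD _ _) (lexx _)))//.
lra.
Qed.

(** For initial data outside the domain, take the limit of trajectories starting
    from nearby points of the domain. *)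
Lemma trajectory_exists x : (forall y e, 0 < e -> exists2 y', D y' & `|y - y'| < e) ->
  exists u, [/\ u 0 = x, (forall T, limit_trajectory T u) &
                D x -> forall T, strong_trajectory D A F T u].
Proof.
move=> Ddense; have [Dx|nDx] := pselect (D x).
  exists (flow D A F x).
  have sx T := evolution_strong_trajectory T (flow_evolution Am L0 FL Dx).
  split => [|T|_ T]; [exact: flow0|exact/strong_limit_trajectory/sx|exact: sx].
have /choice[y yP] : forall n : nat, exists y, D y /\ `|x - y| < n.+1%:R^-1.
  move=> n; have n0 : 0 < n.+1%:R^-1 :> R by rewrite invr_gt0.
  by have [y Dy xy] := Ddense x _ n0; exists y.
have sy n T := evolution_strong_trajectory T (flow_evolution Am L0 FL (yP n).1).
pose e0 n : R := 2 * n.+1%:R^-1.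
have e00 : e0 @ \oo --> (0 : R).
  by have := cvgM (@cvg_cst _ (2 : R) _ _ _) (@cvg_harmonic R); rewrite mulr0; apply.
have ynm n m : (n <= m)%N -> `|y n - y m| <= e0 n.
  move=> nm; rewrite -(subrKA x) (le_trans (ler_normD _ _))//.
  have /ltW a := (yP n).2; have /ltW b := (yP m).2.
  have mn : m.+1%:R^-1 <= n.+1%:R^-1 :> R by rewrite lef_pV2 ?posrE// ler_nat.
  by rewrite distrC /e0 mulr_natl mulr2n lerD// (le_trans b).
have fnm n m t : (n <= m)%N -> 0 <= t ->
    `|flow D A F (y n) t - flow D A F (y m) t| <= expR (L * t) * e0 n.
  move=> nm t0.
  have := strong_trajectory_stable Am FL (sy n t) (sy m t) t0 (lexx _).
  rewrite !flow0 => /le_trans; apply.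
  by rewrite ler_wpM2l ?expR_ge0// ynm.
pose u t := lim (flow D A F (y n) t @[n --> \oo]).
have uc t : 0 <= t -> flow D A F (y n) t @[n --> \oo] --> u t.
  move=> t0; apply: (@cauchy_seq_cvg _ _ _ (fun n => expR (L * t) * e0 n)).
    by have := cvgM (@cvg_cst _ (expR (L * t)) _ _ _) e00; rewrite mulr0; apply.
  by move=> n m nm; exact: fnm.
have un n t : 0 <= t -> `|u t - flow D A F (y n) t| <= expR (L * t) * e0 n.
  move=> t0; rewrite distrC.
  apply: (@ler_cvg_to _ \oo _ _ (fun m => `|flow D A F (y n) t - flow D A F (y m) t|)
    (fun=> expR (L * t) * e0 n)).
  - by apply: cvg_norm; apply: cvgB; [exact: cvg_cst|exact: uc].
  - exact: cvg_cst.
  - by exists n => // m /= nm; exact: fnm.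
exists u; split => // [|T].
  have := uc 0 (lexx _); under eq_fun do rewrite flow0.
  move=> yu; apply: (cvg_unique _ yu) => //; apply/cvgrPdist_lt => e ep.
  have := @cvg_harmonic R => /cvgrPdist_lt /(_ _ ep); apply: filterS => n.
  rewrite sub0r normrN; apply: le_lt_trans; apply: le_trans (ler_norm _).
  exact/ltW/(yP n).2.
exists (fun n => flow D A F (y n)), (fun n => expR (L * T) * e0 n); split.
- by move=> n; exact: sy.
- by have := cvgM (@cvg_cst _ (expR (L * T)) _ _ _) e00; rewrite mulr0; apply.
- move=> n t t0 tT; rewrite (le_trans (un n t t0))// ler_wpM2r ?mulr_ge0//.
  by rewrite ler_expR ler_wpM2l.
Qed.

End global_existence.

(** * Adjoints and differentials *)

Section adjoint_theory.
Context {R : realType} {X Y : hilbertType R}.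

Definition linear_map (K : X -> Y) := forall a x y, K (a *: x + y) = a *: K x + K y.

Lemma linear_map_linear (K : {linear X -> Y}) : linear_map K.
Proof. by move=> a x y; rewrite linearP. Qed.

Lemma adjointP (K : X -> Y) (k : R) (y : Y) : linear_map K ->
  (forall x, `|K x| <= k * `|x|) ->
  forall x, inner (adjoint K y) x = inner y (K x).
Proof.
move=> Klin Kk.
pose f x : R := inner y (K x).
have flin : linear f by move=> a u v; rewrite /f Klin innerDr innerZr.
pose lf : {linear X -> R} := HB.pack f (GRing.isLinear.Build _ _ _ _ f flin).
have [|a aP] := @riesz_representation R X lf (`|y| * k).
  move=> v; apply: le_trans (normr_inner_le _ _) _.
  by rewrite -mulrA ler_wpM2l.
exact: (@xgetPex _ 0 [set x | forall v, inner x v = inner y (K v)] (ex_intro _ a aP)).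
Qed.

Lemma adjointB (K : X -> Y) (k : R) (y1 y2 : Y) : linear_map K ->
  (forall x, `|K x| <= k * `|x|) ->
  adjoint K y1 - adjoint K y2 = adjoint K (y1 - y2).
Proof.
move=> Kl Kk; apply: inner_inj => v.
by rewrite innerBl !(adjointP _ Kl Kk) innerBl.
Qed.

Lemma adjoint_sub_le (K1 K2 : X -> Y) (k1 k2 c : R) (y : Y) :
  linear_map K1 -> linear_map K2 ->
  (forall x, `|K1 x| <= k1 * `|x|) -> (forall x, `|K2 x| <= k2 * `|x|) ->
  0 <= c -> (forall x, `|K1 x - K2 x| <= c * `|x|) ->
  `|adjoint K1 y - adjoint K2 y| <= c * `|y|.
Proof.
move=> l1 l2 b1 b2 c0 K12; set x := _ - _.
have [->|x0] := eqVneq x 0; first by rewrite normr0 mulr_ge0.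
rewrite -(@ler_pM2l _ `|x|) ?normr_gt0// -expr2 -inner_normE {1}/x innerBl.
rewrite (adjointP _ l1 b1) (adjointP _ l2 b2) -innerBr.
rewrite (le_trans (inner_le _ _))// (_ : _ * (c * _) = `|y| * (c * `|x|)); last by ring.
by rewrite ler_wpM2l.
Qed.

Lemma adjoint_le (K : X -> Y) (k : R) (y : Y) : linear_map K -> 0 <= k ->
  (forall x, `|K x| <= k * `|x|) -> `|adjoint K y| <= k * `|y|.
Proof.
move=> Kl k0 Kk; set x := adjoint K y.
have [->|x0] := eqVneq x 0; first by rewrite normr0 mulr_ge0.
rewrite -(@ler_pM2l _ `|x|) ?normr_gt0// -expr2 -inner_normE {1}/x.
rewrite (adjointP _ Kl Kk) (le_trans (inner_le _ _))//.
rewrite (_ : _ * (k * _) = `|y| * (k * `|x|)); last by ring.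
by rewrite ler_wpM2l.
Qed.

End adjoint_theory.

Section differentials.
Context {R : realType}.

Lemma opnorm_le (X Y : normedModType R) (f : X -> Y) (k : R) (x : X) :
  (forall a x, f (a *: x) = a *: f x) -> (forall x, `|f x| <= k * `|x|) ->
  `|f x| <= opnorm f * `|x|.
Proof.
move=> fZ fk; have [->|x0] := eqVneq x 0.
  by rewrite -(scale0r (0 : X)) fZ !scale0r !normr0 mulr0.
have xp : 0 < `|x| by rewrite normr_gt0.
rewrite -ler_pdivrMr// mulrC.
have -> : `|x|^-1 * `|f x| = `|f (`|x|^-1 *: x)|.
  by rewrite fZ normrZ ger0_norm ?invr_ge0.
apply: ub_le_sup; last first.
  exists (`|x|^-1 *: x) => //=.
  by rewrite normrZ ger0_norm ?invr_ge0// mulVf// gt_eqF.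
exists `|k| => _ [y /= y1 <-]; rewrite (le_trans (fk y))//.
rewrite (le_trans (ler_wpM2r (normr_ge0 y) (ler_norm k)))//.
by rewrite ler_piMr.
Qed.

Section normed.
Variables (X Y : normedModType R) (M : X -> Y).

Lemma diff_bounded w : differentiable M w ->
  exists2 k, 0 <= k & forall h, `|'d M w h| <= k * `|h|.
Proof.
move=> dM; have := diff_continuous dM.
move=> /linear_bounded_continuous/linear_boundedP[k [_ hk]].
exists (`|k| + 1) => [|h]; first by rewrite addr_ge0.
by apply: hk; rewrite (le_lt_trans (ler_norm k))// ltrDl.
Qed.

Lemma diff_sub_le v w h : differentiable M v -> differentiable M w ->
  `|'d M v h - 'd M w h| <= opnorm ('d M v \- 'd M w) * `|h|.
Proof.
move=> /diff_bounded[k k0 vk] /diff_bounded[l l0 wl].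
apply: (@opnorm_le _ _ ('d M v \- 'd M w) (k + l)) => [a x|x] /=.
  by rewrite scalerBr; congr (_ - _); exact: linearZ.
by rewrite mulrDl (le_trans (ler_normB _ _))// lerD.
Qed.

Lemma diff_lipschitz_le (S : set X) : (forall w, differentiable M w) ->
  diff_lipschitz_on M S -> exists2 k, 0 <= k & forall w1 w2 h, S w1 -> S w2 ->
  `|'d M w1 h - 'd M w2 h| <= k * `|w1 - w2| * `|h|.
Proof.
move=> dM [k Sk]; exists `|k| => // w1 w2 h S1 S2.
rewrite (le_trans (diff_sub_le _ (dM _) (dM _)))// ler_wpM2r//.
by rewrite (le_trans (Sk _ _ S1 S2))// ler_wpM2r// ler_norm.
Qed.

Lemma diff_lipschitz_bounded (S : set X) : (forall w, differentiable M w) ->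
  S 0 -> diff_lipschitz_on M S -> exists2 m, 0 <= m & forall w h, S w ->
  `|'d M w h| <= m * (1 + `|w|) * `|h|.
Proof.
move=> dM S0 /(diff_lipschitz_le dM)[k k0 Sk].
have [m m0 hm] := diff_bounded (dM 0).
exists (m + k); first by rewrite addr_ge0.
move=> w h Sw; rewrite -(subrK ('d M 0 h) ('d M w h)) (le_trans (ler_normD _ _))//.
have := Sk w 0 h Sw S0; rewrite subr0; have := hm h.
have := mulr_ge0 (mulr_ge0 m0 (normr_ge0 w)) (normr_ge0 h).
have := mulr_ge0 k0 (normr_ge0 h).
lra.
Qed.

Lemma is_derive_comp_diff (w : R -> X) (t : R) (dw : X) : is_derive t 1 w dw ->
  differentiable M (w t) -> is_derive t 1 (M \o w) ('d M (w t) dw).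
Proof.
move=> [wd <-] dM; have dw' : differentiable w t by apply/derivable1_diffP.
have dMw : differentiable (M \o w) t by exact: differentiable_comp.
apply: DeriveDef; first exact/derivable1_diffP.
by rewrite !deriveE// diff_comp.
Qed.

End normed.

Lemma is_derive_inner (X : hilbertType R) (u : R -> X) (t : R) (du e : X) :
  is_derive t 1 u du -> is_derive t 1 (fun s => inner (u s) e) (inner du e).
Proof.
move=> [ud <-].
suff lim : h^-1 *: (inner (u (h *: 1 + t)) e - inner (u t) e) @[h --> 0^']
    --> (inner ('D_1 u t) e : R).
  by apply: DeriveDef; [apply/cvg_ex; exists (inner ('D_1 u t) e)|exact/cvg_lim].
rewrite (_ : (fun h => _) = (fun h : R => inner (h^-1 *: (u (h *: 1 + t) - u t)) e)); last first.
  by apply/funext => h; rewrite innerZl innerBl.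
by apply: cvg_inner; [have := ud; rewrite /derivable|exact: cvg_cst].
Qed.

(** The scalar mean value theorem for [<M (g s), e>] along the segment [g] from
    [w2] to [w1], with [e = M w1 - M w2]. *)
Lemma mean_value_inequality (X : normedModType R) (Y : hilbertType R)
    (M : X -> Y) (r m : R) : (forall w, differentiable M w) ->
  (forall w h, `|w| <= r -> `|'d M w h| <= m * `|h|) ->
  forall w1 w2, `|w1| <= r -> `|w2| <= r -> `|M w1 - M w2| <= m * `|w1 - w2|.
Proof.
move=> dM Mm w1 w2 w1r w2r; set e := M w1 - M w2.
have [->|e0] := eqVneq e 0; first by rewrite normr0 (le_trans _ (Mm w1 _ w1r)).
pose g (s : R) := s *: (w1 - w2) + w2.
have gd (s : R) : is_derive s 1 g (w1 - w2).
  suff lim : h^-1 *: (g (h *: 1 + s) - g s) @[h --> (0 : R)^'] --> w1 - w2.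
    by apply: DeriveDef; [apply/cvg_ex; exists (w1 - w2)|exact/cvg_lim].
  apply: cvg_near_cst; near=> h.
  rewrite /g opprD addrACA subrr addr0 -scalerBl addrK scalerA.
  rewrite [h *: 1]mulr1 mulVf ?scale1r//.
  by near: h; exact: nbhs_dnbhs_neq.
have fd (s : R) : is_derive s 1 (fun s => inner (M (g s)) e) (inner ('d M (g s) (w1 - w2)) e).
  exact/is_derive_inner/is_derive_comp_diff.
have [|c] := @MVT R _ _ 0 1 ltr01 (fun s _ => fd s).
  apply: continuous_subspaceT => s; apply/differentiable_continuous/derivable1_diffP.
  by have [] := fd s.
rewrite in_itv/= => /andP[c0 c1]; rewrite /g scale0r add0r scale1r subrK subr0 mulr1.
rewrite -innerBl -/e inner_normE => h.
rewrite -(@ler_pM2r _ `|e|) ?normr_gt0// -expr2 h (le_trans (inner_le _ _))//.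
rewrite ler_wpM2r// Mm//.
have -> : c *: (w1 - w2) + w2 = c *: w1 + (1 - c) *: w2.
  by rewrite scalerBr scalerBl scale1r -!addrA [- _ + _]addrC.
rewrite (le_trans (ler_normD _ _))// !normrZ (ger0_norm (ltW c0)) ger0_norm ?subr_ge0 ?(ltW c1)//.
have := ler_wpM2l (ltW c0) w1r; have := ler_wpM2l _ w2r => /(_ (1 - c)).
by rewrite subr_ge0 (ltW c1) => /(_ isT); lra.
Unshelve. all: by end_near. Qed.

End differentials.

(** * The transformed system *)

Section truncation.
Context {R : realType} {X : normedModType R} (r : R).
Hypothesis r0 : 0 < r.

Definition truncate (x : X) : X := (r / Num.max r `|x|) *: x.

Lemma truncate_id x : `|x| <= r -> truncate x = x.
Proof. by move=> xr; rewrite /truncate max_l// divff ?gt_eqF// scale1r. Qed.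

Let max_gt0 (x : X) : 0 < Num.max r `|x|.
Proof. by rewrite lt_max r0. Qed.

Lemma truncate_le x : `|truncate x| <= r.
Proof.
rewrite /truncate normrZ ger0_norm ?divr_ge0 ?(ltW r0) ?(ltW (max_gt0 x))//.
by rewrite mulrAC ler_pdivrMr// ler_pM2l// le_max lexx orbT.
Qed.

(** The constant [2] holds in any normed space: for [|y| <= |x|], change the
    vector first and the scaling factor next. *)
Lemma truncate_dist x y : `|truncate x - truncate y| <= 2 * `|x - y|.
Proof.
wlog xy : x y / `|y| <= `|x|.
  move=> H; have [/H//|/ltW/H] := leP `|y| `|x|.
  by rewrite distrC (distrC y).
pose a (x : X) := r / Num.max r `|x|.
have a1 : a x <= 1 by rewrite ler_pdivrMr// mul1r le_max lexx.
have a0 : 0 <= a x by rewrite divr_ge0 ?(ltW r0) ?(ltW (max_gt0 x)).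
have axy : a x <= a y.
  rewrite ler_pM2l// lef_pV2 ?posrE ?max_gt0//.
  by rewrite ge_max le_max lexx/= le_max xy orbT.
have ayy : a y * `|y| <= a x * `|x|.
  have [xr|rx] := leP `|x| r.
    by rewrite /a !max_l ?(le_trans xy)// divff ?gt_eqF// !mul1r.
  rewrite [a x]/a max_r ?(ltW rx)// divfK ?gt_eqF ?(lt_trans r0)//.
  have := truncate_le y; rewrite /truncate normrZ ger0_norm//.
  exact: le_trans axy.
have -> : truncate x - truncate y = a x *: (x - y) + (a x - a y) *: y.
  by rewrite scalerBr scalerBl addrA subrK.
have n1 : `|a x *: (x - y)| = a x * `|x - y| by rewrite normrZ ger0_norm.
have n2 : `|(a x - a y) *: y| = (a y - a x) * `|y|.
  by rewrite normrZ ler0_norm ?subr_le0// opprB.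
rewrite (le_trans (ler_normD _ _))// n1 n2.
have h1 : a x * `|x - y| <= `|x - y| by rewrite ler_piMl.
have h2 : a x * (`|x| - `|y|) <= `|x - y|.
  apply: le_trans h1; rewrite ler_wpM2l//; exact: lerB_dist.
lra.
Qed.

End truncation.

Section shifted_system.
Context {R : realType} {H Z U : hilbertType R}.
Variables (DA : set H) (A : H -> H) (B : {linear U -> H}).
Variables (M : H -> Z) (d : H) (yref : Z).
Hypothesis A_maxmono : maximal_monotone (op_graph DA A).
Hypothesis B_bounded : bounded_linear B.
Hypothesis M_diff : forall w, differentiable M w.
Hypothesis M_lip : diff_locally_lipschitz M.
Implicit Types (u v : hprod H Z).

Definition feedback u : H := B (adjoint B (adjoint ('d M (u.1)) u.2)) + d.

(** The right-hand side of the system satisfied by [(w, z - M w)]: when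
    [z - M w] is differentiated along a solution, the unbounded terms [C w] and
    [dM(w) (A w)] cancel. *)
Definition shifted_field u : hprod H Z :=
  (feedback u, - 'd M (u.1) (feedback u) - yref).

Definition lift_op u : hprod H Z := (A u.1, 0).

Definition lift_dom : set (hprod H Z) := [set u | DA u.1].

Lemma lift_m_monotone : m_monotone lift_dom lift_op.
Proof.
have [Am Ar] := maximal_m_monotone A_maxmono; split=> [u v Du Dv|l [y1 y2] l0].
  by rewrite inner_hprodE /= subrr inner0l addr0 Am.
have [x Dx xy] := Ar l y1 l0; exists ((x, y2) : hprod H Z) => //.
by congr pair => //=; rewrite scaler0 addr0.
Qed.

Lemma bounded_set_ball (r : R) : bounded_set [set w : H | `|w| <= r].
Proof.
exists r; split; first exact: num_real.
by move=> s rs w /= wr; rewrite (le_trans wr)// ltW.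
Qed.

Lemma diff_bounded_ball (r : R) : 0 <= r ->
  exists2 m, 0 <= m & forall w h, `|w| <= r -> `|'d M w h| <= m * `|h|.
Proof.
move=> r0; have S0 : [set w : H | `|w| <= r] 0 by rewrite /= normr0.
have [m m0 hm] := diff_lipschitz_bounded M_diff S0 (M_lip (@bounded_set_ball r)).
exists (m * (1 + r)); first by rewrite mulr_ge0// addr_ge0.
move=> w h wr; rewrite (le_trans (hm w h wr))// ler_wpM2r// ler_wpM2l//.
by rewrite lerD2l.
Qed.

Lemma lipschitz_ball (r : R) : 0 <= r ->
  exists2 m, 0 <= m & forall w1 w2, `|w1| <= r -> `|w2| <= r ->
     `|M w1 - M w2| <= m * `|w1 - w2|.
Proof.
move=> r0; have [m m0 hm] := diff_bounded_ball r0; exists m => //.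
exact: mean_value_inequality M_diff hm.
Qed.

Lemma bounded_linear_ge0 : exists2 b, 0 <= b & forall x, `|B x| <= b * `|x|.
Proof.
have [k hk] := B_bounded; exists `|k| => // x.
by rewrite (le_trans (hk x))// ler_wpM2r// ler_norm.
Qed.

Lemma shifted_field_lipschitz (r : R) : 0 <= r ->
  exists2 L, 0 <= L & forall u v, `|u| <= r -> `|v| <= r ->
    `|shifted_field u - shifted_field v| <= L * `|u - v|.
Proof.
move=> r0; have [m m0 hm] := diff_bounded_ball r0.
have [k k0 hk] := diff_lipschitz_le M_diff (M_lip (@bounded_set_ball r)).
have [b b0 hb] := bounded_linear_ge0.
have hbs x : `|adjoint B x| <= b * `|x|.
  exact: (adjoint_le x (linear_map_linear B) b0 hb).
have hB x : `|B (adjoint B x)| <= b * b * `|x|.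
  by rewrite (le_trans (hb _))// -mulrA ler_wpM2l.
have lB := linear_map_linear B.
have lM w := linear_map_linear ('d M w).
pose L1 := b * b * (m + k * r).
have L10 : 0 <= L1 by rewrite !mulr_ge0// addr_ge0// mulr_ge0.
have fE p q : B (adjoint B p) + d - (B (adjoint B q) + d) = B (adjoint B (p - q)).
  by rewrite opprD addrACA subrr addr0 -linearB (adjointB _ _ lB hb).
have fL u v : `|u| <= r -> `|v| <= r -> `|feedback u - feedback v| <= L1 * `|u - v|.
  move=> ur vr; have u1r := le_trans (hprod_norm1 u) ur.
  have v1r := le_trans (hprod_norm1 v) vr; have v2r := le_trans (hprod_norm2 v) vr.
  rewrite [_ - _]fE.
  rewrite (le_trans (hB _))// /L1 -[leRHS]mulrA ler_wpM2l ?mulr_ge0//.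
  rewrite -(subrKA (adjoint ('d M (u.1)) v.2)) (le_trans (ler_normD _ _))// mulrDl lerD//.
    rewrite (adjointB _ _ (lM _) (fun h => hm u.1 h u1r)).
    rewrite (le_trans (adjoint_le _ (lM _) m0 (fun h => hm u.1 h u1r)))//.
    by rewrite ler_wpM2l// (hprod_norm2 (u - v)).
  have c0 : 0 <= k * `|u.1 - v.1| by rewrite mulr_ge0.
  rewrite (le_trans (adjoint_sub_le _ (lM _) (lM _) (fun h => hm u.1 h u1r)
    (fun h => hm v.1 h v1r) c0 (fun h => hk _ _ h u1r v1r)))//.
  rewrite -!mulrA ler_wpM2l// mulrC ler_pM//.
  exact: (hprod_norm1 (u - v)).
pose f := b * b * (m * r) + `|d|.
have f0 : 0 <= f by rewrite addr_ge0// !mulr_ge0.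
have fb v : `|v| <= r -> `|feedback v| <= f.
  move=> vr; have v1r := le_trans (hprod_norm1 v) vr.
  have v2r := le_trans (hprod_norm2 v) vr.
  rewrite (le_trans (ler_normD _ _))// lerD2r (le_trans (hB _))// ler_wpM2l ?mulr_ge0//.
  by rewrite (le_trans (adjoint_le _ (lM _) m0 (fun h => hm v.1 h v1r)))// ler_wpM2l.
pose L2 := m * L1 + k * f.
exists (L1 + L2); first by rewrite addr_ge0// addr_ge0// mulr_ge0.
move=> u v ur vr; have u1r := le_trans (hprod_norm1 u) ur.
have v1r := le_trans (hprod_norm1 v) vr.
rewrite (le_trans (hprod_norm_le _))// mulrDl lerD//=; first exact: fL.
have e (p q y : Z) : - p - y - (- q - y) = q - p.
  by rewrite opprD !opprK addrACA addNr addr0 addrC.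
rewrite e distrC.
rewrite -(subrKA ('d M (u.1) (feedback v))) (le_trans (ler_normD _ _))// mulrDl lerD//.
  by rewrite -linearB (le_trans (hm _ _ u1r))// -mulrA ler_wpM2l// fL.
rewrite (le_trans (hk _ _ _ u1r v1r))// -!mulrA ler_wpM2l// mulrC.
by rewrite ler_pM// ?fb//; exact: (hprod_norm1 (u - v)).
Qed.

Definition truncated_field (r : R) u : hprod H Z := shifted_field (truncate r u).

Lemma truncated_field_id r u : 0 < r -> `|u| <= r ->
  truncated_field r u = shifted_field u.
Proof. by move=> r0 ur; rewrite /truncated_field truncate_id. Qed.

Lemma truncated_field_lipschitz (r : R) : 0 < r ->
  exists2 L, 0 <= L & forall u v,
    `|truncated_field r u - truncated_field r v| <= L * `|u - v|.
Proof.
move=> r0; have [L L0 hL] := shifted_field_lipschitz (ltW r0).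
exists (L * 2) => [|u v]; first by rewrite mulr_ge0.
rewrite (le_trans (hL _ _ _ _)) ?truncate_le// -mulrA ler_wpM2l//.
exact: truncate_dist.
Qed.

Lemma lift_dom_dense : dense DA ->
  forall (y : hprod H Z) e, 0 < e -> exists2 y', lift_dom y' & `|y - y'| < e.
Proof.
move=> DAd y e e0; have [] := DAd (ball y.1 e) _ (ball_open _ _).
  by exists y.1; exact: ballxx.
move=> w [yw Dw]; exists ((w, y.2) : hprod H Z) => //.
rewrite (le_lt_trans (hprod_norm_le _))//= subrr normr0 addr0.
by move: yw; rewrite -ball_normE.
Qed.

End shifted_system.

(** * Solutions of the closed loop and of the transformed system *)

Section uniform_convergence.
Context {R : realType} {V : normedModType R}.

Lemma uniform_cvgP (A : set R) (f_ : nat -> R -> V) (f : R -> V) :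
  {uniform A, f_ @ \oo --> f} <-> forall e, 0 < e ->
    \forall n \near \oo, forall t, A t -> `|f t - f_ n t| < e.
Proof.
split=> [ff e e0|H P /uniform_nbhs[E [entE EP]]].
  apply: (ff [set h | forall t, A t -> `|f t - h t| < e]).
  apply/uniform_nbhs; exists [set xy : V * V | ball xy.1 e xy.2]; split.
    exact: (entourage_ball _ (PosNum e0)).
  by move=> h hE t At; have := hE t At; rewrite -ball_normE.
move: entE; rewrite -entourage_ballE => -[e /= e0 eE].
apply: filterS (H e e0) => n hn; apply: EP => t At; apply: eE.
by rewrite /= -ball_normE; exact: hn.
Qed.

End uniform_convergence.

Section hprod_derive.
Context {R : realType} {H Z : hilbertType R}.
Implicit Types (t : R) (u : R -> hprod H Z).

Lemma is_derive_hprod (w : R -> H) (y : R -> Z) t dw dy :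
  is_derive t 1 w dw -> is_derive t 1 y dy ->
  is_derive t 1 (fun s => (w s, y s) : hprod H Z) ((dw, dy) : hprod H Z).
Proof.
move=> [wd <-] [yd <-]; set l : hprod H Z := (_, _).
suff lim : h^-1 *: (((w (h *: 1 + t), y (h *: 1 + t)) : hprod H Z) - (w t, y t))
    @[h --> (0 : R)^'] --> l.
  by apply: DeriveDef; [apply/cvg_ex; exists l|exact/cvg_lim].
by apply: cvg_hprod; [have := wd|have := yd]; rewrite /derivable.
Qed.

Lemma is_derive_hprod1 u t (du : hprod H Z) :
  is_derive t 1 u du -> is_derive t 1 (fun s => (u s).1) du.1.
Proof.
move=> [ud <-].
suff lim : h^-1 *: ((u (h *: 1 + t)).1 - (u t).1) @[h --> (0 : R)^'] --> ('D_1 u t).1.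
  by apply: DeriveDef; [apply/cvg_ex; exists ('D_1 u t).1|exact/cvg_lim].
exact: (cvg_hprod1 (f := fun h : R => h^-1 *: (u (h *: 1 + t) - u t)) ud).
Qed.

Lemma is_derive_hprod2 u t (du : hprod H Z) :
  is_derive t 1 u du -> is_derive t 1 (fun s => (u s).2) du.2.
Proof.
move=> [ud <-].
suff lim : h^-1 *: ((u (h *: 1 + t)).2 - (u t).2) @[h --> (0 : R)^'] --> ('D_1 u t).2.
  by apply: DeriveDef; [apply/cvg_ex; exists ('D_1 u t).2|exact/cvg_lim].
exact: (cvg_hprod2 (f := fun h : R => h^-1 *: (u (h *: 1 + t) - u t)) ud).
Qed.

End hprod_derive.

Section dictionary.
Context {R : realType} {H Z U : hilbertType R}.
Variables (DA : set H) (A : H -> H) (B : {linear U -> H}) (C : H -> Z).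
Variables (M : H -> Z) (d : H) (yref : Z).
Hypothesis M_diff : forall w, differentiable M w.
Hypothesis M_lip : diff_locally_lipschitz M.
Hypothesis M_eq : forall w, DA w -> 'd M w (A w) + C w = 0.
Implicit Types (r T : R) (w : R -> H) (z : R -> Z) (u : R -> hprod H Z).

Local Notation strong := (strong_solution DA A B C M d yref).
Local Notation weak := (weak_solution DA A B C M d yref).
Local Notation field := (truncated_field B M d yref).
Local Notation traj r := (strong_trajectory (lift_dom DA) (lift_op A) (field r)).
Local Notation limtraj r := (limit_trajectory (lift_dom DA) (lift_op A) (field r)).

Definition shift w z : R -> hprod H Z := fun t => (w t, z t - M (w t)).
Definition unshift u : R -> Z := fun t => (u t).2 + M (u t).1.

Lemma pair_norm (x : H) (y : Z) : `|(x, y) : (H * Z)%type| = Num.max `|x| `|y|.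
Proof. by rewrite prod_normE. Qed.

Lemma strong_solution_trajectory r T w z : 0 < r -> strong T w z ->
  (forall t, 0 <= t -> t <= T -> `|shift w z t| <= r) -> traj r T (shift w z).
Proof.
move=> r0 [ac wD ae] ur; have [m m0 hm] := lipschitz_ball M_diff M_lip (ltW r0).
split=> [|t t0 tT|].
- apply: (absolutely_continuous_dominated (c := 2 + m) _ ac ac); first by rewrite addr_ge0.
  move=> s t s0 st tT; have t0 := le_trans s0 st; have sT := le_trans st tT.
  set e : R := `|(w t, z t) - (w s, z s)|.
  have [e1 e2] : `|w t - w s| <= e /\ `|z t - z s| <= e.
    by rewrite /e [(_, _) - _](_ : _ = (w t - w s, z t - z s))// pair_norm !le_max !lexx orbT.
  have hM : `|M (w t) - M (w s)| <= m * e.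
    rewrite (le_trans (hm _ _ _ _)) ?ler_wpM2l//.
      exact: le_trans (hprod_norm1 (shift w z t)) (ur t t0 tT).
    exact: le_trans (hprod_norm1 (shift w z s)) (ur s s0 sT).
  rewrite (le_trans (hprod_norm_le _))//=.
  have e3 : `|z t - M (w t) - (z s - M (w s))| <= e + m * e.
    have -> : z t - M (w t) - (z s - M (w s)) = (z t - z s) - (M (w t) - M (w s)).
      by rewrite opprB addrACA [- M (w t) + _]addrC opprB [RHS]addrACA [- z s + _]addrC.
    by rewrite (le_trans (ler_normB _ _))// lerD.
  have e0 : 0 <= e by exact: normr_ge0.
  have p1 : 0 <= (2 + m) * `|t - s| by rewrite mulr_ge0// addr_ge0.
  have p2 : 0 <= m * e by rewrite mulr_ge0.
  lra.
- by apply: wD; rewrite in_itv/= t0.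
- apply: ae_impl ae => t ft tT; have [wd zd + +] := ft tT; rewrite !derive1E => wE zE.
  have [t0 tT'] : 0 <= t /\ t <= T by move: tT; rewrite in_itv/= => /andP[/ltW ? /ltW ?].
  have Dw : DA (w t) by apply: wD; rewrite in_itv/= t0.
  rewrite (truncated_field_id _ _ _ _ r0 (ur t t0 tT')).
  set fb := feedback B M d (shift w z t).
  have w' : is_derive t 1 w (fb - A (w t)).
    by apply: DeriveDef => //; rewrite /fb /feedback /= -wE addrK.
  have z' : is_derive t 1 z (C (w t) - yref) by apply: DeriveDef.
  have Mw' := is_derive_comp_diff w' (M_diff (w t)).
  have := is_derive_hprod w' (is_deriveB z' Mw').
  congr (is_derive _ _ _ _); rewrite /shifted_field /lift_op -/fb.
  congr pair => /=; rewrite subr0 linearB opprB.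
  move/eqP : (M_eq Dw); rewrite addrC addr_eq0 => /eqP ->.
  move: ('d M (w t) fb) ('d M (w t) (A (w t))) => p q.
  by apply: inner_inj => v; rewrite !innerE; ring.
Qed.

Lemma trajectory_strong_solution r T u : 0 < r -> traj r T u ->
  (forall t, 0 <= t -> t <= T -> `|u t| <= r) ->
  strong T (fun t => (u t).1) (unshift u).
Proof.
move=> r0 [ac uD ae] ur; have [m m0 hm] := lipschitz_ball M_diff M_lip (ltW r0).
split=> [|t|].
- apply: (absolutely_continuous_dominated (c := 1 + m) _ ac ac); first by rewrite addr_ge0.
  move=> s t s0 st tT; have t0 := le_trans s0 st; have sT := le_trans st tT.
  have e1 := hprod_norm1 (u t - u s); have e2 := hprod_norm2 (u t - u s).
  set e := `|u t - u s| in e1 e2 *; rewrite /= in e1 e2.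
  have hM : `|M (u t).1 - M (u s).1| <= m * e.
    rewrite (le_trans (hm _ _ _ _)) ?ler_wpM2l//.
      exact: le_trans (hprod_norm1 _) (ur t t0 tT).
    exact: le_trans (hprod_norm1 _) (ur s s0 sT).
  have e0 : 0 <= e by exact: normr_ge0.
  have p1 : 0 <= (1 + m) * `|t - s| by rewrite mulr_ge0// addr_ge0.
  have p2 : 0 <= m * e by rewrite mulr_ge0.
  rewrite [(_, _) - _](_ : _ = ((u t).1 - (u s).1, unshift u t - unshift u s))// pair_norm.
  have e3 : `|unshift u t - unshift u s| <= e + m * e.
    rewrite /unshift opprD addrACA (le_trans (ler_normD _ _))// lerD//.
  by rewrite ge_max; apply/andP; split; lra.
- by rewrite in_itv/= => /andP[t0 tT]; exact: uD.
- apply: ae_impl ae => t ft tT; have := ft tT.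
  have [t0 tT'] : 0 <= t /\ t <= T by move: tT; rewrite in_itv/= => /andP[/ltW ? /ltW ?].
  rewrite (truncated_field_id _ _ _ _ r0 (ur t t0 tT')) => du.
  have Du : DA (u t).1 by exact: (uD t t0 tT').
  have w' := is_derive_hprod1 du; have y' := is_derive_hprod2 du.
  have Mw' := is_derive_comp_diff w' (M_diff (u t).1).
  have z' := is_deriveD y' Mw'.
  have z'' : is_derive t 1 (unshift u) _ := z'.
  have [wd wE] := w'; have [zd zE] := z''.
  split => //.
    rewrite derive1E wE subrK /feedback; congr (B (adjoint B (adjoint _ _)) + _).
    by rewrite /unshift addrK.
  rewrite derive1E zE /= subr0 linearB /=.
  move/eqP : (M_eq Du); rewrite addrC addr_eq0 => /eqP ->.
  move: ('d M _ _) ('d M _ _) => p q.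
  by apply: inner_inj => v; rewrite !innerE; ring.
Qed.

End dictionary.

Section weak_solutions.
Context {R : realType} {H Z U : hilbertType R}.
Variables (DA : set H) (A : H -> H) (B : {linear U -> H}) (C : H -> Z).
Variables (M : H -> Z) (d : H) (yref : Z).
Hypothesis M_diff : forall w, differentiable M w.
Hypothesis M_lip : diff_locally_lipschitz M.
Hypothesis M_eq : forall w, DA w -> 'd M w (A w) + C w = 0.
Implicit Types (r T : R) (w : R -> H) (z : R -> Z) (u : R -> hprod H Z).

Local Notation strong := (strong_solution DA A B C M d yref).
Local Notation weak := (weak_solution DA A B C M d yref).
Local Notation field := (truncated_field B M d yref).
Local Notation traj r := (strong_trajectory (lift_dom DA) (lift_op A) (field r)).
Local Notation limtraj r := (limit_trajectory (lift_dom DA) (lift_op A) (field r)).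

Lemma strong_solution_ext T w z w' z' :
  (forall t, 0 <= t -> t <= T -> w' t = w t /\ z' t = z t) ->
  strong T w z -> strong T w' z'.
Proof.
move=> e [ac wD ae]; split=> [eps eps0|t tT|].
- have [dl dl0 h] := ac eps eps0; exists dl => // n s t st tr sd.
  apply: le_lt_trans (h n s t st tr sd); apply: ler_sum => i _.
  have [s0 [si ti]] := st i; have [-> ->] := e (s i) s0 (le_trans si ti).
  by have [-> ->] := e (t i) (le_trans s0 si) ti.
- have := tT; rewrite in_itv/= => /andP[t0 tT'].
  by have [-> _] := e t t0 tT'; exact: wD.
- apply: ae_impl ae => t ft tT; have [wd zd + +] := ft tT; rewrite !derive1E => wE zE.
  have near1 : \forall s \near t, 0 <= s /\ s <= T.
    move: tT; rewrite in_itv/= => /andP[t0 tT].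
    near=> s; split; apply/ltW; near: s; [exact: lt_nbhsr|exact: lt_nbhsl].
  have [t0 tT'] := nbhs_singleton near1.
  have [ew ez] := e t t0 tT'.
  have nw : \forall s \near t, w s = w' s.
    by apply: filterS near1 => s [s0 sT]; have [] := e s s0 sT.
  have nz : \forall s \near t, z s = z' s.
    by apply: filterS near1 => s [s0 sT]; have [] := e s s0 sT.
  split.
  + exact: near_eq_derivable nw wd.
  + exact: near_eq_derivable nz zd.
  + by rewrite derive1E ew ez -(near_eq_derive _ nw).
  + by rewrite derive1E ew -(near_eq_derive _ nz).
Unshelve. all: by end_near. Qed.

Lemma strong_solutionW S T w z : S <= T -> strong T w z -> strong S w z.
Proof.
move=> ST [ac wD ae]; split; first exact: absolutely_continuousW ac.
  move=> t; rewrite in_itv/= => /andP[t0 tS]; apply: wD.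
  by rewrite in_itv/= t0 (le_trans tS).
apply: ae_impl ae => t ft; rewrite in_itv/= => /andP[t0 tS]; apply: ft.
by rewrite in_itv/= t0 (lt_le_trans tS).
Qed.

Lemma weak_solution_ext T w z w' z' :
  (forall t, 0 <= t -> t <= T -> w' t = w t /\ z' t = z t) ->
  weak T w z -> weak T w' z'.
Proof.
move=> e [wc [w_ [z_ [ws wz]]]]; split.
  apply: (@subspace_eq_continuous _ `[0, T]%classic _ (fun t => (w t, z t))
    (fun t => (w' t, z' t)) _ wc) => t; rewrite inE /= in_itv/= => /andP[t0 tT].
  by have [e1 e2] := e t t0 tT; rewrite /= e1 e2.
exists w_, z_; split => //; apply/uniform_cvgP => eps eps0.
move/uniform_cvgP : wz => /(_ eps eps0); apply: filterS => n h t tT.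
have := tT; rewrite /= in_itv/= => /andP[t0 tT'].
by have [-> ->] := e t t0 tT'; exact: h.
Qed.

Lemma weak_solutionW S T w z : S <= T -> weak T w z -> weak S w z.
Proof.
move=> ST [wc [w_ [z_ [ws wz]]]].
have sub : (`[0, S]%classic : set R) `<=` `[0, T]%classic.
  by move=> t; rewrite /= !in_itv/= => /andP[-> /le_trans]; apply.
split; first exact: continuous_subspaceW sub wc.
exists w_, z_; split => [n|]; first exact: strong_solutionW (ws n).
apply/uniform_cvgP => eps eps0.
move/uniform_cvgP : wz => /(_ eps eps0); apply: filterS => n h t tT.
exact/h/sub.
Qed.

Lemma weak_solution_bounded T w z : weak T w z ->
  exists2 c, 0 <= c & forall t, 0 <= t -> t <= T -> `|shift M w z t| <= c.
Proof.
move=> [wc _]; have [c c0 hc] := within_continuous_bounded wc.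
have [m m0 hm] := lipschitz_ball M_diff M_lip c0.
exists (c + (c + (m * c + `|M 0|))).
  by rewrite !addr_ge0// mulr_ge0.
move=> t t0 tT; have := hc t t0 tT; rewrite pair_norm ge_max => /andP[wt zt].
rewrite (le_trans (hprod_norm_le _))// lerD//= (le_trans (ler_normB _ _))// lerD//.
rewrite -[M (w t)](subrK (M 0)) (le_trans (ler_normD _ _))// lerD2r.
by rewrite (le_trans (hm _ _ wt _)) ?normr0// subr0 ler_wpM2l.
Qed.

(** The gap between [c] and [r] leaves room for the approximations: those close
    enough to the solution stay in the ball where truncation is the identity. *)
Lemma weak_solution_limit r c T w z : 0 <= c -> c < r -> weak T w z ->
  (forall t, 0 <= t -> t <= T -> `|shift M w z t| <= c) ->
  limtraj r T (shift M w z).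
Proof.
move=> c0 cr [wc [w_ [z_ [ws wz]]]] hc; have r0 := le_lt_trans c0 cr.
have [m m0 hm] := lipschitz_ball M_diff M_lip (ltW (addr_gt0 r0 ltr01)).
apply: limit_trajectoryI => e e0.
pose e' := Num.min 1 (Num.min (e / (2 + m)) ((r - c) / (2 + m))).
have m2 : 0 < 2 + m by rewrite ltr_wpDr.
have e'0 : 0 < e' by rewrite !lt_min ltr01 !divr_gt0// subr_gt0.
have e'1 : e' <= 1 by rewrite ge_min lexx.
have e'e : (2 + m) * e' <= e by rewrite mulrC -ler_pdivlMr// !ge_min lexx orbT.
have e'r : (2 + m) * e' <= r - c by rewrite mulrC -ler_pdivlMr// !ge_min lexx !orbT.
move/uniform_cvgP : wz => /(_ e' e'0)[N _ /(_ N (leqnn N)) hN].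
have dist t : 0 <= t -> t <= T -> `|shift M w z t - shift M (w_ N) (z_ N) t| <= (2 + m) * e'.
  move=> t0 tT; have := hN t; rewrite /= in_itv/= t0 tT => /(_ isT).
  rewrite [(_, _) - _](_ : _ = (w t - w_ N t, z t - z_ N t))// pair_norm gt_max.
  move=> /andP[/ltW wN /ltW zN].
  have wr : `|w t| <= r.
    by rewrite (le_trans (hprod_norm1 (shift M w z t)))// (le_trans (hc t t0 tT))// ltW.
  have wNr : `|w_ N t| <= r + 1.
    rewrite -[w_ N t](subKr (w t)) (le_trans (ler_normB _ _))// lerD//.
    exact: le_trans wN e'1.
  rewrite (le_trans (hprod_norm_le _))//=.
  have -> : z t - M (w t) - (z_ N t - M (w_ N t)) = (z t - z_ N t) - (M (w t) - M (w_ N t)).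
    by apply: inner_inj => v; rewrite !innerE; ring.
  have hM : `|M (w t) - M (w_ N t)| <= m * e'.
    by rewrite (le_trans (hm _ _ _ wNr)) ?ler_wpM2l// (le_trans wr)// lerDl.
  have := ler_normB (z t - z_ N t) (M (w t) - M (w_ N t)).
  lra.
exists (shift M (w_ N) (z_ N)).
  apply: (strong_solution_trajectory M_diff M_lip M_eq r0 (ws N)) => t t0 tT.
  rewrite -[X in `|X|](subKr (shift M w z t)) (le_trans (ler_normB _ _))//.
  have := dist t t0 tT; have := hc t t0 tT; lra.
by move=> t t0 tT; rewrite (le_trans (dist t t0 tT)).
Qed.

Lemma limit_weak_solution r c T u : 0 <= T -> 0 < r -> c < r -> limtraj r T u ->
  (forall t, 0 <= t -> t <= T -> `|u t| <= c) ->
  weak T (fun t => (u t).1) (unshift M u).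
Proof.
move=> T0 r0 cr lu hc; have [m m0 hm] := lipschitz_ball M_diff M_lip (ltW r0).
have uc := limit_trajectory_continuous lu.
have [u_ [e [us e0 ue]]] := lu.
split.
  apply/subspace_continuousP => t tT; move/subspace_continuousP : uc => /(_ t tT) uc.
  have u1 : (u s).1 @[s --> within `[0, T] (nbhs t)] --> (u t).1.
    exact: cvg_hprod1 uc.
  have u2 : (u s).2 @[s --> within `[0, T] (nbhs t)] --> (u t).2.
    exact: cvg_hprod2 uc.
  have uM : M (u s).1 @[s --> within `[0, T] (nbhs t)] --> M (u t).1.
    have Mc : {for (u t).1, continuous M} by exact/differentiable_continuous/M_diff.
    exact: (cvg_comp _ _ u1 Mc).
  exact: (cvg_pair u1 (cvgD u2 uM)).
have [N _ hN] : \forall n \near \oo, e n <= r - c.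
  by move/cvgr_le : e0; apply; rewrite subr_gt0.
have ub n t : 0 <= t -> t <= T -> `|u_ (n + N)%N t| <= r.
  move=> t0 tT; rewrite -[u_ _ t](subKr (u t)) (le_trans (ler_normB _ _))//.
  have := hN (n + N)%N (leq_addl _ _); have := ue (n + N)%N t t0 tT.
  by have := hc t t0 tT; rewrite /=; lra.
exists (fun n t => (u_ (n + N)%N t).1), (fun n => unshift M (u_ (n + N)%N)).
split => [n|].
  apply: (trajectory_strong_solution M_diff M_lip M_eq r0 (us _)) => t t0 tT.
  exact: ub.
apply/uniform_cvgP => eps eps0.
have m1 : 0 < 1 + m by rewrite ltr_wpDr.
have [K _ hK] : \forall n \near \oo, e n <= eps / 2 / (1 + m).
  by move/cvgr_le : e0; apply; rewrite !divr_gt0.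
exists K => // n /= Kn t; rewrite /= in_itv/= => /andP[t0 tT].
have en : (1 + m) * e (n + N)%N <= eps / 2.
  by rewrite mulrC -ler_pdivlMr// hK//= (leq_trans Kn)// leq_addr.
have un := ue (n + N)%N t t0 tT.
rewrite [(_, _) - _](_ : _ = ((u t).1 - (u_ (n + N)%N t).1,
  unshift M u t - unshift M (u_ (n + N)%N) t))//.
rewrite pair_norm gt_max.
have h1 := le_trans (hprod_norm1 (u t - u_ (n + N)%N t)) un.
have h2 := le_trans (hprod_norm2 (u t - u_ (n + N)%N t)) un.
rewrite /= in h1 h2.
have en0 : 0 <= e (n + N)%N by exact: le_trans un.
have p : 0 <= m * e (n + N)%N by rewrite mulr_ge0.
have h3 : `|unshift M u t - unshift M (u_ (n + N)%N) t| <= (1 + m) * e (n + N)%N.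
  rewrite /unshift opprD addrACA (le_trans (ler_normD _ _))// mulrDl mul1r lerD//.
  rewrite (le_trans (hm _ _ _ _)) ?ler_wpM2l//.
    by rewrite (le_trans (hprod_norm1 _))// (le_trans (hc t t0 tT))// ltW.
  by rewrite (le_trans (hprod_norm1 _))// ub.
by apply/andP; split; lra.
Qed.

End weak_solutions.

(** * Uniqueness, continuation and growth *)

Section maximal_solutions.
Context {R : realType} {H Z U : hilbertType R}.
Variables (DA : set H) (A : H -> H) (B : {linear U -> H}) (C : H -> Z).
Variables (M : H -> Z) (d : H) (yref : Z).
Hypothesis DA_dense : dense DA.
Hypothesis A_maxmono : maximal_monotone (op_graph DA A).
Hypothesis B_bounded : bounded_linear B.
Hypothesis M_diff : forall w, differentiable M w.
Hypothesis M_lip : diff_locally_lipschitz M.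
Hypothesis M_eq : forall w, DA w -> 'd M w (A w) + C w = 0.
Implicit Types (r T : R) (w : R -> H) (z : R -> Z) (u : R -> hprod H Z).

Local Notation strong := (strong_solution DA A B C M d yref).
Local Notation weak := (weak_solution DA A B C M d yref).
Local Notation field := (truncated_field B M d yref).
Local Notation traj r := (strong_trajectory (lift_dom DA) (lift_op A) (field r)).
Local Notation limtraj r := (limit_trajectory (lift_dom DA) (lift_op A) (field r)).

Lemma truncated_trajectory_unique r T u v t : 0 < r -> limtraj r T u -> limtraj r T v ->
  u 0 = v 0 -> 0 <= t -> t <= T -> u t = v t.
Proof.
move=> r0 lu lv uv t0 tT.
have [L L0 FL] := truncated_field_lipschitz d yref B_bounded M_diff M_lip r0.
have := limit_trajectory_stable (lift_m_monotone (Z := Z) A_maxmono) FL lu lv t0 tT.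
by rewrite uv subrr normr0 mulr0 normr_le0 subr_eq0 => /eqP.
Qed.

Lemma truncated_trajectory_exists r x : 0 < r ->
  exists u, [/\ u 0 = x, (forall T, limtraj r T u) &
                lift_dom DA x -> forall T, traj r T u].
Proof.
move=> r0.
have [L L0 FL] := truncated_field_lipschitz d yref B_bounded M_diff M_lip r0.
exact: (trajectory_exists (lift_m_monotone A_maxmono) L0 FL x (lift_dom_dense DA_dense)).
Qed.

Lemma weak_solution_unique T w z w' z' t : weak T w z -> weak T w' z' ->
  w' 0 = w 0 -> z' 0 = z 0 -> 0 <= t -> t <= T -> w' t = w t /\ z' t = z t.
Proof.
move=> wz wz' ew ez t0 tT.
have [c c0 hc] := weak_solution_bounded M_diff M_lip wz.
have [c' c'0 hc'] := weak_solution_bounded M_diff M_lip wz'.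
pose r := c + c' + 1.
have r0 : 0 < r by rewrite ltr_wpDl// addr_ge0.
have cr : c < r by rewrite /r; lra.
have c'r : c' < r by rewrite /r; lra.
have l1 := weak_solution_limit M_diff M_lip M_eq c0 cr wz hc.
have l2 := weak_solution_limit M_diff M_lip M_eq c'0 c'r wz' hc'.
have e0 : shift M w' z' 0 = shift M w z 0 by rewrite /shift ew ez.
have := truncated_trajectory_unique r0 l2 l1 e0 t0 tT.
by rewrite /shift => -[-> /addIr ->].
Qed.

(** On [0, T] the solution coincides with the trajectory of a truncated system,
    which is strong because its initial value lies in the domain. *)
Lemma weak_solution_strong T w z : 0 <= T -> weak T w z -> DA (w 0) -> strong T w z.
Proof.
move=> T0 wz Dw.
have [c c0 hc] := weak_solution_bounded M_diff M_lip wz.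
have cr : c < c + 1 by rewrite ltrDl.
have r0 := le_lt_trans c0 cr.
have l1 := weak_solution_limit M_diff M_lip M_eq c0 cr wz hc.
have [u [u0 lu su]] := truncated_trajectory_exists (shift M w z 0) r0.
have ue t : 0 <= t -> t <= T -> shift M w z t = u t.
  by move=> t0 tT; apply: (truncated_trajectory_unique r0 l1 (lu T)).
apply: strong_solution_ext (trajectory_strong_solution M_diff M_lip M_eq r0 (su Dw T) _).
  by move=> t t0 tT; rewrite /unshift -ue//= subrK.
by move=> t t0 tT; rewrite -ue// (le_trans (hc t t0 tT))// ltW.
Qed.

Lemma truncated_trajectory_extend r c T u : 0 < r -> c < r -> 0 <= T ->
  (forall S, limtraj r S u) -> (forall t, 0 <= t -> t <= T -> `|u t| <= c) ->
  exists2 S, T < S & weak S (fun t => (u t).1) (unshift M u).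
Proof.
move=> r0 cr T0 lu hc; pose c' := (c + r) / 2.
have c'r : c' < r by rewrite /c'; lra.
have e0 : 0 < c' - c by rewrite /c'; lra.
have /subspace_continuousP /(_ T) := limit_trajectory_continuous (lu (T + 1)).
rewrite /= in_itv/= T0 lerDl ler01 => /(_ isT) /cvgrPdist_lt /(_ _ e0).
rewrite near_withinE => /nbhs_ballP[e /= e'0 he].
pose S := T + Num.min 1 (e / 2).
have m0 : 0 < Num.min 1 (e / 2) by rewrite lt_min ltr01 divr_gt0.
have TS : T < S by rewrite ltrDl.
exists S => //; apply: (limit_weak_solution M_diff M_lip M_eq _ r0 c'r (lu S)).
  exact: le_trans (ltW TS).
move=> t t0 tS; have [tT|Tt] := leP t T.
  by rewrite (le_trans (hc t t0 tT)) ?/c'; lra.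
have := he t; rewrite -ball_normE /ball_ /= in_itv/= t0 => h.
have tS1 : t <= T + 1 by rewrite (le_trans tS)// lerD2l ge_min lexx.
have tSe : t <= T + e / 2 by rewrite (le_trans tS)// lerD2l ge_min lexx orbT.
have te : `|T - t| < e by rewrite ltr0_norm ?subr_lt0// opprB; lra.
have := h te tS1; rewrite distrC => /ltW h2.
rewrite -(subrK (u T) (u t)) (le_trans (ler_normD _ _))//.
by have := hc T T0 (lexx _); lra.
Qed.

Lemma weak_solution_exists (w0 : H) (z0 : Z) :
  exists T w z, [/\ 0 < T, weak T w z, w 0 = w0 & z 0 = z0].
Proof.
pose x : hprod H Z := (w0, z0 - M w0).
have r0 : 0 < `|x| + 1 by rewrite ltr_wpDl.
have [u [u0 lu _]] := truncated_trajectory_exists x r0.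
have cr : `|x| < `|x| + 1 by rewrite ltrDl.
have [|S S0 ws] := truncated_trajectory_extend r0 cr (lexx 0) lu.
  by move=> t t0 t0'; rewrite (_ : t = 0) ?u0//; apply/le_anti; rewrite t0 t0'.
exists S, (fun t => (u t).1), (unshift M u); split => //; first by rewrite u0.
by rewrite /unshift u0 /= subrK.
Qed.

(** Before [T] the solution coincides with the trajectory of a truncated system,
    which is defined at all times and still lies in the interior of the ball of
    truncation at [T]. *)
Lemma bounded_weak_solution_extend c T w z : 0 < T ->
  (forall S, 0 < S -> S < T -> weak S w z) ->
  (forall t, 0 <= t -> t < T -> `|shift M w z t| <= c) ->
  exists S w' z', [/\ T < S, weak S w' z' &
    forall t, 0 <= t -> t < T -> w' t = w t /\ z' t = z t].
Proof.
move=> T0 wz hc.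
have c0 : 0 <= c by apply: le_trans (hc 0 (lexx 0) T0).
have cr : c < c + 1 by rewrite ltrDl.
have r0 := le_lt_trans c0 cr.
have [u [u0 lu _]] := truncated_trajectory_exists (shift M w z 0) r0.
have ue t : 0 <= t -> t < T -> u t = shift M w z t.
  move=> t0 tT; pose S := (t + T) / 2.
  have S0 : 0 < S by rewrite /S; lra.
  have ST : S < T by rewrite /S; lra.
  have tS : t <= S by rewrite /S; lra.
  have lw := weak_solution_limit M_diff M_lip M_eq c0 cr (wz S S0 ST)
    (fun t t0 tS => hc t t0 (le_lt_trans tS ST)).
  exact: (truncated_trajectory_unique r0 (lu S) lw u0 t0 tS).
have uT : `|u T| <= c.
  apply/ler_addgt0Pr => e e0.
  have /subspace_continuousP /(_ T) := limit_trajectory_continuous (lu T).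
  rewrite /= in_itv/= (ltW T0) lexx => /(_ isT) /cvgrPdist_lt /(_ _ e0).
  rewrite near_withinE => /nbhs_ballP[e' /= e'0 he].
  pose t := T - Num.min T (e' / 2).
  have m0 : 0 < Num.min T (e' / 2) by rewrite lt_min T0 divr_gt0.
  have t0 : 0 <= t by rewrite subr_ge0 ge_min lexx.
  have tT : t < T by rewrite gtrBl.
  have := he t; rewrite -ball_normE /ball_ /= in_itv/= t0 (ltW tT) /= => h.
  have te : `|T - t| < e'.
    rewrite /t subKr gtr0_norm// gt_min; apply/orP; right; lra.
  have := h te isT => h2.
  rewrite -(subrK (u t) (u T)) (le_trans (ler_normD _ _))// addrC lerD//; last exact: ltW.
  by rewrite ue// hc.
have [|S TS ws] := truncated_trajectory_extend r0 cr (ltW T0) lu.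
  move=> t t0; rewrite le_eqVlt => /predU1P[->//|tT].
  by rewrite ue// hc.
exists S, (fun t => (u t).1), (unshift M u); split => // t t0 tT.
by rewrite /unshift ue//= subrK.
Qed.

Lemma weak_solution_extend T w z : 0 < T -> weak T w z ->
  exists S w' z', [/\ T < S, weak S w' z', w' 0 = w 0 & z' 0 = z 0].
Proof.
move=> T0 wz; have [c c0 hc] := weak_solution_bounded M_diff M_lip wz.
have [|t t0 /ltW|S [w' [z' [TS ws e]]]] := @bounded_weak_solution_extend c T w z T0.
- by move=> S S0 /ltW ST; exact: weak_solutionW wz.
- exact: hc.
- by exists S, w', z'; have [ew ez] := e 0 (lexx _) T0.
Qed.

(** The growth bound behind forward completeness. With [q] the control
    [B^* dM(w)^* eta], the terms [<B q, w>] and [- |q|^2] combine to at most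
    [|B|^2 |w|^2], and the term [- <dM(w) d, eta>] grows quadratically. *)
Lemma energy_growth (kappa : R) : monotone_graph (op_graph DA A) ->
  DA 0 -> A 0 = 0 -> 0 <= kappa ->
  (forall x : H, `|'d M x d| <= kappa * (1 + `|x|)) ->
  exists2 K, 0 <= K & forall x : hprod H Z, DA x.1 ->
    2 * inner (shifted_field B M d yref x - lift_op A x) x <= K * (1 + `|x| ^+ 2).
Proof.
move=> Am D0 A0 k0 dk; have [b b0 hb] := bounded_linear_ge0 B_bounded.
exists (2 * (b ^+ 2 + `|d| + 2 * kappa + `|yref|)).
  by rewrite mulr_ge0// !addr_ge0// ?sqr_ge0// mulr_ge0.
move=> x Dx; set w := x.1; set y := x.2.
have [m m0 hm] := diff_bounded (M_diff w).
pose p := adjoint ('d M w) y; pose q := adjoint B p.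
have lB := linear_map_linear B; have lM := linear_map_linear ('d M w).
have dMBq : inner ('d M w (B q)) y = `|q| ^+ 2.
  rewrite innerC -(adjointP _ lM hm) -/p -(adjointP _ lB hb) -/q.
  exact: inner_normE.
have mono : 0 <= inner (A w) w.
  have := Am (w, A w) (0, A 0); rewrite /= A0 !subr0; apply.
    by exists w.
  by exists 0 => //; rewrite A0.
have E : inner (shifted_field B M d yref x - lift_op A x) x =
    inner (B q) w + inner d w - inner (A w) w - `|q| ^+ 2 - inner ('d M w d) y - inner yref y.
  rewrite inner_hprodE /= /feedback -/w -/y -/p -/q subr0.
  by rewrite linearD !innerE dMBq; ring.
have wx : `|w| <= `|x| by exact: hprod_norm1.
have yx : `|y| <= `|x| by exact: hprod_norm2.
have i1 : inner (B q) w <= b * `|q| * `|w|.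
  by rewrite (le_trans (inner_le _ _))// ler_wpM2r.
have i1' : b * `|q| * `|w| <= `|q| ^+ 2 + b ^+ 2 * `|w| ^+ 2.
  have := sqr_ge0 (`|q| - b * `|w| / 2); have := sqr_ge0 (b * `|w|).
  by move: `|q| `|w| => a c; lra.
have w2 : `|w| ^+ 2 <= `|x| ^+ 2 by rewrite ler_pXn2r ?nnegrE.
have i2 : inner d w <= `|d| * `|x| by rewrite (le_trans (inner_le _ _))// ler_wpM2l.
have i3 : - inner ('d M w d) y <= kappa * (1 + `|x|) * `|x|.
  rewrite -innerNl (le_trans (inner_le _ _))// normrN ler_pM//.
  by rewrite (le_trans (dk w))// ler_wpM2l// lerD2l.
have i4 : - inner yref y <= `|yref| * `|x|.
  by rewrite -innerNl (le_trans (inner_le _ _))// normrN ler_wpM2l.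
have x2 : `|x| <= 1 + `|x| ^+ 2 by have := sqr_ge0 (`|x| - 1); move: `|x| => a; nra.
have j1 : `|d| * `|x| <= `|d| * (1 + `|x| ^+ 2) by rewrite ler_wpM2l.
have j2 : `|yref| * `|x| <= `|yref| * (1 + `|x| ^+ 2) by rewrite ler_wpM2l.
have j3 : kappa * (1 + `|x|) * `|x| <= kappa * (2 * (1 + `|x| ^+ 2)).
  by rewrite -mulrA ler_wpM2l// mulrDl mul1r -expr2; lra.
have j4 : b ^+ 2 * `|w| ^+ 2 <= b ^+ 2 * (1 + `|x| ^+ 2).
  by rewrite ler_wpM2l ?sqr_ge0//; lra.
rewrite E -mulrA ler_pM2l//; lra.
Qed.

Lemma strong_trajectory_growth r T K u t : 0 < r -> 0 <= K ->
  (forall x : hprod H Z, DA x.1 ->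
    2 * inner (shifted_field B M d yref x - lift_op A x) x <= K * (1 + `|x| ^+ 2)) ->
  traj r T u -> (forall t, 0 <= t -> t <= T -> `|u t| <= r) -> 0 <= t -> t <= T ->
  1 + `|u t| ^+ 2 <= expR (K * t) * (1 + `|u 0| ^+ 2).
Proof.
move=> r0 K0 HK /strong_trajectoryW + ur t0 tT => /(_ _ tT)[ac uD ae].
have acf : absolutely_continuous 0 t (fun s => 1 + `|u s| ^+ 2).
  apply: (absolutely_continuous_dominated (c := 2 * r) _ ac ac); first by rewrite mulr_ge0// ltW.
  move=> a b a0 ab bt; have b0 := le_trans a0 ab.
  have -> : 1 + `|u b| ^+ 2 - (1 + `|u a| ^+ 2) = (`|u b| + `|u a|) * (`|u b| - `|u a|) by ring.
  rewrite normrM; apply: ler_pM => //.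
    rewrite ger0_norm ?addr_ge0//; have := ur a a0 (le_trans ab (le_trans bt tT)).
    have := ur b b0 (le_trans bt tT); lra.
  rewrite (le_trans (ler_dist_dist _ _))//.
  by have := normr_ge0 (b - a); have := normr_ge0 (u b - u a); lra.
have := absolutely_continuous_gronwall (K := K) t0 acf; rewrite subr0; apply.
apply: ae_impl ae => s us st; have du := us st.
have [s0 sT] : 0 <= s /\ s <= t by move: st; rewrite in_itv/= => /andP[/ltW ? /ltW ?].
exists (0 + 2 * inner (field r (u s) - lift_op A (u s)) (u s)).
  have D := is_deriveD (is_derive_cst (1 : R) s (1 : R)) (is_derive_normsq du).
  exact: D.
rewrite add0r truncated_field_id//; first by apply: HK; exact: (uD s s0 sT).
exact: (ur s s0 (le_trans sT tT)).
Qed.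

Lemma weak_solution_growth T K w z t : 0 <= K ->
  (forall x : hprod H Z, DA x.1 ->
    2 * inner (shifted_field B M d yref x - lift_op A x) x <= K * (1 + `|x| ^+ 2)) ->
  weak T w z -> 0 <= t -> t <= T ->
  `|shift M w z t| ^+ 2 <= expR (K * t) * (1 + `|shift M w z 0| ^+ 2).
Proof.
move=> K0 HK wz t0 tT; have [c c0 hc] := weak_solution_bounded M_diff M_lip wz.
have cr : c < c + 1 by rewrite ltrDl.
have r0 : 0 < c + 2 by lra.
have [v_ [e [vs e0 ve]]] := weak_solution_limit M_diff M_lip M_eq c0 (ltac:(lra) : c < c + 2) wz hc.
set u := shift M w z in hc ve *.
have cv s : 0 <= s -> s <= T -> v_ n s @[n --> \oo] --> u s.
  move=> s0 sT; apply/cvgrPdist_lt => eps eps0.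
  move/cvgrPdist_lt : e0 => /(_ _ eps0); apply: filterS => n.
  rewrite sub0r normrN; apply: le_lt_trans.
  by apply: le_trans (ve n s s0 sT) _; exact: ler_norm.
have cv2 s : 0 <= s -> s <= T -> 1 + `|v_ n s| ^+ 2 @[n --> \oo] --> 1 + `|u s| ^+ 2.
  move=> s0 sT; apply: cvgD; first exact: cvg_cst.
  under eq_fun do rewrite expr2; rewrite expr2.
  by apply: cvgM; apply: cvg_norm; exact: cv.
have T0 := le_trans t0 tT.
have : 1 + `|u t| ^+ 2 <= expR (K * t) * (1 + `|u 0| ^+ 2).
  apply: (@ler_cvg_to _ \oo _ _ (fun n => 1 + `|v_ n t| ^+ 2)
    (fun n => expR (K * t) * (1 + `|v_ n 0| ^+ 2))).
  - exact: cv2.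
  - by apply: cvgM; [exact: cvg_cst|exact: cv2].
  - have [N _ hN] : \forall n \near \oo, e n <= 1.
      by move/cvgr_le : e0; apply; rewrite ltr01.
    exists N => // n /= Nn.
    apply: (strong_trajectory_growth r0 K0 HK (vs n)) => // s s0 sT.
    rewrite -[v_ n s](subKr (u s)) (le_trans (ler_normB _ _))//.
    have := hN n Nn; have := ve n s s0 sT; have := hc s s0 sT; rewrite /=; lra.
lra.
Qed.

End maximal_solutions.

(** * Maximal solutions *)

Section main.
Context {R : realType} {H Z U : hilbertType R}.
Variables (DA : set H) (A : H -> H) (B : {linear U -> H}) (C : H -> Z).
Variables (M : H -> Z) (d : H) (yref : Z).
Hypothesis DA_dense : dense DA.
Hypothesis A_maxmono : maximal_monotone (op_graph DA A).
Hypothesis B_bounded : bounded_linear B.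
Hypothesis M_diff : forall w, differentiable M w.
Hypothesis M_lip : diff_locally_lipschitz M.
Hypothesis M_eq : forall w, DA w -> 'd M w (A w) + C w = 0.
Implicit Types (r T : R) (w : R -> H) (z : R -> Z).

Local Notation weak := (weak_solution DA A B C M d yref).
Local Notation maximal := (maximal_weak_solution DA A B C M d yref).

Lemma weak_solution_upto_agree (Tm Tm' : \bar R) w z w' z' :
  weak_solution_upto DA A B C M d yref Tm w z ->
  weak_solution_upto DA A B C M d yref Tm' w' z' ->
  w' 0 = w 0 -> z' 0 = z 0 -> (Tm <= Tm')%E ->
  agree_upto Tm w w' z z'.
Proof.
move=> wz wz' ew ez TT t; rewrite le_eqVlt => /predU1P[<- //|t0] tT.
by apply: (weak_solution_unique A_maxmono B_bounded M_diff M_lip M_eq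
  (wz t t0 tT) (wz' t t0 (lt_le_trans tT TT)) ew ez (ltW t0) (lexx t)).
Qed.

(** By uniqueness the solutions on compact intervals glue together; the result
    is maximal since [weak_solution_extend] continues any solution. *)
Lemma maximal_weak_solution_exists (w0 : H) (z0 : Z) :
  exists Tm w z, [/\ maximal Tm w z, w 0 = w0 & z 0 = z0].
Proof.
pose I := [set T : R | 0 < T /\ exists w z, [/\ weak T w z, w 0 = w0 & z 0 = z0]].
pose Tm := ereal_sup (EFin @` I).
have ITm T : I T -> (T%:E <= Tm)%E by move=> IT; apply: ereal_sup_ubound; exists T.
have TmI (t : R) : (t%:E < Tm)%E -> exists2 T, I T & t < T.
  by move=> /ereal_sup_gt[_ [T IT <-]]; rewrite lte_fin => tT; exists T.
have /choice[p pP] : forall t : R, exists p : H * Z, 0 <= t -> (t%:E < Tm)%E ->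
    exists T w z, [/\ t < T, weak T w z, w 0 = w0, z 0 = z0 & p = (w t, z t)].
  move=> t; have [[t0 tT]|nt] := pselect (0 <= t /\ (t%:E < Tm)%E); last first.
    by exists (w0, z0) => t0 tT; case: nt.
  have [T [T0 [w [z [wz ew ez]]]] lT] := TmI t tT.
  by exists (w t, z t) => _ _; exists T, w, z.
have [T1 [w1 [z1 [T10 wz1 ew1 ez1]]]] := @weak_solution_exists R H Z U
  DA A B C M d yref DA_dense A_maxmono B_bounded M_diff M_lip M_eq w0 z0.
have Tm0 : (0 < Tm)%E.
  by apply: (@lt_le_trans _ _ T1%:E); [rewrite lte_fin|apply: ITm; split => //; exists w1, z1].
pose w t := (p t).1; pose z t := (p t).2.
have sol T w' z' : weak T w' z' -> w' 0 = w0 -> z' 0 = z0 ->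
    forall t, 0 <= t -> t <= T -> (t%:E < Tm)%E -> w t = w' t /\ z t = z' t.
  move=> wz' ew ez t t0 tT tTm.
  have [S [w2 [z2 [tS wz2 ew2 ez2 e]]]] := pP t t0 tTm.
  rewrite /w /z e /=.
  apply: (weak_solution_unique A_maxmono B_bounded M_diff M_lip M_eq
    (weak_solutionW tT wz') (weak_solutionW (ltW tS) wz2)) => //.
  - by rewrite ew ew2.
  - by rewrite ez ez2.
have wz0 : w 0 = w0 /\ z 0 = z0.
  by have [-> ->] := sol _ _ _ wz1 ew1 ez1 0 (lexx _) (ltW T10) Tm0.
exists Tm, w, z; split; [|exact: wz0.1|exact: wz0.2]; split => //.
- move=> T T0 TTm; have [S [S0 [w' [z' [wz' ew ez]]]] TS] := TmI T TTm.
  apply: weak_solution_ext (weak_solutionW (ltW TS) wz') => t t0 tT.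
  apply: (sol _ _ _ wz' ew ez t t0 (le_trans tT (ltW TS))).
  by rewrite (le_lt_trans _ TTm)// lee_fin.
- move=> [T [w' [z' [TmT wz' ag]]]].
  have T0 : 0 < T by rewrite -lte_fin (lt_le_trans Tm0).
  have [ew ez] := ag 0 (lexx _) Tm0.
  have [S [w2 [z2 [TS wz2 ew2 ez2]]]] := weak_solution_extend
    DA_dense A_maxmono B_bounded M_diff M_lip M_eq T0 wz'.
  have : (S%:E <= T%:E)%E.
    apply: le_trans TmT; apply: ITm; split; first exact: lt_trans TS.
    exists w2, z2; split => //; first by rewrite ew2 ew wz0.1.
    by rewrite ez2 ez wz0.2.
  by rewrite lee_fin leNgt TS.
Qed.

Lemma maximal_weak_solution_unique (Tm Tm' : \bar R) w z w' z' :
  maximal Tm w z -> maximal Tm' w' z' -> w' 0 = w 0 -> z' 0 = z 0 ->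
  Tm' = Tm /\ agree_upto Tm w w' z z'.
Proof.
have le (S S' : \bar R) a b a' b' : maximal S a b -> maximal S' a' b' ->
    a' 0 = a 0 -> b' 0 = b 0 -> (S' <= S)%E.
  move=> [S0 ab nS] [S'0 ab' _] ea eb; rewrite leNgt; apply/negP => SS'.
  have ag := weak_solution_upto_agree ab ab' ea eb (ltW SS').
  case: S S0 SS' ab ag nS => // [T|]; last by move=> _; rewrite ltNge leey.
  rewrite lte_fin => T0 TS' _ ag; apply; exists T, a', b'; split => //.
  exact: ab' T T0 TS'.
move=> mw mw' ew ez.
have TT : (Tm' <= Tm)%E by exact: le mw mw' ew ez.
have TT' : (Tm <= Tm')%E by exact: le mw' mw (esym ew) (esym ez).
split; first by apply/le_anti; rewrite TT TT'.
by have [_ a _] := mw; have [_ b _] := mw'; exact: weak_solution_upto_agree a b ew ez TT'.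
Qed.

Lemma maximal_weak_solution_bounded (Tm : R) c w z : maximal Tm%:E w z ->
  (forall t, 0 <= t -> t < Tm -> `|shift M w z t| <= c) -> False.
Proof.
rewrite /maximal_weak_solution lte_fin => -[T0 wz nT] hc.
have wS S : 0 < S -> S < Tm -> weak S w z by move=> S0 ST; apply: wz; rewrite ?lte_fin.
have [S [w' [z' [TS ws e]]]] := bounded_weak_solution_extend
  DA_dense A_maxmono B_bounded M_diff M_lip M_eq T0 wS hc.
apply: nT; exists S, w', z'; split => //; by rewrite lee_fin ltW.
Qed.

End main.

Theorem theorem3p1 (R : realType) (H Z U : hilbertType R)
    (DA : set H) (A : H -> H) (B : {linear U -> H})
    (DC : set H) (C : H -> Z) (M : H -> Z)
    (DA_dense : dense DA)
    (A_maxmono : maximal_monotone (op_graph DA A))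
    (DA0 : DA 0) (A0 : A 0 = 0)
    (B_bounded : bounded_linear B)
    (DC_subspace : linear_subspace DC) (DC_dense : dense DC)
    (DA_sub_DC : DA `<=` DC) (C_linear : linear_on DC C)
    (A_strong : strongly_monotone DA A)
    (M_C1 : continuously_differentiable M)
    (M0 : M 0 = 0)
    (M_eq : forall w, DA w -> 'd M w (A w) + C w = 0)
    (M_lip : diff_locally_lipschitz M) :
  (forall (d : H) (yref : Z) (w0 : H) (z0 : Z),
     exists (Tmax : \bar R) (w : R -> H) (z : R -> Z),
       [/\ maximal_weak_solution DA A B C M d yref Tmax w z,
           w 0 = w0, z 0 = z0 &
           forall (Tmax' : \bar R) (w' : R -> H) (z' : R -> Z),
             maximal_weak_solution DA A B C M d yref Tmax' w' z' ->
             w' 0 = w0 -> z' 0 = z0 ->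
             Tmax' = Tmax /\ agree_upto Tmax w w' z z']) /\
  (forall (d : H) (yref : Z) (w0 : H) (z0 : Z)
      (Tmax : \bar R) (w : R -> H) (z : R -> Z),
     maximal_weak_solution DA A B C M d yref Tmax w z ->
     w 0 = w0 -> z 0 = z0 -> DA w0 ->
     strong_solution_upto DA A B C M d yref Tmax w z) /\
  (forall (d : H) (yref : Z),
     d = 0 \/ diff_globally_lipschitz M ->
     forward_complete DA A B C M d yref).
Proof.
have M_diff := M_C1.1.
split=> [d yref w0 z0|].
  have [Tm [w [z [mw ew ez]]]] := maximal_weak_solution_exists
    d yref DA_dense A_maxmono B_bounded M_diff M_lip M_eq w0 z0.
  exists Tm, w, z; split => // Tm' w' z' mw' ew' ez'.
  apply: (maximal_weak_solution_unique A_maxmono B_bounded M_diff M_lip M_eq mw mw').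
    by rewrite ew ew'.
  by rewrite ez ez'.
split=> [d yref w0 z0 Tm w z [Tm0 wz _] ew ez Dw0 T T0 TTm|d yref hd w0 z0 Tm w z mw ew ez].
  apply: (weak_solution_strong DA_dense A_maxmono B_bounded M_diff M_lip M_eq
    (ltW T0) (wz T T0 TTm)).
  by rewrite ew.
have [kappa k0 dk] : exists2 kappa, 0 <= kappa &
    forall x : H, `|'d M x d| <= kappa * (1 + `|x|).
  case: hd => [->|gl].
    by exists 0 => // x; rewrite linear0 normr0 mul0r.
  have [m m0 hm] := diff_lipschitz_bounded M_diff (I : [set: H] 0) gl.
  exists (m * `|d|) => [|x]; first by rewrite mulr_ge0.
  by rewrite mulrAC; exact: hm.
have [K K0 HK] := energy_growth yref B_bounded M_diff A_maxmono.1 DA0 A0 k0 dk.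
case: Tm mw => [T mw|//|[]]; last by rewrite ltNge leNye.
exfalso; have [T0 wz _] := mw; rewrite lte_fin in T0.
pose c := 1 + expR (K * T) * (1 + `|shift M w z 0| ^+ 2).
apply: (maximal_weak_solution_bounded DA_dense A_maxmono B_bounded M_diff M_lip M_eq mw
  (c := c)) => t t0 tT.
have q0 : 0 <= 1 + `|shift M w z 0| ^+ 2 by rewrite addr_ge0// sqr_ge0.
have ht : `|shift M w z t| ^+ 2 <= expR (K * T) * (1 + `|shift M w z 0| ^+ 2).
  pose S := (t + T) / 2.
  have wS : weak_solution DA A B C M d yref S w z.
    by apply: wz; rewrite ?lte_fin /S; lra.
  have tS : t <= S by rewrite /S; lra.
  apply: le_trans (weak_solution_growth M_diff M_lip M_eq K0 HK wS t0 tS) _.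
  by rewrite ler_wpM2r// ler_expR ler_wpM2l// ltW.
have := sqr_ge0 (`|shift M w z t| - 1); rewrite /c.
by move: `|shift M w z t| ht => a; nra.
Qed.
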